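(* Let $1\leq n\leq N-1$. For all $\varepsilon>0$, there exists $\varepsilon_*=\varepsilon_*(\varepsilon,n)>0$ with the following property. Suppose that for some $x\in\mathbb{R}^n$ and $r>0$ a map $f:\mathbb{R}^N\rightarrow\mathbb{R}^N$ has the properties that $f|_{\mathbb{R}^n}$ is $\varepsilon_*$-almost affine over $B^n(x,9r)$, $f|_{B^N(x,3r)}$ is a topological embedding and $\widetilde{H}_f(B^N(x,3r))\leq \varepsilon_*$, and suppose there exist a closed set $E\subset B^n(x,r)$ and constants $\gamma_E>0$ and $C_E>0$ such that $$\operatorname{diam} E \geq \gamma_E \operatorname{diam} B^n(x,r)$$ and $$\int_{0}^{r} \widetilde{H}_f(B^N(y,s))^2\, \frac{ds}{s}\leq C_E\quad\text{for all }y\in E.$$ Then there exists a quasisymmetric map $F:\mathbb{R}^n\rightarrow\mathbb{R}^N$ such that $F|_E= f|_E$, $F$ is $\varepsilon$-almost affine over $\mathbb{R}^n$, $\widetilde{H}_F(\mathbb{R}^n)\leq \varepsilon$, $$C^{-1}\operatorname{diam} f(B^n(x,r))\le\operatorname{diam} F(B^n(x,r))\leq C \operatorname{diam} f(B^n(x,r)),$$ and $$\int_0^{\infty} \beta_{F(\mathbb{R}^n)}(F(y),s)^2\, \frac{ds}{s}\leq C'\,(C_E+\varepsilon^2)\quad\text{for all }y\in \mathbb{R}^n,$$ where $C=C(n,N,\gamma_E)<\infty$ depends only on $n$, $N$, $\gamma_E$ and $C'=C'(n,N)<\infty$ depends only on $n$ and $N$.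
   Context: $\mathbb{R}^n$ is identified with the subspace $\mathbb{R}^n\times\{0\}^{N-n}$ of $\mathbb{R}^N$. $B^n(x,r)$ and $B^N(x,r)$ denote closed balls in $\mathbb{R}^n$ and $\mathbb{R}^N$. For a set $X$ contained in the domain of a map $f$ into $\mathbb{R}^N$, the weak quasisymmetry constant $H_f(X)\in[1,\infty]$ is the least constant such that for all $x,y,a\in X$, $|x-a|\leq|y-a|$ implies $|f(x)-f(a)|\leq H_f(X)|f(y)-f(a)|$; $\widetilde H_f(X):=H_f(X)-1$. A topological embedding $F$ is quasisymmetric if there is an increasing homeomorphism $\eta:(0,\infty)\to(0,\infty)$ such that $|a-x|\le t|b-x|$ implies $|F(a)-F(x)|\le\eta(t)|F(b)-F(x)|$ for all $a,b,x$ in the domain and $t>0$. For $\Sigma\subset\mathbb{R}^N$, $p\in\Sigma$ and $s>0$, $\beta_\Sigma(p,s):=\inf_{V}\frac1s\sup_{q\in\Sigma\cap B^N(p,s)}\operatorname{dist}(q,V)$, the infimum over all $n$-dimensional affine planes $V$ in $\mathbb{R}^N$. For an affine map $A:\mathbb{R}^n\to\mathbb{R}^N$, $A'$ denotes its linear part and $\|A'\|$ the operator norm. A family of affine maps over $G\subset\mathbb{R}^n$ is an indexed set $\mathcal{A}=\{A_{x,r}:x\in G,r>0\}$ of affine maps $A_{x,r}:\mathbb{R}^n\to\mathbb{R}^N$. It is $\varepsilon$-compatible if $\|A'_{x,r}-A'_{y,s}\|\leq\varepsilon\min\{\|A'_{x,r}\|,\|A'_{y,s}\|\}$ for all $x,y\in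 G$ and $r,s>0$ with $|x-y|\leq\max\{r,s\}$ and $1/2\leq r/s\leq2$. For $G\subset X\subset\mathbb{R}^n$, a map $g:X\to\mathbb{R}^N$ is $\varepsilon$-almost affine over $G$ if there is an $\varepsilon$-compatible family $\mathcal{A}$ of affine maps over $G$ such that $\sup_{z\in G\cap B^n(x,r)}|g(z)-A_{x,r}(z)|\leq\varepsilon\|A'_{x,r}\|r$ for all $x\in G$, $r>0$. *)

(* Defs.v *)
From HB Require Import structures.
From mathcomp Require Import all_boot all_order all_algebra.
From mathcomp Require Import all_classical all_reals all_analysis.

Set Implicit Arguments.
Unset Strict Implicit.
Unset Printing Implicit Defensive.

Import Order.TTheory GRing.Theory Num.Theory.
Import numFieldTopology.Exports numFieldNormedType.Exports.

Local Open Scope classical_set_scope.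
Local Open Scope ring_scope.

(* R^m is the type 'rV[R]_m.  The library's norm on row vectors is the sup
   norm, so the Euclidean norm and its closed balls are defined here; the two
   norms induce the same topology, hence the library's [continuous], [closed],
   etc. on 'rV[R]_m are the intended ones. *)
Definition enorm (R : realType) (m : nat) (v : 'rV[R]_m) : R :=
  Num.sqrt (\sum_(i < m) v ord0 i ^+ 2).

Definition eball (R : realType) (m : nat) (x : 'rV[R]_m) (r : R) :
  set 'rV[R]_m := [set y | enorm (y - x) <= r].

(* [maxe 0] only matters for the empty set, which gets diameter 0. *)
Definition ediam (R : realType) (m : nat) (A : set 'rV[R]_m) : \bar R :=
  maxe 0%E (ereal_sup [set (enorm (x - y))%:E | x in A & y in A]).

(* The identification of R^n with R^n x {0}^(N-n), for n <= N: [pid_mx n] has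
   n rows and N columns, so this pads [x] with N - n zeros. *)
Definition plane_incl (R : realType) (n N : nat) (x : 'rV[R]_n) : 'rV[R]_N :=
  x *m (pid_mx n : 'M[R]_(n, N)).

Definition topological_embedding (T U : topologicalType) (X : set T)
    (f : T -> U) : Prop :=
  {within X, continuous f} /\
  exists g : U -> T,
    {in X, cancel f g} /\ {within f @` X, continuous g}.

(* The infimum of the empty set is +oo. *)
Definition weak_qs_const (R : realType) (m N : nat) (f : 'rV[R]_m -> 'rV[R]_N)
    (X : set 'rV[R]_m) : \bar R :=
  ereal_inf [set H%:E | H in [set H : R | 1 <= H /\
    forall x y a : 'rV[R]_m, X x -> X y -> X a -> enorm (x - a) <= enorm (y - a) ->
      enorm (f x - f a) <= H * enorm (f y - f a)]].

Definition weak_qs_excess (R : realType) (m N : nat) (f : 'rV[R]_m -> 'rV[R]_N)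
    (X : set 'rV[R]_m) : \bar R :=
  (weak_qs_const f X - 1)%E.

Definition increasing_homeo_pos (R : realType) (eta : R -> R) : Prop :=
  [/\ topological_embedding (`]0, +oo[ : set R) eta,
      eta @` `]0, +oo[%classic = `]0, +oo[%classic
    & {in `]0, +oo[ &, {homo eta : s t / s < t}}].

Definition quasisymmetric (R : realType) (m N : nat) (X : set 'rV[R]_m)
    (F : 'rV[R]_m -> 'rV[R]_N) : Prop :=
  topological_embedding X F /\
  exists eta : R -> R, increasing_homeo_pos eta /\
    forall (a b x : 'rV[R]_m) (t : R), X a -> X b -> X x -> 0 < t ->
      enorm (a - x) <= t * enorm (b - x) ->
      enorm (F a - F x) <= eta t * enorm (F b - F x).

Definition edist_to (R : realType) (N : nat) (q : 'rV[R]_N) (V : set 'rV[R]_N) :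
  \bar R := ereal_inf [set (enorm (q - v))%:E | v in V].

Definition affine_plane (R : realType) (N n : nat) (V : set 'rV[R]_N) : Prop :=
  exists (p : 'rV[R]_N) (W : {vspace 'rV[R]_N}),
    \dim W = n /\ V = [set q | q - p \in W].

Definition beta_number (R : realType) (N n : nat) (Sigma : set 'rV[R]_N)
    (p : 'rV[R]_N) (s : R) : \bar R :=
  ereal_inf [set ((s^-1)%:E *
                  ereal_sup [set edist_to q V | q in Sigma `&` eball p s])%E
            | V in affine_plane n].

(* Row vectors are acted on from the right, so the linear part of an affine map
   R^n -> R^N is an n x N matrix. *)
Record affine_map (R : realType) (n N : nat) := AffineMap {
  linear_part : 'M[R]_(n, N);
  translation_part : 'rV[R]_N }.

Definition affine_eval (R : realType) (n N : nat) (A : affine_map R n N)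
    (z : 'rV[R]_n) : 'rV[R]_N :=
  z *m linear_part A + translation_part A.

Coercion affine_eval : affine_map >-> Funclass.

Definition op_norm (R : realType) (n N : nat) (M : 'M[R]_(n, N)) : R :=
  sup [set enorm (v *m M) | v in [set v : 'rV[R]_n | enorm v <= 1]].

(* A family {A_{x,r} : x in G, r > 0} is given by a total function; its values
   outside G x (0, oo) are irrelevant. *)
Definition compatible_family (R : realType) (n N : nat) (eps : R)
    (G : set 'rV[R]_n) (A : 'rV[R]_n -> R -> affine_map R n N) : Prop :=
  forall (x y : 'rV[R]_n) (r s : R), G x -> G y -> 0 < r -> 0 < s ->
    enorm (x - y) <= Num.max r s -> 1 / 2 <= r / s <= 2 ->
    op_norm (linear_part (A x r) - linear_part (A y s)) <=
      eps * Num.min (op_norm (linear_part (A x r)))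
                    (op_norm (linear_part (A y s))).

Definition almost_affine (R : realType) (n N : nat) (eps : R)
    (G : set 'rV[R]_n) (g : 'rV[R]_n -> 'rV[R]_N) : Prop :=
  exists A : 'rV[R]_n -> R -> affine_map R n N,
    compatible_family eps G A /\
    forall (x : 'rV[R]_n) (r : R), G x -> 0 < r ->
      (ereal_sup [set (enorm (g z - A x r z))%:E | z in G `&` eball x r]
        <= (eps * op_norm (linear_part (A x r)) * r)%:E)%E.

(* Main.v *)
Require Import Defs.
From HB Require Import structures.
From mathcomp Require Import all_boot all_order all_algebra.
From mathcomp Require Import all_classical all_reals all_analysis.
From mathcomp Require Import measurable_realfun ring lra zify.

(** The map [F] is a smoothing of [f] on many scales that leaves [E] fixed.

At mesh size [h], the restriction of [f] to the n-plane is replaced by the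
quadratic spline quasi-interpolant [spline], whose value at a point is a convex
combination of values of [f] at grid points at distance O(h), and which
reproduces affine maps. Whatever affine estimate holds for [f] near a point, such
as closeness to an affine map or to a hyperplane, therefore passes to the
interpolant, and the second-order Taylor remainder of the interpolant at scale
[h] is controlled by the distance from [f] to an affine map at that scale.
The function [extension] blends the interpolants of mesh 2^-k by cutoffs that
equal 1 at distance much less than 2^-k from [E] and vanish at distance much more
than 2^-k. Near a point z only the meshes comparable to dist(z, E) matter, and
far from [E] only a fixed affine map [A0] is left. This gives three regimes for
[F] at a point y and a scale s. Below dist(y, E), the map is smooth with
remainder quadratic in s ([smooth_approx]). Between dist(y, E) and the radius r,
its values are convex combinations of values of [f] at points at distance O(s)
([F_convex]). Above r, it differs from [A0] by a bounded amount ([F_far]).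

The hypothesis on the weak quasisymmetry constant makes every affine map in sight
almost conformal ([near_conformal]). Hence, at all points and scales, [F] is close
to an almost conformal affine map; this is the predicate [flat]. Almost affinity
and weak quasisymmetry follow at once, and quasisymmetry follows because the norms
of the linear parts at scales s and s' differ at most by a small power of s'/s
([flat_ratio]).

For the beta numbers, a vector e normal to the n-plane makes y + t e and y - t e
equidistant from each point of the plane. Weak quasisymmetry then puts the image
of the plane near the bisector of the images of these two points, with an error
linear in the excess of the constant over 1; intersecting the bisectors over an
orthonormal family of normals gives [image_near_plane]. Convexity transfers this
bound to [F] in the middle regime, where the integral hypothesis sums the squares.
In the other two regimes the beta numbers decay geometrically away from dist(y, E)
and from r. Since scales in the image are scales in the domain times norms of
linear parts, the logarithmic integral is compared with a sum over dyadic scales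
of the domain ([log_integral_le], [flat_beta_integral], [beta_integral]).

Finally, [f] and [F] are both close to [A0] on the ball of radius r, so the
diameters of the two images of this ball are comparable ([near_A0_diam]). *)

Set Implicit Arguments.
Unset Strict Implicit.
Unset Printing Implicit Defensive.

Import Order.TTheory GRing.Theory Num.Theory.
Import numFieldTopology.Exports numFieldNormedType.Exports.

Local Open Scope classical_set_scope.
Local Open Scope ring_scope.

(** * Euclidean norm and operator norm *)

Section Euclid.
Variable R : realType.
Implicit Types (m n N : nat).

Lemma enorm_ge0 m (v : 'rV[R]_m) : 0 <= enorm v.
Proof. exact: sqrtr_ge0. Qed.

Lemma enorm_sqr m (v : 'rV[R]_m) : enorm v ^+ 2 = \sum_(i < m) v ord0 i ^+ 2.
Proof. by rewrite sqr_sqrtr // sumr_ge0 // => i _; exact: sqr_ge0. Qed.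

Lemma ler_sqr2 (a b : R) : 0 <= b -> a ^+ 2 <= b ^+ 2 -> a <= b.
Proof. nra. Qed.

Lemma enorm0 m : enorm (0 : 'rV[R]_m) = 0.
Proof.
by rewrite /enorm big1 ?sqrtr0 // => i _; rewrite mxE expr0n.
Qed.

Lemma enormN m (v : 'rV[R]_m) : enorm (- v) = enorm v.
Proof. by congr Num.sqrt; apply: eq_bigr => i _; rewrite mxE sqrrN. Qed.

Lemma enormZ m (a : R) (v : 'rV[R]_m) : enorm (a *: v) = `|a| * enorm v.
Proof.
rewrite /enorm -sqrtr_sqr -sqrtrM ?sqr_ge0 // mulr_sumr.
by congr Num.sqrt; apply: eq_bigr => i _; rewrite mxE exprMn.
Qed.

Lemma enorm_distC m (v w : 'rV[R]_m) : enorm (v - w) = enorm (w - v).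
Proof. by rewrite -enormN opprB. Qed.

Lemma coord_le_enorm m (v : 'rV[R]_m) i : `|v ord0 i| <= enorm v.
Proof.
apply: ler_sqr2; first exact: enorm_ge0.
rewrite enorm_sqr real_normK ?num_real // (bigD1 i) //= lerDl.
by apply: sumr_ge0 => j _; exact: sqr_ge0.
Qed.

Lemma enorm_eq0 m (v : 'rV[R]_m) : enorm v = 0 -> v = 0.
Proof.
move=> v0; apply/rowP => i; rewrite mxE; apply/eqP.
by rewrite -normr_le0 -v0; exact: coord_le_enorm.
Qed.

Lemma enorm_gt0 m (v : 'rV[R]_m) : v != 0 -> 0 < enorm v.
Proof.
by move=> v0; rewrite lt0r enorm_ge0 andbT; apply: contra_neq v0 => /enorm_eq0.
Qed.

Definition edot m (v w : 'rV[R]_m) : R := \sum_(i < m) v ord0 i * w ord0 i.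

Lemma edotC m (v w : 'rV[R]_m) : edot v w = edot w v.
Proof. by apply: eq_bigr => i _; rewrite mulrC. Qed.

Lemma edotDl m (u v w : 'rV[R]_m) : edot (u + v) w = edot u w + edot v w.
Proof. by rewrite -big_split; apply: eq_bigr => i _ /=; rewrite mxE mulrDl. Qed.

Lemma edotNl m (v w : 'rV[R]_m) : edot (- v) w = - edot v w.
Proof. by rewrite -sumrN; apply: eq_bigr => i _; rewrite mxE mulNr. Qed.

Lemma edotZl m a (v w : 'rV[R]_m) : edot (a *: v) w = a * edot v w.
Proof. by rewrite mulr_sumr; apply: eq_bigr => i _; rewrite mxE mulrA. Qed.

Lemma edotBl m (u v w : 'rV[R]_m) : edot (u - v) w = edot u w - edot v w.
Proof. by rewrite edotDl edotNl. Qed.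

Lemma edotBr m (u v w : 'rV[R]_m) : edot w (u - v) = edot w u - edot w v.
Proof. by rewrite edotC edotBl !(edotC w). Qed.

Lemma edotvv m (v : 'rV[R]_m) : edot v v = enorm v ^+ 2.
Proof. by rewrite enorm_sqr; apply: eq_bigr => i _; rewrite expr2. Qed.

Lemma edot_mulmx m (v w : 'rV[R]_m) : v *m w^T = (edot v w)%:M.
Proof.
apply/matrixP => i j; rewrite !ord1 !mxE eqxx mulr1n.
by apply: eq_bigr => k _; rewrite mxE.
Qed.

Lemma edot_sqr_le m (v w : 'rV[R]_m) : edot v w ^+ 2 <= enorm v ^+ 2 * enorm w ^+ 2.
Proof.
rewrite -2!edotvv.
have [w0|w0] := eqVneq w 0.
  by rewrite w0 /edot (eq_bigr (fun=> 0)) ?sumr_const ?mul0rn ?expr0n ?mulr_ge0 //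
    ?sumr_ge0 // => i _; rewrite ?mxE ?mulr0 // -expr2 sqr_ge0.
have ww : 0 < edot w w by rewrite edotvv exprn_gt0 // enorm_gt0.
have : 0 <= edot (edot w w *: v - edot v w *: w) (edot w w *: v - edot v w *: w).
  by rewrite edotvv sqr_ge0.
rewrite !edotBl !edotBr !(edotZl, edotC _ (_ *: _)) (edotC w v).
set a := edot v v; set b := edot w w in ww *; set c := edot v w => H.
have : 0 <= b * (a * b - c ^+ 2).
  by apply: le_trans H _; rewrite le_eqVlt; apply/orP; left; apply/eqP; ring.
by rewrite pmulr_rge0 // subr_ge0.
Qed.

Lemma edot_le m (v w : 'rV[R]_m) : `|edot v w| <= enorm v * enorm w.
Proof.
apply: ler_sqr2; first by rewrite mulr_ge0 ?enorm_ge0.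
by rewrite real_normK ?num_real // exprMn edot_sqr_le.
Qed.

Lemma enormD m (v w : 'rV[R]_m) : enorm (v + w) <= enorm v + enorm w.
Proof.
apply: ler_sqr2; first by rewrite addr_ge0 ?enorm_ge0.
rewrite -edotvv edotDl !(edotC _ (v + w)) !edotDl !edotvv (edotC w v).
have := edot_le v w; rewrite ler_norml => /andP[_]; nra.
Qed.

Lemma enormB m (v w : 'rV[R]_m) : enorm (v - w) <= enorm v + enorm w.
Proof. by rewrite -(enormN w) enormD. Qed.

Lemma enorm_distD m (u v w : 'rV[R]_m) :
  enorm (v - w) <= enorm (v - u) + enorm (u - w).
Proof. by rewrite -[v in v - w](subrK u) -addrA enormD. Qed.

Lemma enorm_sum m (I : Type) (s : seq I) (P : pred I) (F : I -> 'rV[R]_m) :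
  enorm (\sum_(i <- s | P i) F i) <= \sum_(i <- s | P i) enorm (F i).
Proof.
elim/big_rec2 : _ => [|i y x _ h]; first by rewrite enorm0.
by apply: le_trans (enormD _ _) _; rewrite lerD2l.
Qed.

Lemma enorm_le_sum m (v : 'rV[R]_m) : enorm v <= \sum_(i < m) `|v ord0 i|.
Proof.
rewrite {1}[v]row_sum_delta; apply: le_trans (enorm_sum _ _ _) _.
apply: ler_sum => i _; rewrite enormZ ler_piMr //.
rewrite /enorm (bigD1 i) //= mxE !eqxx big1 ?addr0 ?expr1n ?sqrtr1 // => j ji.
by rewrite mxE (negbTE ji) andbF expr0n.
Qed.

Lemma enorm_le_coords m (v : 'rV[R]_m) (a : R) :
  (forall i, `|v ord0 i| <= a) -> enorm v <= m%:R * a.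
Proof.
move=> H; apply: le_trans (enorm_le_sum v) _.
apply: le_trans (ler_sum _ (fun i _ => H i)) _.
by rewrite sumr_const card_ord mulr_natl.
Qed.

(** The sup norm carries the topology, so each norm has to bound the other. *)
Lemma mx_norm_le_enorm m (v : 'rV[R]_m) : `|v| <= enorm v.
Proof.
rewrite /Num.norm /= mx_normrE; apply: bigmax_le; first exact: enorm_ge0.
by move=> [i j] _ /=; rewrite ord1 coord_le_enorm.
Qed.

Lemma enorm_le_mx_norm m (v : 'rV[R]_m) : enorm v <= m%:R * `|v|.
Proof.
apply: enorm_le_coords => i.
by rewrite {2}/Num.norm /= mx_normrE (le_bigmax _ (fun ij => `|v ij.1 ij.2|) (ord0, i)).
Qed.

Lemma enorm_le_bound_mul m N (M : 'M[R]_(m, N)) :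
  exists2 c, 0 <= c & forall v, enorm (v *m M) <= c * enorm v.
Proof.
exists (\sum_(i < m) enorm (row i M)) => [|v]; first by apply: sumr_ge0 => i _; exact: enorm_ge0.
rewrite mulmx_sum_row; apply: le_trans (enorm_sum _ _ _) _.
rewrite mulr_suml; apply: ler_sum => i _.
by rewrite enormZ mulrC ler_wpM2l ?enorm_ge0 ?coord_le_enorm.
Qed.

Lemma op_norm_has_sup m N (M : 'M[R]_(m, N)) :
  has_sup [set enorm (v *m M) | v in [set v : 'rV[R]_m | enorm v <= 1]].
Proof.
split; first by exists (enorm ((0 : 'rV_m) *m M)), 0 => //=; rewrite enorm0.
have [c c0 cM] := enorm_le_bound_mul M.
exists c => _ [v /= v1 <-]; apply: le_trans (cM v) _.
by rewrite ler_piMr.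
Qed.

Lemma op_norm_ge0 m N (M : 'M[R]_(m, N)) : 0 <= op_norm M.
Proof.
apply: (ub_le_sup (op_norm_has_sup M).2).
by exists 0; rewrite /= ?enorm0 // mul0mx enorm0.
Qed.

Lemma op_normP m N (M : 'M[R]_(m, N)) v : enorm (v *m M) <= op_norm M * enorm v.
Proof.
have [->|v0] := eqVneq v 0; first by rewrite mul0mx !enorm0 mulr0.
have vp := enorm_gt0 v0.
rewrite -ler_pdivrMr // mulrC -[X in X * _]ger0_norm ?invr_ge0 ?enorm_ge0 //.
rewrite -enormZ scalemxAl; apply: (ub_le_sup (op_norm_has_sup M).2).
exists ((enorm v)^-1 *: v) => //=.
by rewrite enormZ ger0_norm ?invr_ge0 ?enorm_ge0 // mulVf // gt_eqF.
Qed.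

Lemma op_norm_le m N (M : 'M[R]_(m, N)) (c : R) :
  (forall v, enorm v <= 1 -> enorm (v *m M) <= c) -> op_norm M <= c.
Proof.
move=> H; apply: ge_sup; first exact: (op_norm_has_sup M).1.
by move=> _ [v /= v1 <-]; exact: H.
Qed.

Lemma op_norm_distC m N (M M' : 'M[R]_(m, N)) : op_norm (M - M') = op_norm (M' - M).
Proof.
apply/eqP; rewrite eq_le; apply/andP; split; apply: op_norm_le => v v1;
 rewrite -enormN -mulmxN opprB; apply: le_trans (op_normP _ _) _;
 by rewrite ler_piMr // op_norm_ge0.
Qed.

Lemma op_normD m N (M M' : 'M[R]_(m, N)) : op_norm (M + M') <= op_norm M + op_norm M'.
Proof.
apply: op_norm_le => v v1; rewrite mulmxDr; apply: le_trans (enormD _ _) _.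
have := op_normP M v; have := op_normP M' v.
have := op_norm_ge0 M; have := op_norm_ge0 M'; have := enorm_ge0 v; nra.
Qed.

Lemma exists_unit m : (0 < m)%N -> exists v : 'rV[R]_m, enorm v = 1.
Proof.
case: m => // m _; exists (delta_mx 0 0).
rewrite /enorm (bigD1 ord0) //= mxE !eqxx big1 ?addr0 ?expr1n ?sqrtr1 // => j ji.
by rewrite mxE (negbTE ji) andbF expr0n.
Qed.

End Euclid.

(** * The quadratic B-spline *)

Section Spline1.
Variable R : realType.
Implicit Types (t u d : R).

(** The centred quadratic B-spline is the third difference of the truncated square
[sqpos]. The two functions below it are primitives for summation over integer
translates: [bspline u] and [u * bspline u] are their differences, so the sums that
express partition of unity and reproduction of linear functions telescope. *)
Definition sqpos t : R := if 0 <= t then t ^+ 2 else 0.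

Definition pos_part t : R := if 0 <= t then t else 0.

Lemma pos_cases t :
  [/\ 0 <= t, pos_part t = t & sqpos t = t ^+ 2] \/ [/\ t <= 0, pos_part t = 0 & sqpos t = 0].
Proof.
rewrite /pos_part /sqpos; case: (lerP 0 t) => t0; [left|right]; split=> //.
exact: ltW.
Qed.

Definition bspline u : R :=
  (sqpos (u + 3 / 2) - 3 * sqpos (u + 1 / 2) + 3 * sqpos (u - 1 / 2)
   - sqpos (u - 3 / 2)) / 2.

Definition bspline_prim u : R := (sqpos (u + 1) - 2 * sqpos u + sqpos (u - 1)) / 2.

Definition bspline_moment_prim u : R :=
  ((u - 1 / 2) * sqpos (u + 1) - 2 * u * sqpos u + (u + 1 / 2) * sqpos (u - 1)) / 2.

Lemma bspline_prim_diff u :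
  bspline u = bspline_prim (u + 1 / 2) - bspline_prim (u - 1 / 2).
Proof.
rewrite /bspline_prim /bspline.
have -> : u + 1 / 2 + 1 = u + 3 / 2 by field.
have -> : u + 1 / 2 - 1 = u - 1 / 2 by field.
have -> : u - 1 / 2 + 1 = u + 1 / 2 by field.
have -> : u - 1 / 2 - 1 = u - 3 / 2 by field.
by field.
Qed.

Lemma bspline_moment_prim_diff u :
  u * bspline u = bspline_moment_prim (u + 1 / 2) - bspline_moment_prim (u - 1 / 2).
Proof.
rewrite /bspline_moment_prim /bspline.
have -> : u + 1 / 2 + 1 = u + 3 / 2 by field.
have -> : u + 1 / 2 - 1 = u - 1 / 2 by field.
have -> : u - 1 / 2 + 1 = u + 1 / 2 by field.
have -> : u - 1 / 2 - 1 = u - 3 / 2 by field.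
by field.
Qed.

Lemma bspline_prim_ge1 u : 1 <= u -> bspline_prim u = 1.
Proof.
move=> u1; rewrite /bspline_prim /sqpos !ifT; lra.
Qed.

Lemma bspline_prim_leN1 u : u <= -1 -> bspline_prim u = 0.
Proof.
move=> u1; rewrite /bspline_prim /sqpos.
have -> : (0 <= u) = false by apply/negbTE; rewrite -ltNge; lra.
have -> : (0 <= u - 1) = false by apply/negbTE; rewrite -ltNge; lra.
case: leP => h; last by field.
have -> : u = -1 by lra.
by field.
Qed.

Lemma bspline_prim01 u : 0 <= bspline_prim u <= 1.
Proof.
rewrite /bspline_prim.
case: (pos_cases (u + 1)) => -[? _ ->]; case: (pos_cases u) => -[? _ ->];
  case: (pos_cases (u - 1)) => -[? _ ->]; apply/andP; split; nra.
Qed.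

Lemma bspline_moment_prim_out u : 1 <= `|u| -> bspline_moment_prim u = 0.
Proof.
move=> u1; rewrite /bspline_moment_prim /sqpos.
have [u0|u0] := leP 0 u.
  by rewrite ger0_norm // in u1; rewrite !ifT; nra.
rewrite ltr0_norm // in u1.
have -> : (0 <= u - 1) = false by apply/negbTE; rewrite -ltNge; lra.
case: leP => h; last by field.
have -> : u = -1 by lra.
by field.
Qed.

Lemma bspline_ge0 u : 0 <= bspline u.
Proof.
rewrite /bspline.
case: (pos_cases (u + 3 / 2)) => -[? _ ->]; case: (pos_cases (u + 1 / 2)) => -[? _ ->];
  case: (pos_cases (u - 1 / 2)) => -[? _ ->]; case: (pos_cases (u - 3 / 2)) => -[? _ ->];
  nra.
Qed.

Lemma bspline_out u : 3 / 2 <= `|u| -> bspline u = 0.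
Proof.
move=> h; rewrite bspline_prim_diff; have [u0|u0] := leP 0 u.
  by rewrite ger0_norm // in h; rewrite !bspline_prim_ge1 ?subrr //; lra.
by rewrite ltr0_norm // in h; rewrite !bspline_prim_leN1 ?subrr //; lra.
Qed.

Lemma bspline_le1 u : bspline u <= 1.
Proof.
rewrite bspline_prim_diff.
have := bspline_prim01 (u + 1 / 2); have := bspline_prim01 (u - 1 / 2); lra.
Qed.

(** The truncated square has a Lipschitz derivative although it is not twice
differentiable; this is all the smoothness that the splines inherit. *)
Lemma sqpos_taylor t d : 0 <= sqpos (t + d) - sqpos t - 2 * pos_part t * d <= d ^+ 2.
Proof.
case: (pos_cases (t + d)) => -[? _ ->]; case: (pos_cases t) => -[? -> ->];
  apply/andP; split; nra.
Qed.

Definition bspline_deriv u : R :=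
  pos_part (u + 3 / 2) - 3 * pos_part (u + 1 / 2) + 3 * pos_part (u - 1 / 2) - pos_part (u - 3 / 2).

Lemma bspline_deriv_le u : `|bspline_deriv u| <= 4.
Proof.
rewrite /bspline_deriv ler_norml.
case: (pos_cases (u + 3 / 2)) => -[? -> _]; case: (pos_cases (u + 1 / 2)) => -[? -> _];
  case: (pos_cases (u - 1 / 2)) => -[? -> _]; case: (pos_cases (u - 3 / 2)) => -[? -> _];
  apply/andP; split; lra.
Qed.

Lemma bspline_taylor u d :
  `|bspline (u + d) - bspline u - bspline_deriv u * d| <= 4 * d ^+ 2.
Proof.
rewrite /bspline /bspline_deriv ler_norml !(addrAC u d).
have := sqpos_taylor (u + 3 / 2) d; have := sqpos_taylor (u + 1 / 2) d.
have := sqpos_taylor (u - 1 / 2) d; have := sqpos_taylor (u - 3 / 2) d.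
move=> /andP[? ?] /andP[? ?] /andP[? ?] /andP[? ?].
by apply/andP; split; nra.
Qed.

Lemma telescope_shift (m : nat) (phi : R -> R) t :
  \sum_(j < m) (phi (t - j%:R + 1 / 2) - phi (t - j%:R - 1 / 2)) =
  phi (t + 1 / 2) - phi (t - m%:R + 1 / 2).
Proof.
rewrite -(big_mkord xpredT (fun j => phi (t - j%:R + 1 / 2) - phi (t - j%:R - 1 / 2))).
rewrite (eq_bigr (fun j => - phi (t - j.+1%:R + 1 / 2) - (- phi (t - j%:R + 1 / 2)))).
  by rewrite telescope_sumr // opprK addrC subr0.
move=> j _; have -> : t - j.+1%:R + 1 / 2 = t - j%:R - 1 / 2 by rewrite -natr1; field.
by rewrite opprK addrC.
Qed.

Lemma bspline_sum (m : nat) t : 0 <= t + 1 / 2 - 1 -> t - m%:R + 1 / 2 <= -1 ->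
  \sum_(j < m) bspline (t - j%:R) = 1.
Proof.
move=> h1 h2; under eq_bigr do rewrite bspline_prim_diff.
by rewrite telescope_shift bspline_prim_ge1 ?bspline_prim_leN1 ?subr0 //; lra.
Qed.

Lemma bspline_sum_le (m : nat) t : \sum_(j < m) bspline (t - j%:R) <= 1.
Proof.
under eq_bigr do rewrite bspline_prim_diff.
rewrite telescope_shift.
have := bspline_prim01 (t + 1 / 2); have := bspline_prim01 (t - m%:R + 1 / 2); lra.
Qed.

Lemma bspline_moment_sum (m : nat) t : 0 <= t + 1 / 2 - 1 -> t - m%:R + 1 / 2 <= -1 ->
  \sum_(j < m) (t - j%:R) * bspline (t - j%:R) = 0.
Proof.
move=> h1 h2; under eq_bigr do rewrite bspline_moment_prim_diff.
rewrite telescope_shift !bspline_moment_prim_out ?subrr //.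
  by rewrite ler0_norm; lra.
by rewrite ger0_norm; lra.
Qed.

(** The identity clamped to an interval of length 6, up to an additive constant. *)
Definition ramp u : R := pos_part (u + 5 / 2) - pos_part (u - 7 / 2).

(** The number of integer translates of a window of length 5 that contain a
given point is bounded by the total increase 6 of [ramp], which grows by 1
across each such window. *)
Lemma count_window (m : nat) t :
  \sum_(j < m) ((`|t - j%:R| < 5 / 2)%R)%:R <= 6 :> R.
Proof.
apply: (@le_trans _ _ (\sum_(j < m)
   (ramp (t + 1 / 2 - j%:R + 1 / 2) - ramp (t + 1 / 2 - j%:R - 1 / 2)))).
  apply: ler_sum => j _.
  have -> : t + 1 / 2 - j%:R - 1 / 2 = t - j%:R by field.
  have -> : t + 1 / 2 - j%:R + 1 / 2 = t - j%:R + 1 by field.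
  set s := t - _; rewrite /ramp ltr_norml.
  case: (boolP (_ && _)) => [/andP[h1 h2]|_] /=;
  case: (pos_cases (s + 1 + 5 / 2)) => -[? -> _]; case: (pos_cases (s + 1 - 7 / 2)) => -[? -> _];
  case: (pos_cases (s + 5 / 2)) => -[? -> _]; case: (pos_cases (s - 7 / 2)) => -[? -> _]; lra.
rewrite telescope_shift /ramp; set a := t + _ + _; set b := t + _ - _ + _.
case: (pos_cases (a + 5 / 2)) => -[? -> _]; case: (pos_cases (a - 7 / 2)) => -[? -> _];
case: (pos_cases (b + 5 / 2)) => -[? -> _]; case: (pos_cases (b - 7 / 2)) => -[? -> _]; lra.
Qed.

End Spline1.

(** * First-order expansions with quadratic remainder *)

Section Taylor.
Variable R : realType.
Implicit Types (n N : nat).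

(** Only the expansion at the single point [z] is required. Measuring increments in
units of [h] lets one constant bound the value, the derivative and the remainder,
which makes the class stable under sums and products. *)
Definition taylor n N (u : 'rV[R]_n -> 'rV[R]_N) (z : 'rV[R]_n) (h M : R) : Prop :=
  enorm (u z) <= M /\
  exists L : 'M[R]_(n, N),
    (forall v, enorm (v *m L) <= M * (enorm v / h)) /\
    (forall v, enorm v <= h ->
       enorm (u (z + v) - u z - v *m L) <= M * (enorm v / h) ^+ 2).

Lemma taylor_ge0 n N (u : 'rV[R]_n -> 'rV[R]_N) z h M : taylor u z h M -> 0 <= M.
Proof. by case=> h1 _; apply: le_trans h1; exact: enorm_ge0. Qed.

Lemma taylor_ext n N (u u' : 'rV[R]_n -> 'rV[R]_N) z h M :
  0 <= h -> (forall v, enorm v <= h -> u (z + v) = u' (z + v)) ->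
  taylor u z h M -> taylor u' z h M.
Proof.
move=> h0 uu'; have e0 := uu' 0; rewrite enorm0 addr0 in e0.
case=> uM [L [L1 L2]]; split; first by rewrite -e0.
by exists L; split=> // v vh; rewrite -e0 // -uu' // L2.
Qed.

Lemma taylor_le n N (u : 'rV[R]_n -> 'rV[R]_N) z h h' M M' :
  0 < h' -> h' <= h -> M <= M' -> taylor u z h M -> taylor u z h' M'.
Proof.
move=> h0 hh MM T; have M0 := taylor_ge0 T; case: T => uM [L [L1 L2]].
have q (v : 'rV[R]_n) : enorm v / h <= enorm v / h'.
  by rewrite ler_wpM2l ?enorm_ge0 // lef_pV2 // ?posrE // (lt_le_trans h0).
have q0 (v : 'rV[R]_n) : 0 <= enorm v / h.
  by rewrite divr_ge0 ?enorm_ge0 // (le_trans (ltW h0)).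
split; first exact: le_trans MM.
exists L; split=> v; first by apply: le_trans (L1 v) _; apply: ler_pM.
move=> vh; apply: le_trans (L2 v (le_trans vh hh)) _.
by apply: ler_pM => //; rewrite ?exprn_ge0 // lerXn2r ?nnegrE // (le_trans (q0 v)).
Qed.

Lemma taylor_cst n N (b : 'rV[R]_N) (z : 'rV[R]_n) h : 0 < h ->
  taylor (fun=> b) z h (enorm b).
Proof.
move=> h0; split=> //; exists 0; split=> v *; rewrite mulmx0 ?subrr ?subr0 enorm0.
  by rewrite mulr_ge0 ?divr_ge0 ?enorm_ge0 // ltW.
by rewrite mulr_ge0 ?exprn_ge0 ?divr_ge0 ?enorm_ge0 // ltW.
Qed.

Lemma taylorD n N (u u' : 'rV[R]_n -> 'rV[R]_N) z h M M' :
  taylor u z h M -> taylor u' z h M' -> taylor (fun y => u y + u' y) z h (M + M').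
Proof.
case=> uM [L [L1 L2]] [uM' [L' [L1' L2']]]; split.
  by apply: le_trans (enormD _ _) _; apply: lerD.
exists (L + L'); split=> v; rewrite mulmxDr => *.
  by apply: le_trans (enormD _ _) _; rewrite mulrDl lerD.
rewrite [X in enorm X](_ : _ = (u (z + v) - u z - v *m L) + (u' (z + v) - u' z - v *m L')).
  by apply: le_trans (enormD _ _) _; rewrite mulrDl lerD ?L2 ?L2'.
by apply/rowP => i; rewrite !mxE; ring.
Qed.

Lemma taylor_sum n N (I : Type) (s : seq I) (u : I -> 'rV[R]_n -> 'rV[R]_N) z h (M : I -> R) :
  0 < h -> (forall i, taylor (u i) z h (M i)) ->
  taylor (fun y => \sum_(i <- s) u i y) z h (\sum_(i <- s) M i).
Proof.
move=> h0 T; elim: s => [|i s IH].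
  rewrite big_nil; apply: (@taylor_ext _ _ (fun=> 0)); first exact: ltW.
    by move=> v _; rewrite big_nil.
  by rewrite -(@enorm0 R N); exact: taylor_cst.
rewrite big_cons; apply: taylor_ext (taylorD (T i) IH); first exact: ltW.
by move=> v _; rewrite big_cons.
Qed.

(** The remainder of a product collects the cross term of the two linear parts
and the terms that contain a remainder; the constant 6 bounds their number. *)
Lemma taylorM n N (c : 'rV[R]_n -> 'rV[R]_1) (u : 'rV[R]_n -> 'rV[R]_N) z h M M' :
  0 < h -> taylor c z h M -> taylor u z h M' ->
  taylor (fun y => c y ord0 ord0 *: u y) z h (6 * M * M').
Proof.
move=> h0 T T'; have M0 := taylor_ge0 T; have M0' := taylor_ge0 T'.
case: T T' => cM [L [L1 L2]] [uM [L' [L1' L2']]].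
have e1 (w : 'rV[R]_1) (a : 'rV[R]_N) : enorm (w ord0 ord0 *: a) = enorm w * enorm a.
  by rewrite enormZ /enorm big_ord1 sqrtr_sqr.
have MM : 0 <= M * M' by rewrite mulr_ge0.
split; first by rewrite e1 -mulrA; apply: (@le_trans _ _ (M * M')); [apply: ler_pM; rewrite ?enorm_ge0|nra].
exists (c z ord0 ord0 *: L' + L *m u z).
have eL v : v *m (c z ord0 ord0 *: L' + L *m u z) =
    c z ord0 ord0 *: (v *m L') + (v *m L) ord0 ord0 *: u z.
  rewrite mulmxDr -scalemxAr mulmxA; congr (_ + _).
  by rewrite {1}[v *m L]mx11_scalar mul_scalar_mx.
split=> v; rewrite eL.
  apply: le_trans (enormD _ _) _; rewrite !e1.
  have t0 : 0 <= enorm v / h by rewrite divr_ge0 ?enorm_ge0 ?ltW.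
  set t := enorm v / h in t0 *.
  have b1 : enorm (c z) * enorm (v *m L') <= M * (M' * t).
    by apply: ler_pM; rewrite ?enorm_ge0 ?L1'.
  have b2 : enorm (v *m L) * enorm (u z) <= M * t * M'.
    by apply: ler_pM; rewrite ?enorm_ge0 ?L1.
  have : 0 <= M * M' * t by rewrite mulr_ge0.
  by move: b1 b2; nra.
move=> vh.
have t0 : 0 <= enorm v / h by rewrite divr_ge0 ?enorm_ge0 ?ltW.
have t1 : enorm v / h <= 1 by rewrite ler_pdivrMr // mul1r.
move: (L1 v) (L1' v) (L2 v vh) (L2' v vh); set t := enorm v / h in t0 t1 *.
set l := v *m L; set l' := v *m L'.
set q := c (z + v) - c z - l; set q' := u (z + v) - u z - l'.
move=> hl hl' hq hq'.
have -> : c (z + v) ord0 ord0 *: u (z + v) - c z ord0 ord0 *: u z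
   - (c z ord0 ord0 *: l' + l ord0 ord0 *: u z) =
   (l ord0 ord0 *: l' + l ord0 ord0 *: q') +
   (c z ord0 ord0 *: q' + q ord0 ord0 *: (u z + l' + q')).
  by apply/rowP => i; rewrite !mxE; ring.
have hu : enorm (u z + l' + q') <= 3 * M'.
  apply: le_trans (enormD _ _) _.
  have := enormD (u z) l'.
  have : M' * t <= M' by rewrite ler_piMr.
  have : M' * t ^+ 2 <= M' by rewrite ler_piMr // expr_le1.
  move: hl' hq' uM; lra.
have t2 : 0 <= t ^+ 2 by rewrite exprn_ge0.
have t3 : t ^+ 3 <= t ^+ 2 by rewrite exprS ler_piMl.
have b1 : enorm (l ord0 ord0 *: l') <= M * M' * t ^+ 2.
  rewrite e1; have -> : M * M' * t ^+ 2 = (M * t) * (M' * t) by ring.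
  by apply: ler_pM; rewrite ?enorm_ge0.
have b2 : enorm (l ord0 ord0 *: q') <= M * M' * t ^+ 2.
  rewrite e1; apply: (@le_trans _ _ ((M * t) * (M' * t ^+ 2))).
    by apply: ler_pM; rewrite ?enorm_ge0.
  have -> : (M * t) * (M' * t ^+ 2) = (M * M') * t ^+ 3 by ring.
  by rewrite ler_wpM2l.
have b3 : enorm (c z ord0 ord0 *: q') <= M * M' * t ^+ 2.
  by rewrite e1 -mulrA; apply: ler_pM; rewrite ?enorm_ge0.
have b4 : enorm (q ord0 ord0 *: (u z + l' + q')) <= 3 * (M * M' * t ^+ 2).
  rewrite e1; have -> : 3 * (M * M' * t ^+ 2) = (M * t ^+ 2) * (3 * M') by ring.
  by apply: ler_pM; rewrite ?enorm_ge0.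
apply: le_trans (enormD _ _) _.
have := enormD (l ord0 ord0 *: l') (l ord0 ord0 *: q').
have := enormD (c z ord0 ord0 *: q') (q ord0 ord0 *: (u z + l' + q')).
by move: b1 b2 b3 b4; rewrite -!mulrA; lra.
Qed.

Lemma taylor_bspline n (i : 'I_n) (g h : R) (z : 'rV[R]_n) : 0 < h ->
  taylor (fun y : 'rV_n => (bspline ((y ord0 i - g) / h))%:M : 'rV[R]_1) z h 4.
Proof.
move=> h0; have h00 := lt0r_neq0 h0.
have e1 (a : R) : enorm (a%:M : 'rV[R]_1) = `|a|.
  by rewrite /enorm big_ord1 mxE eqxx mulr1n sqrtr_sqr.
split.
  rewrite e1 ger0_norm ?bspline_ge0 //; apply: le_trans (bspline_le1 _) _; lra.
set u0 := (z ord0 i - g) / h.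
exists ((bspline_deriv u0 / h) *: delta_mx i ord0).
have eL (v : 'rV[R]_n) : v *m ((bspline_deriv u0 / h) *: delta_mx i ord0) =
   (bspline_deriv u0 * (v ord0 i / h))%:M :> 'rV[R]_1.
  rewrite -scalemxAr -colE; apply/matrixP => a b; rewrite !ord1 !mxE eqxx mulr1n.
  by field.
have hv (v : 'rV[R]_n) : `|v ord0 i / h| <= enorm v / h.
  rewrite normrM normfV (gtr0_norm h0) ler_wpM2r ?coord_le_enorm //. by rewrite invr_ge0 ltW.
split=> v; rewrite eL.
  by rewrite e1 normrM ler_pM ?bspline_deriv_le.
move=> vh; rewrite -!raddfB e1.
have -> : ((z + v) ord0 i - g) / h = u0 + v ord0 i / h.
  by rewrite /u0 mxE; field.
apply: le_trans (bspline_taylor _ _) _.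
rewrite ler_pM2l // -[leLHS]real_normK ?num_real //.
by rewrite lerXn2r ?nnegrE // divr_ge0 ?enorm_ge0 // ltW.
Qed.

End Taylor.

(** * Spline quasi-interpolation in several variables *)

Section SplineN.
Variables (R : realType) (n : nat) (x : 'rV[R]_n) (h : R) (M : nat).
Hypothesis h_gt0 : 0 < h.
Implicit Types (z v : 'rV[R]_n).

(** The grid has finitely many points, so that the interpolant is a finite sum; its
identities hold on [gridbox], where no active point is missing. *)
Definition gridpt (c : {ffun 'I_n -> 'I_(M.*2.+1)}) : 'rV[R]_n :=
  \row_i (x ord0 i + h * ((c i : nat)%:R - M%:R)).

Definition weight (c : {ffun 'I_n -> 'I_(M.*2.+1)}) z : R :=
  \prod_(i < n) bspline ((z ord0 i - gridpt c ord0 i) / h).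

Definition spline N (u : 'rV[R]_n -> 'rV[R]_N) z : 'rV[R]_N :=
  \sum_c weight c z *: u (gridpt c).

Definition gridbox : set 'rV[R]_n :=
  [set z | forall i, `|z ord0 i - x ord0 i| <= (M%:R - 1) * h].

Let coordE c z i : (z ord0 i - gridpt c ord0 i) / h =
  (z ord0 i - x ord0 i) / h + M%:R - (c i : nat)%:R.
Proof. by rewrite mxE; field; exact: lt0r_neq0. Qed.

Lemma weight_ge0 c z : 0 <= weight c z.
Proof. by apply: prodr_ge0 => i _; exact: bspline_ge0. Qed.

(** The weights are products over the coordinates, so that sums over the grid
factor into one-dimensional sums. *)
Lemma weight_sumE z : \sum_c weight c z =
  \prod_(i < n) \sum_(j < M.*2.+1) bspline ((z ord0 i - x ord0 i) / h + M%:R - j%:R).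
Proof.
rewrite bigA_distr_bigA /=; apply: eq_bigr => c _.
by apply: eq_bigr => i _; rewrite coordE.
Qed.

Lemma weight_sum_le1 z : \sum_c weight c z <= 1.
Proof.
rewrite weight_sumE; apply: prodr_ile1 => i _.
by rewrite bspline_sum_le sumr_ge0 // => j _; exact: bspline_ge0.
Qed.

Let inboxP z i : gridbox z -> let t := (z ord0 i - x ord0 i) / h + M%:R in
  0 <= t + 1 / 2 - 1 /\ t - (M.*2.+1)%:R + 1 / 2 <= -1.
Proof.
move=> /(_ i); rewrite -ler_pdivrMr // => zi /=.
rewrite -{1}(gtr0_norm h_gt0) -normfV -normrM ler_norml in zi.
case/andP: zi => z1 z2.
have -> : (M.*2.+1)%:R = 2 * M%:R + 1 :> R by rewrite -addn1 natrD -muln2 natrM; ring.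
by split; lra.
Qed.

Lemma weight_sum z : gridbox z -> \sum_c weight c z = 1.
Proof.
move=> zbox; rewrite weight_sumE big1 // => i _.
by have [] := inboxP i zbox; exact: bspline_sum.
Qed.

(** In the product over the coordinates, the factor of coordinate [l] is the first
moment of the one-dimensional spline, which vanishes. *)
Lemma weight_moment z : gridbox z -> \sum_c weight c z *: (z - gridpt c) = 0.
Proof.
move=> zbox; apply/rowP => l; rewrite summxE [RHS]mxE.
have -> : \sum_c (weight c z *: (z - gridpt c)) ord0 l = h * \sum_(c : {ffun 'I_n -> 'I_(M.*2.+1)}) \prod_(i < n)
   ((if i == l then (z ord0 i - x ord0 i) / h + M%:R - (c i : nat)%:R else 1) *
    bspline ((z ord0 i - x ord0 i) / h + M%:R - (c i : nat)%:R)).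
  rewrite mulr_sumr; apply: eq_bigr => c _; rewrite 3!mxE big_split /=.
  rewrite -big_mkcond big_pred1_eq -coordE mulrA (mulrC h) mulfVK ?lt0r_neq0 //.
  by rewrite mulrC; congr (_ * _); apply: eq_bigr => i _; rewrite coordE.
rewrite -(bigA_distr_bigA (fun i (j : 'I_(M.*2.+1)) =>
   (if i == l then (z ord0 i - x ord0 i) / h + M%:R - (j : nat)%:R else 1) *
    bspline ((z ord0 i - x ord0 i) / h + M%:R - (j : nat)%:R))) /=.
rewrite (bigD1 l) //= (eq_bigr _ (fun j _ => congr2 *%R (ifT _ _ (eqxx l)) erefl)).
by have [i1 i2] := inboxP l zbox; rewrite bspline_moment_sum // mul0r mulr0.
Qed.

Lemma weight_neq0 c z : weight c z != 0 -> enorm (z - gridpt c) <= 2 * n%:R * h.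
Proof.
move=> /prodf_neq0 w0; apply: (@le_trans _ _ (n%:R * (3 / 2 * h))).
  apply: enorm_le_coords => i; rewrite leNgt; apply/negP => hi.
  have /negP := w0 i isT; apply; apply/eqP/bspline_out.
  by rewrite normrM normfV (gtr0_norm h_gt0) ler_pdivlMr // !mxE in hi *; exact: ltW.
have : 0 <= n%:R * h by rewrite mulr_ge0 // ltW.
by lra.
Qed.

(** The window is wider than the support of the spline by one unit, so that inactive
weights vanish on a whole ball of radius [h]. *)
Definition active z (c : {ffun 'I_n -> 'I_(M.*2.+1)}) :=
  [forall i, `|(z ord0 i - gridpt c ord0 i) / h| < 5 / 2].

Lemma active_near z c : active z c -> enorm (z - gridpt c) <= 3 * n%:R * h.
Proof.
move=> /forallP zc; apply: (@le_trans _ _ (n%:R * (5 / 2 * h))).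
  apply: enorm_le_coords => i; move: (zc i).
  by rewrite normrM normfV (gtr0_norm h_gt0) ltr_pdivrMr // !mxE => /ltW.
have : 0 <= n%:R * h by rewrite mulr_ge0 // ltW.
by lra.
Qed.

Lemma inactive_weight0 z c v : ~~ active z c -> enorm v <= h -> weight c (z + v) = 0.
Proof.
rewrite negb_forall => /existsP[i]; rewrite -leNgt => hi vh.
rewrite /weight (bigD1 i) //= bspline_out ?mul0r //.
have -> : ((z + v) ord0 i - gridpt c ord0 i) / h =
   (z ord0 i - gridpt c ord0 i) / h + v ord0 i / h by rewrite !mxE; ring.
have : `|v ord0 i / h| <= 1.
  rewrite normrM normfV (gtr0_norm h_gt0) ler_pdivrMr // mul1r.
  exact: le_trans (coord_le_enorm _ _) vh.
have := ler_normB ((z ord0 i - gridpt c ord0 i) / h + v ord0 i / h) (v ord0 i / h).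
by rewrite addrK; lra.
Qed.

Lemma active_count z : \sum_c (active z c)%:R <= 6 ^+ n :> R.
Proof.
have -> : \sum_c (active z c)%:R = \prod_(i < n) \sum_(j < M.*2.+1)
   ((`|(z ord0 i - x ord0 i) / h + M%:R - j%:R| < 5 / 2)%R)%:R :> R.
  rewrite bigA_distr_bigA /=; apply: eq_bigr => c _.
  rewrite /active; case: forallP => [a|/forallP]; last rewrite negb_forall => /existsP[i ai].
    by rewrite big1 // => i _; rewrite -coordE a.
  by rewrite (bigD1 i) //= -coordE (negbTE ai) mul0r.
rewrite -[X in 6 ^+ X]card_ord -prodr_const; apply: ler_prod => i _.
by rewrite count_window sumr_ge0.
Qed.

(** [spline u z] is a sub-convex combination of the values of [u] near [z]. *)
Lemma spline_bound N m (U : 'M[R]_(N, m)) (u : 'rV[R]_n -> 'rV[R]_N) z d : 0 <= d ->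
  (forall p, enorm (z - p) <= 2 * n%:R * h -> enorm (u p *m U) <= d) ->
  enorm (spline u z *m U) <= d.
Proof.
move=> d0 ud; rewrite mulmx_suml; apply: le_trans (enorm_sum _ _ _) _.
apply: (@le_trans _ _ (\sum_c weight c z * d)).
  apply: ler_sum => c _; rewrite -scalemxAl enormZ ger0_norm ?weight_ge0 //.
  have [->|w0] := eqVneq (weight c z) 0; first by rewrite !mul0r.
  by rewrite ler_wpM2l ?weight_ge0 // ud // weight_neq0.
by rewrite -mulr_suml ler_piMl // weight_sum_le1.
Qed.

(** The spline reproduces affine maps because the weights have total mass 1 and
vanishing first moment. *)
Lemma splineB_affine N (u : 'rV[R]_n -> 'rV[R]_N) (A : affine_map R n N) z :
  gridbox z -> spline u z - A z = spline (fun p => u p - A p) z.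
Proof.
move=> zbox; have -> : A z = spline A z.
  apply/eqP; rewrite -subr_eq0; apply/eqP.
  have -> : A z = \sum_c weight c z *: A z by rewrite -scaler_suml weight_sum // scale1r.
  rewrite /spline -sumrB (eq_bigr (fun c => (weight c z *: (z - gridpt c)) *m linear_part A)).
    by rewrite -mulmx_suml weight_moment // mul0mx.
  move=> c _; rewrite -scalerBr -scalemxAl /affine_eval mulmxBl.
  by congr (_ *: _); rewrite opprD addrACA subrr addr0.
by rewrite /spline -sumrB; apply: eq_bigr => c _; rewrite scalerBr.
Qed.

(** Each weight has Taylor constant 24^n, since its n factors have constant 4 and each
multiplication costs a factor 6. Multiplication by a value costs another factor 6,
and at most 6^n weights are active. *)
Definition spline_const : R := 6 * 144 ^+ n.

Lemma weight_taylor c z : taylor (fun y => (weight c y)%:M : 'rV[R]_1) z h (24 ^+ n).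
Proof.
have H (s : seq 'I_n) : taylor (fun y => (\prod_(i <- s)
   bspline ((y ord0 i - gridpt c ord0 i) / h))%:M : 'rV[R]_1) z h (24 ^+ size s).
  elim: s => [|i s IH].
    have e : enorm (1%:M : 'rV[R]_1) = 1.
      by rewrite /enorm big_ord1 mxE eqxx expr1n sqrtr1.
    rewrite expr0; apply: (@taylor_ext _ _ _ (fun=> 1%:M)); first exact: ltW.
      by move=> v _; rewrite big_nil.
    by have := taylor_cst (1%:M : 'rV[R]_1) z h_gt0; rewrite e.
  have := taylorM h_gt0 (taylor_bspline i (gridpt c ord0 i) z h_gt0) IH.
  rewrite (_ : 6 * 4 = 24) -?exprS; last by ring.
  apply: taylor_ext; first exact: ltW.
  by move=> v _; rewrite big_cons mxE eqxx mulr1n scale_scalar_mx.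
have := H (enum 'I_n); rewrite size_enum_ord.
apply: taylor_ext; first exact: ltW.
by move=> v _; rewrite /weight big_enum.
Qed.

(** Only boundedly many weights are active near [z], so the smoothness of the
weights passes to [spline u] with a constant that depends on the dimension. *)
Lemma spline_taylor N (u : 'rV[R]_n -> 'rV[R]_N) z d : 0 <= d ->
  (forall p, enorm (z - p) <= 3 * n%:R * h -> enorm (u p) <= d) ->
  taylor (spline u) z h (spline_const * d).
Proof.
move=> d0 ud.
have T c : taylor (fun y => weight c y *: u (gridpt c)) z h
    ((active z c)%:R * (6 * 24 ^+ n * d)).
  case: (boolP (active z c)) => zc; last first.
    rewrite mul0r; apply: (@taylor_ext _ _ _ (fun=> 0)); first exact: ltW.
      by move=> v vh; rewrite inactive_weight0 // scale0r.
    by rewrite -(@enorm0 R N); exact: taylor_cst.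
  rewrite mul1r.
  have := taylorM h_gt0 (weight_taylor c z) (taylor_cst (u (gridpt c)) z h_gt0).
  move=> /(taylor_le h_gt0 (lexx h)) => T.
  apply: (taylor_ext _ _ (T _ _)); first exact: ltW.
    by move=> v _; rewrite mxE eqxx mulr1n.
  by rewrite ler_wpM2l ?ud ?active_near // mulr_ge0 // exprn_ge0.
apply: (taylor_le h_gt0 (lexx h)) (taylor_sum (index_enum _) h_gt0 T).
rewrite -mulr_suml /spline_const (_ : 144 = 6 * 24); last by ring.
rewrite exprMn.
have -> : 6 * (6 ^+ n * 24 ^+ n) * d = 6 ^+ n * (6 * 24 ^+ n * d) by ring.
by rewrite ler_wpM2r ?active_count // !mulr_ge0 // exprn_ge0.
Qed.

End SplineN.

(** * Blending interpolants at the scale of the distance to a set *)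

Section Extension.
Variables (R : realType) (n N : nat) (x : 'rV[R]_n) (r : R) (E : set 'rV[R]_n).
Variable u : 'rV[R]_n -> 'rV[R]_N.
Hypotheses (n_gt0 : (0 < n)%N) (r_gt0 : 0 < r) (E_ball : E `<=` eball x r).
Implicit Types (z v p : 'rV[R]_n) (k : nat).

Definition close_to z (rho : R) : Prop := exists2 y, E y & enorm (z - y) <= rho.

(** The factor 64 n keeps every grid point that matters within distance 2 r of [x]. *)
Definition mesh k : R := r / (64 * n%:R) / 2 ^+ k.

(** With this many points on each side, the grid covers the ball of radius 4 r. *)
Definition halfwidth k : nat := (256 * n * 2 ^ k).+1.

Definition level_spline m (w : 'rV[R]_n -> 'rV[R]_m) k : 'rV[R]_n -> 'rV[R]_m :=
  spline x (mesh k) (halfwidth k) w.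

(** A smoothed indicator of a neighbourhood of [E] whose size is the mesh. It takes
values in 1 x 1 matrices because [taylorM] multiplies by such functions. *)
Definition cutoff k : 'rV[R]_n -> 'rV[R]_1 :=
  level_spline (fun p => (`[< close_to p (4 * n%:R * mesh k) >]%:R)%:M) k.

(** Where the cutoff equals 1, a step forgets all coarser meshes. *)
Fixpoint blend k z : 'rV[R]_N :=
  if k is k'.+1 then (1 - cutoff k' z ord0 ord0) *: blend k' z +
     cutoff k' z ord0 ord0 *: level_spline u k' z
  else 0.

(** At the chosen level and beyond it all cutoffs vanish at [z], so the blends
have stabilized. *)
Definition extension z : 'rV[R]_N :=
  if `[< E z >] then u z
  else blend (xget 0%N [set k | ~ close_to z (8 * n%:R * mesh k)]) z.

Let n_ge1 : 1 <= n%:R :> R. Proof. by rewrite ler1n. Qed.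

Let n_pos : 0 < n%:R :> R. Proof. by rewrite ltr0n. Qed.

Lemma mesh_gt0 k : 0 < mesh k.
Proof. by rewrite /mesh !divr_gt0 ?mulr_gt0 ?exprn_gt0. Qed.

Lemma meshS k : mesh k = 2 * mesh k.+1.
Proof. by rewrite /mesh exprS; field; rewrite expf_neq0 //= lt0r_neq0. Qed.

Lemma mesh_le j k : (j <= k)%N -> mesh k <= mesh j.
Proof.
move=> /subnK <-; elim: (k - j)%N => [|i IH]; first by rewrite add0n.
by have := meshS (i + j)%N; have := mesh_gt0 (i + j).+1; rewrite addSn; lra.
Qed.

Lemma mesh0 : 64 * n%:R * mesh 0 = r.
Proof. by rewrite /mesh expr0; field; rewrite lt0r_neq0. Qed.

Lemma nmesh_le k : 64 * (n%:R * mesh k) <= r.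
Proof. by rewrite -mesh0 -mulrA ler_wpM2l // ler_wpM2l // mesh_le. Qed.

Lemma nmesh_ge k : mesh k <= n%:R * mesh k.
Proof. by rewrite ler_peMl // ltW // mesh_gt0. Qed.

Lemma nmesh_gt0 k : 0 < n%:R * mesh k.
Proof. by rewrite mulr_gt0 // mesh_gt0. Qed.

Lemma close_to_le z (a b : R) : a <= b -> close_to z a -> close_to z b.
Proof. by move=> ab [y Ey zy]; exists y => //; exact: le_trans ab. Qed.

Lemma close_to_shift z z' (a b : R) : close_to z a -> enorm (z' - z) + a <= b -> close_to z' b.
Proof.
move=> [y Ey zy] h; exists y => //; apply: le_trans (enorm_distD z _ _) _.
by apply: le_trans h; rewrite lerD2l.
Qed.

Lemma close_to_dist z a : close_to z a -> enorm (z - x) <= r + a.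
Proof.
move=> [y Ey zy]; apply: le_trans (enorm_distD y _ _) _.
by rewrite addrC lerD // E_ball.
Qed.

Lemma gridbox_ball k z : enorm (z - x) <= 4 * r -> gridbox x (mesh k) (halfwidth k) z.
Proof.
move=> zx i; apply: le_trans (_ : enorm (z - x) <= _).
  by have := coord_le_enorm (z - x) i; rewrite !mxE.
apply: le_trans zx _.
have -> : (halfwidth k)%:R - 1 = 256 * n%:R * 2 ^+ k :> R.
  by rewrite /halfwidth -addn1 natrD addrK !natrM natrX.
rewrite /mesh.
rewrite le_eqVlt; apply/orP; left; apply/eqP; field.
by rewrite expf_neq0 //= lt0r_neq0.
Qed.

Let e1 (a : R) : enorm (a%:M : 'rV[R]_1) = `|a|.
Proof. by rewrite /enorm big_ord1 mxE eqxx mulr1n sqrtr_sqr. Qed.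

Let ind01 (b : bool) : 0 <= (b%:R : R) <= 1.
Proof. by case: b; rewrite ?lexx ?ler01. Qed.

Lemma cutoffE k z : cutoff k z ord0 ord0 = \sum_(c : {ffun _ -> 'I_((halfwidth k).*2.+1)}) weight x (mesh k) c z *
   (`[< close_to (gridpt x (mesh k) c) (4 * n%:R * mesh k) >] : bool)%:R
   :> R.
Proof.
rewrite /cutoff /level_spline /spline summxE; apply: eq_bigr => c _.
by rewrite 2!mxE eqxx mulr1n.
Qed.

Lemma cutoff01 k z : 0 <= cutoff k z ord0 ord0 <= 1.
Proof.
rewrite cutoffE; apply/andP; split.
  by apply: sumr_ge0 => c _; rewrite mulr_ge0 ?weight_ge0 //; case/andP: (ind01 (asbool _)).
apply: le_trans (weight_sum_le1 x (halfwidth k) (mesh_gt0 k) z).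
by apply: ler_sum => c _; rewrite ler_piMr ?weight_ge0 //; case: asbool; rewrite ?lexx ?ler01.
Qed.

Lemma cutoff1 k z : close_to z (2 * n%:R * mesh k) -> cutoff k z ord0 ord0 = 1.
Proof.
move=> zE; rewrite cutoffE.
have zb : gridbox x (mesh k) (halfwidth k) z.
  apply: gridbox_ball; apply: le_trans (close_to_dist zE) _.
  by have := nmesh_le k; rewrite -mulrA; move: r_gt0; lra.
rewrite -[RHS](weight_sum (mesh_gt0 k) zb); apply: eq_bigr => c _.
have [->|w0] := eqVneq (weight x (mesh k) c z) 0; first by rewrite mul0r.
rewrite asboolT ?mulr1 //; apply: close_to_shift zE _.
by have := weight_neq0 (mesh_gt0 k) w0; rewrite enorm_distC; lra.
Qed.

Lemma cutoff0 k z : ~ close_to z (6 * n%:R * mesh k) -> cutoff k z ord0 ord0 = 0.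
Proof.
move=> zE; rewrite cutoffE big1 // => c _.
have [->|w0] := eqVneq (weight x (mesh k) c z) 0; first by rewrite mul0r.
rewrite asboolF ?mulr0 // => pE; apply: zE; apply: close_to_shift pE _.
by have := weight_neq0 (mesh_gt0 k) w0; lra.
Qed.

Lemma cutoff_taylor k z : taylor (cutoff k) z (mesh k) (spline_const R n).
Proof.
rewrite -[spline_const R n]mulr1; apply: spline_taylor => //; first exact: mesh_gt0.
by move=> p _; rewrite e1 ger0_norm; case/andP: (ind01 (asbool (close_to p (4 * n%:R * mesh k)))).
Qed.

Lemma blend_stable K k z : ~ close_to z (6 * n%:R * mesh K) -> (K <= k)%N -> blend k z = blend K z.
Proof.
move=> zE /subnK <-; elim: (k - K)%N => [|i IH]; first by rewrite add0n.
rewrite addSn /= cutoff0 ?subr0 ?scale1r ?scale0r ?addr0 //.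
apply: contra_not zE; apply: close_to_le; rewrite ler_wpM2l ?mulr_ge0 //.
by rewrite mesh_le // leq_addl.
Qed.

Lemma extension_out K z : ~ close_to z (6 * n%:R * mesh K) -> extension z = blend K z.
Proof.
move=> zE; rewrite /extension asboolF; last first.
  move=> Ez; apply: zE; exists z => //; rewrite subrr enorm0.
  by rewrite !mulr_ge0 // ltW // mesh_gt0.
have : [set k | ~ close_to z (8 * n%:R * mesh k)] K.+1.
  apply: contra_not zE => /=; apply: close_to_le; rewrite (meshS K).
  by have := mesh_gt0 K.+1; rewrite -!mulrA; have := n_pos; nra.
move=> /(xgetI 0%N); set k := xget _ _ => /= kE.
have kE6 : ~ close_to z (6 * n%:R * mesh k).
  apply: contra_not kE; apply: close_to_le.
  by rewrite -!mulrA; have := nmesh_gt0 k; lra.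
by case: (leqP K k) => [?|/ltnW ?]; [|symmetry]; apply: blend_stable.
Qed.

Lemma extension_in z : E z -> extension z = u z.
Proof. by move=> Ez; rewrite /extension asboolT. Qed.

Lemma blend_step_bound m (U : 'M[R]_(N, m)) k z (a : 'rV[R]_N) d :
  enorm ((blend k z - a) *m U) <= d ->
  enorm ((level_spline u k z - a) *m U) <= d ->
  enorm ((blend k.+1 z - a) *m U) <= d.
Proof.
move=> h1 h2 /=; have /andP[] := cutoff01 k z; set c := cutoff k z ord0 ord0 => c0 c1.
have -> : (1 - c) *: blend k z + c *: level_spline u k z - a =
  (1 - c) *: (blend k z - a) + c *: (level_spline u k z - a).
  by apply/rowP => i; rewrite !mxE; ring.
rewrite mulmxDl -!scalemxAl; apply: le_trans (enormD _ _) _.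
rewrite !enormZ !ger0_norm ?subr_ge0 //.
have : (1 - c) * enorm ((blend k z - a) *m U) <= (1 - c) * d.
  by rewrite ler_wpM2l // subr_ge0.
have : c * enorm ((level_spline u k z - a) *m U) <= c * d by rewrite ler_wpM2l.
by lra.
Qed.

Lemma extension_bound d z : (forall p, enorm (u p) <= d) -> enorm (extension z) <= d.
Proof.
move=> ud; have d0 : 0 <= d by exact: le_trans (enorm_ge0 _) (ud 0).
have H k : enorm ((blend k z - 0) *m 1%:M) <= d.
  elim: k => [|k IH]; first by rewrite /= subr0 mul0mx enorm0.
  apply: blend_step_bound IH _; rewrite subr0.
  by apply: spline_bound => //; [exact: mesh_gt0|move=> p _; rewrite mulmx1].
rewrite /extension; case: ifP => _ //.
by have := H (xget 0%N [set k | ~ close_to z (8 * n%:R * mesh k)]); rewrite subr0 mulmx1.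
Qed.

Hypothesis E_closed : closed E.

Lemma mesh_small (e : R) : 0 < e -> exists k, n%:R * mesh k < e.
Proof.
move=> e0; exists (Num.truncn (r / e)).+1; set k := _.+1.
have rk : r / e < 2 ^+ k.
  apply: lt_le_trans (truncnS_gt _) _; rewrite -natrX ler_nat -/k.
  by rewrite ltnW // ltn_expl.
rewrite /mesh; have -> : n%:R * (r / (64 * n%:R) / 2 ^+ k) = r / 64 / 2 ^+ k.
  by field; rewrite expf_neq0 //= lt0r_neq0.
rewrite ltr_pdivrMr ?exprn_gt0 //.
move: rk; rewrite ltr_pdivrMr // => rk.
have : 0 < e * 2 ^+ k by rewrite mulr_gt0 // exprn_gt0.
by move: r_gt0 rk; lra.
Qed.

Lemma notin_far z : ~ E z -> exists2 e, 0 < e & ~ close_to z e.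
Proof.
move=> nEz; have : open (~` E) by rewrite openC.
rewrite openE => /(_ z nEz); rewrite /interior => /nbhs_ballP[e /= e0 eE].
exists (e / 2); first by rewrite divr_gt0.
move=> [y Ey zy]; apply: (eE y) => //.
rewrite -ball_normE /=; apply: le_lt_trans (mx_norm_le_enorm _) _.
by apply: le_lt_trans zy _; lra.
Qed.

Lemma levelP z : ~ E z -> exists K, ~ close_to z (8 * n%:R * mesh K) /\
  forall k, (k < K)%N -> close_to z (8 * n%:R * mesh k).
Proof.
move=> /notin_far[e e0 ze].
have ex : exists k, `[< ~ close_to z (8 * n%:R * mesh k) >].
  have e8 : 0 < e / 8 by rewrite divr_gt0.
  have [k kn] := mesh_small e8.
  exists k; apply/asboolP; apply: contra_not ze; apply: close_to_le.
  by move: kn; lra.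
exists (ex_minn ex); case: ex_minnP => K /asboolP KP Kmin; split=> // k kK.
apply: contrapT => /asboolP /Kmin; by rewrite leqNgt kK.
Qed.

(** Near [E] the extension is a convex combination of values of [u] at points
whose distance from [z] is controlled by the distance from [z] to [E]. *)
Lemma extension_convex m (U : 'M[R]_(N, m)) (A : affine_map R n N) z (rho d : R) :
  0 <= rho -> close_to z rho -> 64 * rho < r -> 0 <= d ->
  (forall p, enorm (z - p) <= 4 * rho -> enorm ((u p - A p) *m U) <= d) ->
  enorm ((extension z - A z) *m U) <= d.
Proof.
move=> rho0 zE rhor d0 H; have [Ez|nEz] := pselect (E z).
  by rewrite extension_in // H // subrr enorm0 mulr_ge0.
have [K [KE Kmin]] := levelP nEz.
have Krho : 8 * n%:R * mesh K < rho.
  by rewrite ltNge; apply/negP => h; apply: KE; exact: close_to_le zE.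
have K4 : (4 <= K)%N.
  rewrite leqNgt; apply/negP; rewrite ltnS => /mesh_le K3.
  have := mesh0; rewrite (meshS 0) (meshS 1) (meshS 2) => m0.
  have : n%:R * mesh 3 <= n%:R * mesh K by rewrite ler_wpM2l.
  by move: m0 Krho; lra.
(* Four levels above the last one the cutoff equals 1, which restarts the blending. *)
case: K => [//|[//|[//|[//|K]]]] in KE Kmin Krho K4 *.
have m4 : n%:R * mesh K = 16 * (n%:R * mesh K.+4).
  by rewrite (meshS K) (meshS K.+1) (meshS K.+2) (meshS K.+3); ring.
have nK : close_to z (2 * n%:R * mesh K).
  apply: close_to_le (Kmin K.+3 (ltnSn _)).
  by move: m4; rewrite (meshS K.+3); have := mesh_gt0 K.+4; have := n_pos; nra.
have S k : (K <= k)%N -> enorm ((level_spline u k z - A z) *m U) <= d.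
  move=> Kk; rewrite splineB_affine; first last.
  - apply: gridbox_ball; apply: le_trans (close_to_dist zE) _; by move: r_gt0; lra.
  - exact: mesh_gt0.
  apply: spline_bound => //; first exact: mesh_gt0.
  move=> p zp; apply: H; apply: le_trans zp _.
  have : n%:R * mesh k <= n%:R * mesh K by rewrite ler_wpM2l // mesh_le.
  by move: Krho; lra.
rewrite (@extension_out K.+4); last first.
  apply: contra_not KE; apply: close_to_le.
  by rewrite -!mulrA; have := nmesh_gt0 K.+4; lra.
have S1 : enorm ((blend K.+1 z - A z) *m U) <= d.
  by rewrite /= cutoff1 // subrr scale0r add0r scale1r S.
by do 3 (apply: blend_step_bound; last by [apply: S; lia]).
Qed.

Lemma spline_const_ge1 : 1 <= spline_const R n.
Proof.
rewrite /spline_const; have : 1 <= 144 ^+ n :> R by rewrite exprn_ege1 // ler1n.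
by lra.
Qed.

(** The factor 18 collects the two products, each with constant 6, and the constant of
the complementary cutoff, which is at most twice that of the cutoff. *)
Lemma taylor_blend_step (A : 'rV[R]_n -> 'rV[R]_N) k z h M0 M :
  0 < h -> h <= mesh k -> M0 <= M ->
  taylor (fun y => blend k y - A y) z h M ->
  taylor (fun y => level_spline u k y - A y) z h M0 ->
  taylor (fun y => blend k.+1 y - A y) z h (18 * spline_const R n * M).
Proof.
move=> h0 hk MM T T0; have M0' := taylor_ge0 T; have K1 := spline_const_ge1.
have Tc := taylor_le h0 hk (lexx _) (cutoff_taylor k z).
have Tc1 : taylor (fun y => 1%:M - cutoff k y) z h (1 + spline_const R n).
  have := taylor_cst (1%:M : 'rV[R]_1) z h0; rewrite e1 normr1 => T1.
  have e1' : enorm ((-1)%:M : 'rV[R]_1) = 1 by rewrite e1 normrN normr1.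
  case: Tc => b [L [L1 L2]].
  apply: (@taylor_ext _ _ _ (fun y => 1%:M + (- cutoff k y)) _ _ _ _ (ltW h0)) => //.
  apply: taylorD T1 _; split; first by rewrite enormN.
  exists (- L); split=> v; rewrite mulmxN ?enormN // => vh.
  have -> : - cutoff k (z + v) - - cutoff k z - - (v *m L) =
      - (cutoff k (z + v) - cutoff k z - v *m L).
    by apply/rowP => i; rewrite !mxE; ring.
  by rewrite enormN L2.
have := taylorD (taylorM h0 Tc1 T) (taylorM h0 Tc T0).
move=> /(taylor_ext (ltW h0)) TT.
apply: (taylor_le h0 (lexx h)) (TT _ _) => [|v _ /=].
  have : 6 * spline_const R n * M0 <= 6 * spline_const R n * M by rewrite ler_wpM2l //; lra.
  by nra.
by apply/rowP => i; rewrite !mxE eqxx mulr1n; ring.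
Qed.

(** Three blending steps and one interpolation, each with a factor at most
18 * spline_const. *)
Definition extension_const : R := (18 * spline_const R n) ^+ 4.

Lemma taylor_blend_steps m (A : 'rV[R]_n -> 'rV[R]_N) k z h d :
  0 < h -> h <= mesh (k + m)%N -> (m <= 3)%N -> 0 <= d ->
  taylor (fun y => blend k y - A y) z h (spline_const R n * d) ->
  (forall j, (k <= j)%N -> (j < k + m)%N ->
    taylor (fun y => level_spline u j y - A y) z h (spline_const R n * d)) ->
  taylor (fun y => blend (k + m)%N y - A y) z h (extension_const * d).
Proof.
move=> h0 hk m3 d0 T Ts; have K1 := spline_const_ge1.
have K18 : 1 <= 18 * spline_const R n by lra.
have Kd : 0 <= spline_const R n * d by rewrite mulr_ge0 //; lra.
have H : taylor (fun y => blend (k + m)%N y - A y) z h ((18 * spline_const R n) ^+ m * (spline_const R n * d)).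
  elim: m hk {m3} Ts => [|m IH] hk Ts; first by rewrite addn0 expr0 mul1r.
  rewrite addnS exprS -mulrA; apply: (@taylor_blend_step _ _ _ _ (spline_const R n * d)) => //.
  - by apply: le_trans hk _; rewrite mesh_le // addnS.
  - by rewrite ler_peMl // exprn_ege1.
  - apply: IH; first by apply: le_trans hk _; rewrite mesh_le // addnS.
    by move=> j j1 j2; apply: Ts => //; rewrite addnS ltnW.
  - by apply: Ts; rewrite ?leq_addr // addnS.
apply: taylor_le H => //; rewrite /extension_const mulrA ler_wpM2r //.
rewrite exprSr; apply: ler_pM; rewrite ?exprn_ge0 //; try lra.
by apply: ler_weXn2l.
Qed.

Section TaylorExtension.
Variables (z : 'rV[R]_n) (K : nat).
Hypothesis KE : ~ close_to z (8 * n%:R * mesh K).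

Lemma extension_blend v : enorm v <= mesh K -> extension (z + v) = blend K (z + v).
Proof.
move=> vh; apply: extension_out; apply: contra_not KE => nE.
apply: close_to_shift nE _; rewrite -[z in z - _]addr0 opprD addrACA subrr add0r sub0r enormN.
by have := nmesh_ge K; have := mesh_gt0 K; nra.
Qed.

(** Away from [E] at the scale of the distance to [E], all meshes that still
matter are comparable, so the extension is smooth at that scale. *)
Lemma extension_taylor_near (A : affine_map R n N) d :
  (4 <= K)%N -> (forall k, (k < K)%N -> close_to z (8 * n%:R * mesh k)) -> 0 <= d ->
  (forall p, enorm (z - p) <= 48 * n%:R * mesh K -> enorm (u p - A p) <= d) ->
  taylor (fun y => extension y - A y) z (mesh K) (extension_const * d).
Proof.
move=> K4 Kmin d0 H; have mK := mesh_gt0 K.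
apply: (@taylor_ext _ _ _ (fun y => blend K y - A y)); first exact: ltW.
  by move=> v vh; rewrite extension_blend.
case: K KE K4 Kmin H mK => [//|[//|[//|[//|j]]]] KE' K4 Kmin H mK.
have m4 : mesh j = 16 * mesh j.+4.
  by rewrite (meshS j) (meshS j.+1) (meshS j.+2) (meshS j.+3); ring.
have nv v : enorm v <= mesh j.+4 -> close_to (z + v) (2 * n%:R * mesh j).
  move=> vh; apply: close_to_shift (Kmin j.+3 (ltnSn _)) _.
  rewrite [z + v]addrC addrK m4 (meshS j.+3).
  by have := nmesh_ge j.+4; lra.
have S k : (j <= k)%N -> (k < j.+4)%N ->
    taylor (fun y => level_spline u k y - A y) z (mesh j.+4) (spline_const R n * d).
  move=> jk kj.
  have kj' : mesh j.+4 <= mesh k by rewrite mesh_le // ltnW.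
  apply: (@taylor_ext _ _ _ (level_spline (fun p => u p - A p) k)); first exact: ltW.
    move=> v vh; rewrite /level_spline -splineB_affine //; first exact: mesh_gt0.
    apply: gridbox_ball; apply: le_trans (close_to_dist (nv v vh)) _.
    by have := nmesh_le j; move: r_gt0; lra.
  apply: (taylor_le mK kj' (lexx _)); apply: spline_taylor => //; first exact: mesh_gt0.
  move=> p zp; apply: H; apply: le_trans zp _.
  have : n%:R * mesh k <= n%:R * mesh j by rewrite ler_wpM2l // mesh_le.
  by rewrite -!mulrA m4; lra.
have := @taylor_blend_steps 3 A j.+1 z (mesh j.+4) d; rewrite addn3; apply => //.
- apply: (@taylor_ext _ _ _ (fun y => level_spline u j y - A y)); first exact: ltW.
    by move=> v vh /=; rewrite (cutoff1 (nv v vh)) subrr scale0r add0r scale1r.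
  by apply: S; lia.
- by move=> k k1 k2; apply: S; lia.
Qed.

(** When few levels are involved, all of them are comparable to [r], and a global bound
on [u] takes the place of an affine approximation. *)
Lemma extension_taylor_far d : (K <= 3)%N -> 0 <= d -> (forall p, enorm (u p) <= d) ->
  taylor extension z (mesh K) (extension_const * d).
Proof.
move=> K3 d0 H; have mK := mesh_gt0 K.
apply: (@taylor_ext _ _ _ (fun y => blend (0 + K) y - (fun=> 0) y)); first exact: ltW.
  by move=> v vh; rewrite extension_blend // subr0.
apply: taylor_blend_steps => //.
- apply: (@taylor_ext _ _ _ (fun=> 0)); first exact: ltW.
    by move=> v _; rewrite /= subrr.
  apply: taylor_le (lexx _) _ (taylor_cst _ _ mK) => //.
  by rewrite enorm0 mulr_ge0 //; have := spline_const_ge1; lra.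
- move=> k _ kK; apply: (@taylor_ext _ _ _ (level_spline u k)); first exact: ltW.
    by move=> v _; rewrite subr0.
  apply: (taylor_le mK (mesh_le (ltnW kK)) (lexx _)).
  by apply: spline_taylor => //; exact: mesh_gt0.
Qed.
End TaylorExtension.
End Extension.

(** * Maps close to almost conformal affine maps at all scales *)

Section Flat.
Variables (R : realType) (n N : nat).
Implicit Types (y z w v : 'rV[R]_n) (F : 'rV[R]_n -> 'rV[R]_N) (B : affine_map R n N).

(** The estimate is required on the ball of radius 4 s, so that the balls of two
neighbouring points at comparable scales share a ball that determines both linear
parts. *)
Definition approx kappa F y s B : Prop :=
  [/\ 0 < op_norm (linear_part B),
      forall v, (1 - kappa) * op_norm (linear_part B) * enorm v <=
                enorm (v *m linear_part B)
    & forall z, enorm (z - y) <= 4 * s ->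
        enorm (F z - B z) <= kappa * op_norm (linear_part B) * s].

Definition flat kappa F : Prop :=
  forall y s, 0 < s -> exists B, approx kappa F y s B.

Lemma affineB B z w : B z - B w = (z - w) *m linear_part B.
Proof. by rewrite /affine_eval opprD addrACA subrr addr0 mulmxBl. Qed.

Lemma approx_linear kappa F y s B z w : approx kappa F y s B ->
  enorm (z - y) <= 4 * s -> enorm (w - y) <= 4 * s ->
  enorm (F z - F w - (z - w) *m linear_part B) <=
    2 * kappa * op_norm (linear_part B) * s.
Proof.
case=> _ _ H zy wy; rewrite -affineB.
have -> : F z - F w - (B z - B w) = (F z - B z) - (F w - B w).
  by apply/rowP => i; rewrite !mxE; ring.
apply: le_trans (enormB _ _) _; have := H z zy; have := H w wy; lra.
Qed.

Lemma approx_upper kappa F y s B z w : approx kappa F y s B ->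
  enorm (z - y) <= 4 * s -> enorm (w - y) <= 4 * s ->
  enorm (F z - F w) <= op_norm (linear_part B) * enorm (z - w) +
    2 * kappa * op_norm (linear_part B) * s.
Proof.
move=> a zy wy; have := approx_linear a zy wy; have := op_normP (linear_part B) (z - w).
have := enormD (F z - F w - (z - w) *m linear_part B) ((z - w) *m linear_part B).
by rewrite subrK; lra.
Qed.

Lemma approx_lower kappa F y s B z w : approx kappa F y s B ->
  enorm (z - y) <= 4 * s -> enorm (w - y) <= 4 * s ->
  (1 - kappa) * op_norm (linear_part B) * enorm (z - w) -
    2 * kappa * op_norm (linear_part B) * s <= enorm (F z - F w).
Proof.
move=> a zy wy; have := approx_linear a zy wy; case: a => _ /(_ (z - w)) c _.
have := enormB (F z - F w) (F z - F w - (z - w) *m linear_part B).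
by rewrite subKr; lra.
Qed.

(** Both affine maps approximate [F] on a ball of radius [Num.max s s'] around [y],
so their linear parts agree up to the sum of the errors divided by the radius. *)
Lemma approx_close kappa F y s B y' s' B' : 0 < s -> 0 < s' -> 0 <= kappa ->
  approx kappa F y s B -> approx kappa F y' s' B' ->
  enorm (y - y') <= Num.max s s' -> s' <= 2 * s -> s <= 2 * s' ->
  op_norm (linear_part B - linear_part B') <=
    2 * kappa * (op_norm (linear_part B) + op_norm (linear_part B')).
Proof.
move=> s0 s0' k0 a a' yy' s1 s2.
set m := Num.max s s' in yy'.
have [m1 m2 m3 m4] : [/\ s <= m, s' <= m, m <= 2 * s & m <= 2 * s'].
  by rewrite /m; case: (leP s s') => ?; split; lra.
apply: op_norm_le => v v1.
have d1 : enorm (y + m *: v - y) <= 4 * s.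
  rewrite [y + _]addrC addrK enormZ gtr0_norm; last by lra.
  by have : m * enorm v <= m by [rewrite ler_piMr //; lra]; lra.
have d2 : enorm (y + m *: v - y') <= 4 * s'.
  rewrite addrAC; apply: le_trans (enormD _ _) _; rewrite enormZ gtr0_norm; last by lra.
  by have : m * enorm v <= m by [rewrite ler_piMr //; lra]; lra.
have d3 : enorm (y - y) <= 4 * s by rewrite subrr enorm0; lra.
have d4 : enorm (y - y') <= 4 * s' by lra.
have := approx_linear a d1 d3; have := approx_linear a' d2 d4.
rewrite [y + _]addrC addrK -!scalemxAl => h1 h2.
have : enorm (m *: (v *m (linear_part B - linear_part B'))) <=
    2 * kappa * (op_norm (linear_part B) + op_norm (linear_part B')) * m.
  rewrite mulmxBr scalerBr.
  set e := F _ - F _ in h1 h2.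
  have -> : m *: (v *m linear_part B) - m *: (v *m linear_part B') =
    (e - m *: (v *m linear_part B')) - (e - m *: (v *m linear_part B)).
    by apply/rowP => i; rewrite !mxE; ring.
  apply: le_trans (enormB _ _) _.
  have : kappa * op_norm (linear_part B) * s <= kappa * op_norm (linear_part B) * m.
    by rewrite ler_wpM2l // mulr_ge0 ?op_norm_ge0.
  have : kappa * op_norm (linear_part B') * s' <= kappa * op_norm (linear_part B') * m.
    by rewrite ler_wpM2l // mulr_ge0 ?op_norm_ge0.
  by lra.
by rewrite enormZ gtr0_norm ?(mulrC m) ?ler_pM2r //; lra.
Qed.

Lemma op_norm_lipschitz m m' (M M' : 'M[R]_(m, m')) :
  op_norm M <= op_norm M' + op_norm (M - M').
Proof. by have := op_normD M' (M - M'); rewrite addrC subrK. Qed.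

Lemma approx_compat kappa F y s B y' s' B' : 0 < s -> 0 < s' ->
  0 <= kappa -> kappa <= 1 / 16 ->
  approx kappa F y s B -> approx kappa F y' s' B' ->
  enorm (y - y') <= Num.max s s' -> s' <= 2 * s -> s <= 2 * s' ->
  op_norm (linear_part B - linear_part B') <= 6 * kappa * op_norm (linear_part B').
Proof.
move=> s0 s0' k0 k1 a a' yy' s1 s2.
have := approx_close s0 s0' k0 a a' yy' s1 s2.
have := op_norm_lipschitz (linear_part B) (linear_part B').
have := op_norm_ge0 (linear_part B'); have := op_norm_ge0 (linear_part B).
set b := op_norm _; set b' := op_norm (linear_part B'); set d := op_norm _ => h1 h2 h3 h4.
have kb : kappa * b <= 1 / 16 * b by rewrite ler_wpM2r.
have kb' : kappa * b' <= 1 / 16 * b' by rewrite ler_wpM2r.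
have : kappa * b <= kappa * (2 * b') by rewrite ler_wpM2l //; lra.
by lra.
Qed.

Lemma approx_ratio kappa F y s B y' s' B' : 0 < s -> 0 < s' ->
  0 <= kappa -> kappa <= 1 / 16 ->
  approx kappa F y s B -> approx kappa F y' s' B' ->
  enorm (y - y') <= Num.max s s' -> s' <= 2 * s -> s <= 2 * s' ->
  op_norm (linear_part B) <= (1 + 6 * kappa) * op_norm (linear_part B').
Proof.
move=> s0 s0' k0 k1 a a' yy' s1 s2.
have := approx_compat s0 s0' k0 k1 a a' yy' s1 s2.
have := op_norm_lipschitz (linear_part B) (linear_part B'); lra.
Qed.

Lemma flat_family kappa F : flat kappa F ->
  exists A : 'rV[R]_n -> R -> affine_map R n N,
    forall y s, 0 < s -> approx kappa F y s (A y s).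
Proof.
move=> Ffl.
have /choice[A HA] : forall p : 'rV[R]_n * R, exists B, 0 < p.2 -> approx kappa F p.1 p.2 B.
  move=> [y s] /=; have [s0|s0] := ltP 0 s.
    by have [B a] := Ffl y s s0; exists B.
  by exists (AffineMap 0 0) => ?.
by exists (fun y s => A (y, s)) => y s; exact: (HA (y, s)).
Qed.

Lemma flat_almost_affine kappa eps F : 0 <= kappa -> kappa <= 1 / 16 ->
  6 * kappa <= eps -> flat kappa F -> almost_affine eps setT F.
Proof.
move=> k0 k1 ke /flat_family[A HA]; exists A; split.
  move=> y y' s s' _ _ s0 s0' yy' /andP[r1 r2].
  have q1 : s <= 2 * s' by rewrite -ler_pdivrMr.
  have q2 : s' <= 2 * s.
    by move: r1; rewrite ler_pdivlMr //; lra.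
  have c1 := approx_compat s0 s0' k0 k1 (HA _ _ s0) (HA _ _ s0') yy' q2 q1.
  rewrite enorm_distC Order.TotalTheory.maxC in yy'.
  have c2 := approx_compat s0' s0 k0 k1 (HA _ _ s0') (HA _ _ s0) yy' q1 q2.
  rewrite op_norm_distC in c2.
  have h b : 0 <= b -> 6 * kappa * b <= eps * b by move=> b0; rewrite ler_wpM2r.
  have := h _ (op_norm_ge0 (linear_part (A y s))).
  have := h _ (op_norm_ge0 (linear_part (A y' s'))).
  by rewrite minElt; case: ifP => _; lra.
move=> y s _ s0; apply: ge_ereal_sup => _ [z [_ zy] <-]; rewrite lee_fin.
have [_ _ H] := HA y s s0; apply: le_trans (H z _) _.
  by rewrite /eball /= in zy; lra.
have bs : 0 <= op_norm (linear_part (A y s)) * s by rewrite mulr_ge0 ?op_norm_ge0 // ltW.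
by rewrite -!mulrA ler_wpM2r //; lra.
Qed.

(** At scale |w - y|, the affine map sends the sphere through w almost to a sphere. *)
Lemma flat_weak_qs kappa F z w y : 0 <= kappa -> kappa <= 1 / 16 -> flat kappa F ->
  enorm (z - y) <= enorm (w - y) ->
  enorm (F z - F y) <= (1 + 10 * kappa) * enorm (F w - F y).
Proof.
move=> k0 k1 Ffl zw; have [wy|wy] := eqVneq (enorm (w - y)) 0.
  have -> : z = y.
    apply/eqP; rewrite -subr_eq0; apply/eqP/enorm_eq0/eqP.
    by rewrite eq_le enorm_ge0 -wy zw.
  by rewrite subrr enorm0 mulr_ge0 ?enorm_ge0 //; lra.
have s0 : 0 < enorm (w - y) by rewrite lt0r wy enorm_ge0.
have [B a] := Ffl y _ s0.
have h1 : enorm (y - y) <= 4 * enorm (w - y) by rewrite subrr enorm0; lra.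
have h2 : enorm (w - y) <= 4 * enorm (w - y) by lra.
have h3 : enorm (z - y) <= 4 * enorm (w - y) by lra.
have := approx_upper a h3 h1; have := approx_lower a h2 h1.
case: a => b0 _ _; set b := op_norm _ in b0 *; set s := enorm (w - y) in s0 zw *.
have bz : b * enorm (z - y) <= b * s by rewrite ler_pM2l.
have bs : 0 < b * s by rewrite mulr_gt0.
move=> l1 l2.
have : (1 - 3 * kappa) * (b * s) <= enorm (F w - F y) by lra.
have : enorm (F z - F y) <= (1 + 2 * kappa) * (b * s) by lra.
move=> u1 u2; apply: le_trans u1 _.
apply: le_trans (_ : (1 + 10 * kappa) * ((1 - 3 * kappa) * (b * s)) <= _).
  by rewrite [leRHS]mulrA ler_pM2r //; nra.
by rewrite ler_wpM2l //; lra.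
Qed.

Lemma flat_weak_qs_excess kappa eps F : 0 <= kappa -> kappa <= 1 / 16 ->
  10 * kappa <= eps -> flat kappa F -> (weak_qs_excess F setT <= eps%:E)%E.
Proof.
move=> k0 k1 ke Ffl; rewrite /weak_qs_excess leeBlDr //.
apply: ereal_inf_lbound; exists (eps + 1); last by rewrite EFinD.
split=> [|z w y _ _ _ zw]; first by lra.
apply: le_trans (flat_weak_qs k0 k1 Ffl zw) _.
by rewrite ler_wpM2r ?enorm_ge0 //; lra.
Qed.

Lemma flat_growth kappa F y s B k B' : 0 < s -> 0 <= kappa -> kappa <= 1 / 16 ->
  flat kappa F -> approx kappa F y s B -> approx kappa F y (2 ^+ k * s) B' ->
  op_norm (linear_part B) <= (1 + 6 * kappa) ^+ k.+1 * op_norm (linear_part B') /\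
  op_norm (linear_part B') <= (1 + 6 * kappa) ^+ k.+1 * op_norm (linear_part B).
Proof.
move=> s0 k0 k1 Ffl a; elim: k B' => [|k IH] B' a'.
  rewrite expr0 mul1r in a'.
  by split; rewrite expr1; [apply: (approx_ratio s0 s0 k0 k1 a a')|
    apply: (approx_ratio s0 s0 k0 k1 a' a)]; rewrite ?subrr ?enorm0 ?maxxx; lra.
have sk : 0 < 2 ^+ k * s by rewrite mulr_gt0 ?exprn_gt0.
have sk1 : 0 < 2 ^+ k.+1 * s by rewrite mulr_gt0 ?exprn_gt0.
have [B1 a1] := Ffl y _ sk.
have [h1 h2] := IH _ a1.
have e : 2 ^+ k.+1 * s = 2 * (2 ^+ k * s) by rewrite exprS mulrA.
have q0 : 0 <= 1 + 6 * kappa by lra.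
have mx : enorm (y - y) <= Num.max (2 ^+ k * s) (2 ^+ k.+1 * s).
  by rewrite subrr enorm0 le_max ltW.
have mx' : enorm (y - y) <= Num.max (2 ^+ k.+1 * s) (2 ^+ k * s).
  by rewrite subrr enorm0 le_max ltW.
have h3 := approx_ratio sk sk1 k0 k1 a1 a' mx ltac:(lra) ltac:(lra).
have h4 := approx_ratio sk1 sk k0 k1 a' a1 mx' ltac:(lra) ltac:(lra).
rewrite exprSr; split.
  apply: le_trans h1 _; rewrite -mulrA ler_wpM2l ?exprn_ge0 //.
by apply: le_trans h4 _; rewrite (mulrC _ (1 + 6 * kappa)) -mulrA ler_wpM2l.
Qed.

Lemma dyadic_bracket (t : R) : 1 <= t -> exists k, 2 ^+ k <= t < 2 ^+ k.+1.
Proof.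
move=> t1.
have ex : exists k, t < 2 ^+ k.+1.
  exists (Num.truncn t); apply: lt_le_trans (truncnS_gt _) _.
  by rewrite -natrX ler_nat ltnW // ltn_expl.
exists (ex_minn ex); case: ex_minnP => -[|k] tk kmin; first by rewrite expr0 t1.
by rewrite tk andbT leNgt; apply/negP => /kmin; rewrite ltnn.
Qed.

(** The dyadic growth bound turns into a power bound on the ratio of the
derivatives at scales [s] and [s']: one factor 2 absorbs the incomplete last
step, and the square of [1 + 6 * kappa] stays below 2. *)
Lemma flat_ratio kappa F y s s' B B' : 0 < s -> s <= s' -> 0 <= kappa -> kappa <= 1 / 16 ->
  flat kappa F -> approx kappa F y s B -> approx kappa F y s' B' ->
  op_norm (linear_part B) <= 2 * Num.sqrt (s' / s) * op_norm (linear_part B') /\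
  op_norm (linear_part B') <= 2 * Num.sqrt (s' / s) * op_norm (linear_part B).
Proof.
move=> s0 ss' k0 k1 Ffl a a'; have s0' : 0 < s' by exact: lt_le_trans ss'.
have t1 : 1 <= s' / s by rewrite ler_pdivlMr // mul1r.
have [k /andP[kt tk]] := dyadic_bracket t1.
have sk : 0 < 2 ^+ k * s by rewrite mulr_gt0 ?exprn_gt0.
have [B1 a1] := Ffl y _ sk.
have [g1 g2] := flat_growth s0 k0 k1 Ffl a a1.
have q1 : 2 ^+ k * s <= s' by rewrite -ler_pdivlMr.
have q2 : s' <= 2 * (2 ^+ k * s) by rewrite mulrA -exprS -ler_pdivrMr // ltW.
have mx b c : 0 < b -> enorm (y - y) <= Num.max b c.
  by move=> b0; rewrite subrr enorm0 le_max ltW.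
have l1 := approx_ratio sk s0' k0 k1 a1 a' (mx _ _ sk) ltac:(lra) ltac:(lra).
have l2 := approx_ratio s0' sk k0 k1 a' a1 (mx _ _ s0') ltac:(lra) ltac:(lra).
set q := 1 + 6 * kappa in g1 g2 l1 l2.
have q0 : 1 <= q by rewrite /q; lra.
have qq : q ^+ 2 <= 2 by rewrite /q; nra.
have q3 : q ^+ k <= Num.sqrt (s' / s).
  apply: ler_sqr2; first exact: sqrtr_ge0.
  rewrite sqr_sqrtr; last by lra.
  apply: le_trans kt; rewrite -exprM mulnC exprM.
  by apply: lerXn2r => //; rewrite nnegrE ?exprn_ge0 //; lra.
have q4 : q * q ^+ k.+1 <= 2 * Num.sqrt (s' / s).
  by rewrite exprS mulrA -expr2; apply: ler_pM; rewrite ?exprn_ge0 //; lra.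
split.
  apply: le_trans g1 _; apply: le_trans (_ : q ^+ k.+1 * (q * op_norm (linear_part B')) <= _).
    by rewrite ler_wpM2l // exprn_ge0 //; lra.
  by rewrite mulrA ler_wpM2r ?op_norm_ge0 // mulrC.
apply: le_trans l2 _; apply: le_trans (_ : q * (q ^+ k.+1 * op_norm (linear_part B)) <= _).
  by rewrite ler_wpM2l //; lra.
by rewrite mulrA ler_wpM2r ?op_norm_ge0.
Qed.

Lemma sqrt_ratio_mul (s s' : R) : 0 < s -> 0 < s' ->
  Num.sqrt (s' / s) * s = Num.sqrt (s / s') * s'.
Proof.
move=> s0 s0'; have d1 : 0 <= s' / s by rewrite divr_ge0 // ltW.
have d2 : 0 <= s / s' by rewrite divr_ge0 // ltW.
apply/eqP; rewrite -(@eqrXn2 _ 2) ?mulr_ge0 ?sqrtr_ge0 ?(ltW s0) ?(ltW s0') //.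
rewrite [X in X == _]exprMn [X in _ == X]exprMn !sqr_sqrtr //.
by apply/eqP; field; rewrite !lt0r_neq0.
Qed.

(** A power below 1 for small ratios and above 1 for large ones. This choice has an
explicit continuous inverse. *)
Definition qs_gauge (t : R) : R := 4 * Num.max (Num.sqrt t) (t ^+ 2).

Lemma flat_qs kappa F a b y t : 0 <= kappa -> kappa <= 1 / 16 -> flat kappa F -> 0 < t ->
  enorm (a - y) <= t * enorm (b - y) ->
  enorm (F a - F y) <= qs_gauge t * enorm (F b - F y).
Proof.
move=> k0 k1 Ffl t0 ab.
have g0 : 0 <= qs_gauge t by rewrite mulr_ge0 // le_max sqrtr_ge0.
have [->|ay] := eqVneq a y; first by rewrite subrr enorm0 mulr_ge0 ?enorm_ge0.
have s0 : 0 < enorm (a - y) by rewrite enorm_gt0 // subr_eq0.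
have s0' : 0 < enorm (b - y) by rewrite -(pmulr_rgt0 _ t0) (lt_le_trans s0).
set s := enorm (a - y) in ab s0; set s' := enorm (b - y) in ab s0'.
have [A Aa] := Ffl y _ s0; have [B Bb] := Ffl y _ s0'.
have yy c : 0 < c -> enorm (y - y) <= 4 * c by move=> c0; rewrite subrr enorm0; lra.
have u := approx_upper Aa (_ : enorm (a - y) <= 4 * s) (yy _ s0).
have l := approx_lower Bb (_ : enorm (b - y) <= 4 * s') (yy _ s0').
rewrite -/s in u; rewrite -/s' in l.
have {}u : enorm (F a - F y) <= (1 + 2 * kappa) * (op_norm (linear_part A) * s).
  by apply: le_trans (u _) _; [lra|lra].
have {}l : (1 - 3 * kappa) * (op_norm (linear_part B) * s') <= enorm (F b - F y).
  by apply: le_trans (l _); [lra|lra].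
case: (Aa) => A0 _ _; case: (Bb) => B0 _ _.
set x := op_norm _ in u A0; set z := op_norm _ in l B0.
have t1 : s / s' <= t by rewrite ler_pdivrMr.
suff H : x * s <= 2 * Num.max (Num.sqrt t) (t ^+ 2) * (z * s').
  have zs : 0 < z * s' by rewrite mulr_gt0.
  have m0 : 0 <= Num.max (Num.sqrt t) (t ^+ 2) by rewrite le_max sqrtr_ge0.
  rewrite /qs_gauge; move: (Num.max _ _) m0 H => m m0 H.
  have xs : 0 < x * s by rewrite mulr_gt0.
  apply: le_trans u _; apply: le_trans (_ : 9 / 8 * (2 * m * (z * s')) <= _).
    by apply: ler_pM => //; lra.
  apply: le_trans (_ : 4 * m * (13 / 16 * (z * s')) <= _); last first.
    rewrite ler_wpM2l ?mulr_ge0 //; apply: le_trans l.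
    by rewrite ler_pM2r //; lra.
  have : 0 <= m * (z * s') by rewrite mulr_ge0 // ltW.
  by lra.
have [ss'|s's] := leP s s'.
  have [h _] := flat_ratio s0 ss' k0 k1 Ffl Aa Bb.
  apply: le_trans (_ : 2 * Num.sqrt (s' / s) * z * s <= _).
    by rewrite ler_pM2r.
  have e : Num.sqrt (s' / s) * s = Num.sqrt (s / s') * s'.
    exact: sqrt_ratio_mul.
  have -> : 2 * Num.sqrt (s' / s) * z * s = 2 * Num.sqrt (s / s') * (z * s').
    by rewrite -mulrA (mulrC z s) mulrA -(mulrA 2) e; ring.
  by rewrite ler_pM2r ?mulr_gt0 // ler_pM2l // le_max ler_wsqrtr.
have [_ h] := flat_ratio s0' (ltW s's) k0 k1 Ffl Bb Aa.
apply: le_trans (_ : 2 * Num.sqrt (s / s') * z * s <= _).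
  by rewrite ler_pM2r.
have ts : 1 <= s / s' by rewrite ler_pdivlMr // mul1r ltW.
have -> : 2 * Num.sqrt (s / s') * z * s = 2 * (Num.sqrt (s / s') * (s / s')) * (z * s').
  by field; rewrite lt0r_neq0.
rewrite ler_pM2r ?mulr_gt0 // ler_pM2l // le_max; apply/orP; right.
apply: le_trans (_ : (s / s') ^+ 2 <= _); last first.
  by apply: lerXn2r => //; rewrite nnegrE; lra.
rewrite expr2 ler_wpM2r //; first by lra.
apply: ler_sqr2; first by lra.
by rewrite sqr_sqrtr ?expr2 ?ler_peMl //; lra.
Qed.

End Flat.

Section Gauge.
Variable R : realType.

Lemma qs_gauge_homeo : increasing_homeo_pos (@qs_gauge R).
Proof.
pose g (w : R) : R := Num.min ((w / 4) ^+ 2) (Num.sqrt (w / 4)).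
have gpos (w : R) : 0 < w -> 0 < g w.
  by move=> w0; rewrite /g lt_min exprn_gt0 ?sqrtr_gt0 divr_gt0.
have qpos (w : R) : 0 < w -> 0 < qs_gauge w.
  by move=> w0; rewrite /qs_gauge mulr_gt0 // lt_max sqrtr_gt0 w0.
have s1 (t : R) : 0 <= t -> t <= 1 -> t <= Num.sqrt t.
  by move=> t0 t1; apply: ler_sqr2; rewrite ?sqrtr_ge0 // sqr_sqrtr // expr2 ler_piMl.
have s2 (t : R) : 1 <= t -> Num.sqrt t <= t.
  by move=> t1; apply: ler_sqr2; rewrite ?sqr_sqrtr ?expr2 ?ler_peMl //; lra.
have sq1 (t : R) : 0 <= t -> Num.sqrt (t ^+ 2) = t.
  by move=> t0; rewrite sqrtr_sqr ger0_norm.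
have e1 (t : R) : 0 <= t -> t <= 1 -> qs_gauge t = 4 * Num.sqrt t.
  move=> t0 t1; rewrite /qs_gauge max_l //; apply: le_trans (s1 t t0 t1).
  by rewrite expr2 ler_piMl.
have e2 (t : R) : 1 <= t -> qs_gauge t = 4 * t ^+ 2.
  move=> t1; rewrite /qs_gauge max_r //; apply: le_trans (s2 t t1) _.
  by rewrite expr2 ler_peMl //; lra.
have f1 (t : R) : 0 <= t -> t <= 1 -> g (4 * t) = t ^+ 2.
  move=> t0 t1; rewrite /g mulrC mulKf // min_l //; apply: le_trans (s1 t t0 t1).
  by rewrite expr2 ler_piMl.
have f2 (t : R) : 1 <= t -> g (4 * t) = Num.sqrt t.
  move=> t1; rewrite /g mulrC mulKf // min_r //; apply: le_trans (s2 t t1) _.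
  by rewrite expr2 ler_peMl //; lra.
have gK (t : R) : 0 < t -> g (qs_gauge t) = t.
  move=> t0; have [t1|t1] := leP t 1.
    rewrite (e1 t (ltW t0) t1) f1 ?sqrtr_ge0 ?sqr_sqrtr ?(ltW t0) //.
    by rewrite -sqrtr1 ler_wsqrtr.
  by rewrite (e2 t (ltW t1)) f2 ?sq1 ?(ltW t0) // exprn_ege1 // ltW.
have qK (w : R) : 0 < w -> qs_gauge (g w) = w.
  move=> w0; have -> : w = 4 * (w / 4) by field.
  have t0 : 0 < w / 4 by rewrite divr_gt0.
  move: (w / 4) t0 => t t0; have [t1|t1] := leP t 1.
    by rewrite (f1 t (ltW t0) t1) e1 ?sq1 ?exprn_ge0 ?expr_le1 ?(ltW t0).
  rewrite (f2 t (ltW t1)) e2 ?sqr_sqrtr ?(ltW t0) //.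
  by rewrite -sqrtr1 ler_wsqrtr // ltW.
have cq : continuous (@qs_gauge R : R -> R).
  move=> t; apply: cvgM; first exact: cvg_cst.
  apply: (@continuous_max _ _ (fun t : R => Num.sqrt t) (fun t : R => t ^+ 2) t).
    exact: sqrt_continuous.
  exact: exprn_continuous.
have cg : continuous (g : R -> R).
  move=> t.
  have c4 : {for t, continuous (fun w : R => w / 4)} by exact: mulrr_continuous.
  apply: (@continuous_min _ _ (fun t : R => (t / 4) ^+ 2) (fun t : R => Num.sqrt (t / 4)) t).
    by apply: (@continuous_comp _ _ _ (fun w : R => w / 4) (fun v : R => v ^+ 2)) => //; exact: exprn_continuous.
  by apply: (@continuous_comp _ _ _ (fun w : R => w / 4) (fun v : R => Num.sqrt v)) => //; exact: sqrt_continuous.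
split.
- split; first exact: continuous_subspaceT.
  exists g; split; last exact: continuous_subspaceT.
  by move=> t; rewrite inE /= in_itv /= andbT; exact: gK.
- apply/seteqP; split=> [_ [t + <-]|w]; rewrite /= !in_itv /= !andbT; first exact: qpos.
  by move=> w0; exists (g w); rewrite ?qK //= in_itv /= andbT gpos.
- move=> a b; rewrite !in_itv /= !andbT => a0 b0 ab; rewrite /qs_gauge ltr_pM2l //.
  rewrite gt_max !lt_max ltr_sqrt // ab /=; apply/orP; right.
  by rewrite ltr_pXn2r // nnegrE ltW.
Qed.

End Gauge.

Section FlatQuasisymmetric.
Variables (R : realType) (n N : nat) (kappa : R) (F : 'rV[R]_n -> 'rV[R]_N).
Hypotheses (n_gt0 : (0 < n)%N) (k0 : 0 <= kappa) (k1 : kappa <= 1 / 16).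
Hypothesis Fflat : flat kappa F.
Implicit Types (y z : 'rV[R]_n).

Lemma flat_continuous : continuous F.
Proof.
move=> y; have [e e1] := exists_unit R n_gt0.
have [_] := @cvgrPdist_lt R 'rV[R]_N 'rV[R]_n (nbhs y) _ F (F y); apply => d d0.
pose D := enorm (F (y + e) - F y).
have D0 : 0 <= D by exact: enorm_ge0.
have c0 : 0 < d / (4 * (D + 1)) by rewrite divr_gt0 // mulr_gt0 //; lra.
pose t := Num.min 1 ((d / (4 * (D + 1))) ^+ 2).
have t0 : 0 < t by rewrite /t lt_min ltr01 exprn_gt0.
have t1 : t <= 1 by rewrite /t ge_min lexx.
have tc : Num.sqrt t <= d / (4 * (D + 1)).
  rewrite -[leRHS]ger0_norm ?(ltW c0) // -sqrtr_sqr ler_wsqrtr //.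
  by rewrite /t ge_min lexx orbT.
have gt : qs_gauge t <= 4 * Num.sqrt t.
  rewrite /qs_gauge ler_pM2l // ge_max lexx /=; apply: ler_sqr2; first exact: sqrtr_ge0.
  rewrite sqr_sqrtr ?(ltW t0) // -exprM; apply: le_trans (_ : t ^+ 1 <= _); last by rewrite expr1.
  by apply: ler_wiXn2l => //; exact: ltW.
have n0 : 0 < n%:R :> R by rewrite ltr0n.
apply/nbhs_ballP; exists (t / n%:R) => /=; first by rewrite divr_gt0.
move=> z; rewrite -ball_normE /= distrC => yz.
rewrite distrC; apply: le_lt_trans (mx_norm_le_enorm _) _.
have zt : enorm (z - y) <= t * enorm (y + e - y).
  rewrite [y + e]addrC addrK e1 mulr1; apply: le_trans (enorm_le_mx_norm _) _.
  by rewrite mulrC -ler_pdivlMr // ltW.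
apply: le_lt_trans (flat_qs k0 k1 Fflat t0 zt) _; rewrite -/D.
apply: le_lt_trans (_ : d / (D + 1) * D < _).
  apply: le_trans (_ : 4 * (d / (4 * (D + 1))) * D <= _).
    by rewrite ler_wpM2r // (le_trans gt) // ler_pM2l.
  by rewrite le_eqVlt; apply/orP; left; apply/eqP; field; apply: lt0r_neq0; lra.
rewrite mulrAC ltr_pdivrMr; last by lra.
by rewrite ltr_pM2l //; lra.
Qed.

(** Weak quasisymmetry compares an arbitrary point at distance at least [s]
with a point at distance exactly [s], where the affine map gives a bound. *)
Lemma flat_far y s B z : 0 < s -> approx kappa F y s B -> s <= enorm (z - y) ->
  op_norm (linear_part B) * s <= 2 * enorm (F z - F y).
Proof.
move=> s0 a sz; have [e e1] := exists_unit R n_gt0.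
have ye : enorm (y + s *: e - y) = s by rewrite [y + _]addrC addrK enormZ e1 mulr1 gtr0_norm.
have h1 : enorm (y + s *: e - y) <= 4 * s by rewrite ye; lra.
have h2 : enorm (y - y) <= 4 * s by rewrite subrr enorm0; lra.
have := approx_lower a h1 h2; rewrite ye => l.
rewrite -ye in sz; have := flat_weak_qs k0 k1 Fflat sz.
move: l; case: a => b0 _ _; set b := op_norm _ in b0 *.
have bs : 0 < b * s by rewrite mulr_gt0.
set X := enorm _; set Y := enorm _ => h3 h4.
have Y0 : 0 <= Y by exact: enorm_ge0.
have h5 : kappa * (b * s) <= 1 / 16 * (b * s) by rewrite ler_pM2r.
have h6 : kappa * Y <= 1 / 16 * Y by rewrite ler_wpM2r.
by lra.
Qed.

Lemma flat_inj : injective F.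
Proof.
move=> z y Fzy; apply/eqP; rewrite -subr_eq0; apply/negPn/negP => /enorm_gt0 s0.
have [B a] := Fflat y s0.
have := flat_far s0 a (lexx _); rewrite Fzy subrr enorm0 mulr0.
by case: a => b0 _ _; rewrite leNgt mulr_gt0.
Qed.

(** The inverse is continuous because, by [flat_far], points at distance at least [d]
have images that are uniformly far apart. *)
Lemma flat_embedding : topological_embedding setT F.
Proof.
split; first by apply: continuous_subspaceT; exact: flat_continuous.
pose g q := xget (0 : 'rV[R]_n) [set z | F z = q].
have gK z : g (F z) = z.
  apply: flat_inj; rewrite /g; case: xgetP => [w _ //|/(_ z) H].
  by exfalso; exact: H.
exists g; split; first by move=> z _.
apply/subspace_continuousP => _ [y _ <-]; apply/cvgrPdist_lt => d d0.
have [B a] := Fflat y d0.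
have b0 : 0 < op_norm (linear_part B) * d / 2.
  by case: a => b0 _ _; rewrite divr_gt0 // mulr_gt0.
rewrite near_withinE; apply/nbhs_ballP.
exists (op_norm (linear_part B) * d / 2 / (N%:R + 1)) => /=.
  by rewrite divr_gt0 // ltr_wpDl.
move=> q /= yq [z _ qz]; move: yq; rewrite -{}qz -ball_normE /= distrC => zy.
rewrite (gK y : from_subspace (range F) g (F y) = y) (gK z : from_subspace (range F) g (F z) = z).
rewrite distrC; apply: le_lt_trans (mx_norm_le_enorm _) _.
rewrite ltNge; apply/negP => dz; have := flat_far d0 a dz.
have : enorm (F z - F y) <= (N%:R + 1) * `|F z - F y|.
  apply: le_trans (enorm_le_mx_norm _) _; rewrite ler_wpM2r //; lra.
by move: zy; rewrite ltr_pdivlMr ?ltr_wpDl // mulrC; lra.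
Qed.

Lemma flat_quasisymmetric : quasisymmetric setT F.
Proof.
split; first exact: flat_embedding.
exists (@qs_gauge R); split; first exact: qs_gauge_homeo.
by move=> a b y t _ _ _ t0; exact: (flat_qs k0 k1 Fflat).
Qed.

End FlatQuasisymmetric.

(** * Affine planes and beta numbers *)

Section Planes.
Variable R : realType.
Implicit Types (n m N : nat).

(** The Gram matrix of the rows of [W] is close to the identity, so its quadratic form
is bounded below by half the squared norm. This makes it invertible and controls
the solution of minimal norm, which is a combination of the rows. *)
Lemma gram_solve m N (W : 'M[R]_(m, N)) (eta : R) :
  (forall i j, `|(W *m W^T) i j - (i == j)%:R| <= eta) -> 0 <= eta -> eta * m%:R <= 1 / 2 ->
  forall t : 'rV[R]_m, exists v : 'rV[R]_N, v *m W^T = t /\ enorm v <= 2 * enorm t.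
Proof.
move=> HG eta0 etam; set G := W *m W^T.
have quad (b : 'rV[R]_m) : enorm b ^+ 2 / 2 <= edot (b *m G) b.
  have -> : edot (b *m G) b = enorm b ^+ 2 +
      \sum_j \sum_i b ord0 i * b ord0 j * (G i j - (i == j)%:R).
    rewrite -edotvv /edot -big_split /=; apply: eq_bigr => j _.
    rewrite mxE -[X in _ = X + _](_ : (\sum_i b ord0 i * b ord0 j * (i == j)%:R) = _).
      rewrite -big_split /= mulr_suml; apply: eq_bigr => i _; ring.
    rewrite (bigD1 j) //= eqxx mulr1 big1 ?addr0 // => i ij.
    by rewrite (negbTE ij) mulr0.
  have : `|\sum_j \sum_i b ord0 i * b ord0 j * (G i j - (i == j)%:R)| <=
      eta * m%:R * enorm b ^+ 2.
    apply: le_trans (ler_norm_sum _ _ _) _.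
    apply: le_trans (_ : \sum_(j < m) \sum_(i < m)
       (eta * (b ord0 i ^+ 2 / 2 + b ord0 j ^+ 2 / 2)) <= _).
      apply: ler_sum => j _; apply: le_trans (ler_norm_sum _ _ _) _.
      apply: ler_sum => i _; rewrite normrM mulrC; apply: ler_pM => //;
      have := sqr_ge0 (b ord0 i - b ord0 j); have := sqr_ge0 (b ord0 i + b ord0 j).
      by move=> ? ?; rewrite ler_norml; apply/andP; split; lra.
    have -> : \sum_(j < m) \sum_(i < m) (eta * (b ord0 i ^+ 2 / 2 + b ord0 j ^+ 2 / 2)) =
        \sum_(j < m) eta * (enorm b ^+ 2 / 2 + m%:R * (b ord0 j ^+ 2 / 2)).
      apply: eq_bigr => j _; rewrite -mulr_sumr big_split /= -mulr_suml -enorm_sqr.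
      by rewrite sumr_const card_ord mulr_natl.
    rewrite -mulr_sumr big_split /= sumr_const card_ord -mulr_sumr -mulr_suml -enorm_sqr.
    by rewrite -mulr_natl le_eqVlt; apply/orP; left; apply/eqP; field.
  have : eta * m%:R * enorm b ^+ 2 <= 1 / 2 * enorm b ^+ 2.
    by rewrite ler_wpM2r ?sqr_ge0.
  by rewrite ler_norml => h /andP[h1 h2]; lra.
have Gu : G \in unitmx.
  rewrite unitmxE unitfE; apply/negP => /det0P[b b0 bG].
  have := quad b; rewrite bG.
  have -> : edot (0 : 'rV[R]_m) b = 0 by rewrite /edot big1 // => i _; rewrite mxE mul0r.
  have : 0 < enorm b ^+ 2 by rewrite exprn_gt0 // enorm_gt0.
  by lra.
move=> t; pose b := t *m invmx G.
have bG : b *m G = t by rewrite /b mulmxKV.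
exists (b *m W); split; first by rewrite -mulmxA.
have hb : enorm b <= 2 * enorm t.
  have := quad b; rewrite bG; have := edot_le t b; rewrite ler_norml => /andP[_ h1] h2.
  have [b0|b0] := eqVneq (enorm b) 0; first by rewrite b0 mulr_ge0 ?enorm_ge0.
  have bp : 0 < enorm b by rewrite lt0r b0 enorm_ge0.
  have : enorm b * (enorm b / 2) <= enorm b * enorm t by lra.
  by rewrite ler_pM2l //; lra.
apply: ler_sqr2; first by rewrite mulr_ge0 ?enorm_ge0.
have -> : enorm (b *m W) ^+ 2 = edot (b *m G) b.
  have := edot_mulmx (b *m W) (b *m W).
  rewrite trmx_mul mulmxA -(mulmxA b) -/G edot_mulmx edotvv => /matrixP/(_ ord0 ord0).
  by rewrite !mxE eqxx !mulr1n.
rewrite bG; have := edot_le t b; rewrite ler_norml => /andP[_ h1].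
have : enorm t * enorm b <= enorm t * (2 * enorm t) by rewrite ler_wpM2l ?enorm_ge0.
have : 0 <= enorm t ^+ 2 by rewrite sqr_ge0.
by rewrite exprMn !expr2; lra.
Qed.

Lemma level_set_plane n m (U : 'M[R]_(n + m, m)) (c : 'rV[R]_m) :
  (forall t : 'rV[R]_m, exists v : 'rV[R]_(n + m), v *m U = t) -> affine_plane n [set q : 'rV[R]_(n + m) | q *m U = c].
Proof.
move=> surj; have [p pc] := surj c.
pose g : 'Hom('rV[R]_(n + m), 'rV[R]_m) := linfun (mulmxr U).
exists p, (lker g); split.
  have gfull : limg g = fullv.
    apply/eqP; rewrite eqEsubv subvf /=; apply/subvP => t _.
    have [v <-] := surj t; have -> : v *m U = g v by rewrite lfunE.
    by rewrite memv_img // memvf.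
  have := limg_ker_dim g fullv; rewrite gfull capfv !dimvf /= /dim /= !mul1n.
  by move=> /eqP; rewrite eqn_add2r => /eqP.
apply/seteqP; split=> q /=; rewrite memv_ker lfunE /= mulmxBl pc.
  by move=> ->; rewrite subrr.
by rewrite subr_eq0 => /eqP.
Qed.

Lemma affine_range_plane n N (A : affine_map R n N) :
  (forall v : 'rV[R]_n, v *m linear_part A = 0 -> v = 0) -> affine_plane n (range A).
Proof.
move=> inj; pose g : 'Hom('rV[R]_n, 'rV[R]_N) := linfun (mulmxr (linear_part A)).
exists (translation_part A), (limg g); split.
  have kg : lker g = 0%VS.
    apply/eqP; rewrite -subv0; apply/subvP => v; rewrite memv_ker lfunE /= => /eqP /inj ->.
    by rewrite mem0v.
  have := limg_ker_dim g fullv; rewrite capfv kg dimv0 add0n !dimvf /= /dim /= mul1n => ->.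
  by [].
apply/seteqP; split=> q /=.
  move=> [z _ <-]; rewrite /affine_eval addrK.
  have -> : z *m linear_part A = g z by rewrite lfunE.
  by rewrite memv_img // memvf.
move=> /memv_imgP[z _ zq]; exists z => //; rewrite /affine_eval.
have -> : z *m linear_part A = g z by rewrite lfunE.
by rewrite -zq subrK.
Qed.

Lemma edist_to_le N (q v : 'rV[R]_N) (V : set 'rV[R]_N) (d : R) :
  V v -> enorm (q - v) <= d -> (edist_to q V <= d%:E)%E.
Proof.
move=> Vv qv; apply: (@le_trans _ _ (enorm (q - v))%:E); last by rewrite lee_fin.
by apply: ereal_inf_lbound; exists v.
Qed.

Lemma edist_to_ge0 N (q : 'rV[R]_N) (V : set 'rV[R]_N) : (0 <= edist_to q V)%E.
Proof. by apply: le_ereal_inf_tmp => _ [v _ <-]; rewrite lee_fin enorm_ge0. Qed.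

Lemma beta_ge0 n N (S : set 'rV[R]_N) p (s : R) : S p -> 0 <= s ->
  (0 <= beta_number n S p s)%E.
Proof.
move=> Sp s0; apply: le_ereal_inf_tmp => _ [V _ <-].
apply: mule_ge0; first by rewrite lee_fin invr_ge0.
apply: le_trans (edist_to_ge0 p V) _; apply: ereal_sup_ubound; exists p => //.
by split=> //=; rewrite /eball /= subrr enorm0.
Qed.

Lemma beta_le n N (S : set 'rV[R]_N) p (s d : R) V : 0 < s -> affine_plane n V ->
  (forall q, S q -> enorm (q - p) <= s -> (edist_to q V <= d%:E)%E) ->
  (beta_number n S p s <= (d / s)%:E)%E.
Proof.
move=> s0 HV H.
apply: (@le_trans _ _ ((s^-1)%:E * ereal_sup [set edist_to q V | q in S `&` eball p s])%E).
  by apply: ereal_inf_lbound; exists V.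
rewrite mulrC EFinM lee_wpmul2l ?lee_fin ?invr_ge0 ?(ltW s0) //.
by apply: ge_ereal_sup => _ [q [Sq qs] <-]; exact: H.
Qed.

Lemma ediam_le N (S : set 'rV[R]_N) (d : R) : 0 <= d ->
  (forall p p', S p -> S p' -> enorm (p - p') <= d) -> (ediam S <= d%:E)%E.
Proof.
move=> d0 H; rewrite /ediam ge_max lee_fin d0 /=; apply: ge_ereal_sup => _ [p Sp [p' Sp' <-]].
by rewrite lee_fin H.
Qed.

Lemma ediam_ge N (S : set 'rV[R]_N) p p' (d : R) : S p -> S p' ->
  d <= enorm (p - p') -> (d%:E <= ediam S)%E.
Proof.
move=> Sp Sp' h; rewrite /ediam le_max; apply/orP; right.
apply: (@le_trans _ _ (enorm (p - p'))%:E); first by rewrite lee_fin.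
by apply: ereal_sup_ubound; exists p => //; exists p'.
Qed.

End Planes.

(** * The weak quasisymmetry constant *)

Section WeakQs.
Variable R : realType.
Implicit Types (n m N : nat).

Definition weak_qs N m (H : R) (X : set 'rV[R]_N) (f : 'rV[R]_N -> 'rV[R]_m) : Prop :=
  forall x y a, X x -> X y -> X a -> enorm (x - a) <= enorm (y - a) ->
    enorm (f x - f a) <= H * enorm (f y - f a).

Lemma weak_qs_excess_ge0 N m (f : 'rV[R]_N -> 'rV[R]_m) X : (0 <= weak_qs_excess f X)%E.
Proof.
rewrite /weak_qs_excess leeBrDr // add0e.
by apply: le_ereal_inf_tmp => _ [H [H1 _] <-]; rewrite lee_fin.
Qed.

Lemma weak_qs_excess_sub N m (f : 'rV[R]_N -> 'rV[R]_m) X Y : X `<=` Y ->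
  (weak_qs_excess f X <= weak_qs_excess f Y)%E.
Proof.
move=> XY; rewrite /weak_qs_excess leeB //.
apply: ereal_inf_le_tmp => _ [H [H1 HY] <-]; exists H => //; split=> // x y a Xx Xy Xa.
by apply: HY; exact: XY.
Qed.

(** The infimum is attained because the defining inequality is closed in the constant,
so the excess can be used as a number. *)
Lemma weak_qs_excessP N m (f : 'rV[R]_N -> 'rV[R]_m) X (c : R) :
  (weak_qs_excess f X <= c%:E)%E ->
  exists h, [/\ 0 <= h, h <= c, weak_qs_excess f X = h%:E & weak_qs (1 + h) X f].
Proof.
move=> hc; have h0 := weak_qs_excess_ge0 f X.
have [h eh] : exists h, weak_qs_excess f X = h%:E.
  by move: hc h0; case: weak_qs_excess => // h _ _; exists h.
rewrite eh !lee_fin in hc h0; exists h; split=> // x y a Xx Xy Xa xy.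
have ec : weak_qs_const f X = (1 + h)%:E.
  move: eh; rewrite /weak_qs_excess; case: weak_qs_const => // k /= [<-].
  by congr EFin; lra.
rewrite leNgt; apply/negP => lt.
have Y0 : 0 <= enorm (f y - f a) by exact: enorm_ge0.
set Y := enorm (f y - f a) in Y0 lt; set Z := enorm (f x - f a) in lt.
pose d := (Z - (1 + h) * Y) / (Y + 1).
have d0 : 0 < d by rewrite divr_gt0 //; lra.
have : (weak_qs_const f X < (1 + h + d)%:E)%E by rewrite ec lte_fin; lra.
move=> /ereal_inf_lt[_ [H [H1 HX] <-]]; rewrite lte_fin => Hd.
have := HX x y a Xx Xy Xa xy; rewrite -/Y -/Z => ZH.
have : H * Y <= (1 + h + d) * Y by rewrite ler_wpM2r // ltW.
have : d * Y < Z - (1 + h) * Y.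
  by rewrite /d mulrAC ltr_pdivrMr; nra.
by lra.
Qed.

End WeakQs.

(** * Weak quasisymmetry flattens the image of a plane *)

Section ImageNearPlane.
Variables (R : realType) (n m : nat).
Implicit Types (w v : 'rV[R]_n).
Local Notation N := (n + m)%N.

Lemma plane_inclE w : plane_incl N w = row_mx w 0.
Proof.
rewrite /plane_incl; have -> : pid_mx n = row_mx 1%:M 0 :> 'M[R]_(n, N).
  rewrite -pid_mx_row; apply/matrixP => i j; rewrite !mxE.
  by case: (_ == _) => //=; rewrite ltn_ord.
by rewrite mul_mx_row mulmx1 mulmx0.
Qed.

Lemma plane_inclB w v : plane_incl N w - plane_incl N v = plane_incl N (w - v).
Proof. by rewrite /plane_incl mulmxBl. Qed.

Lemma enorm_plane_incl w : enorm (plane_incl N w) = enorm w.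
Proof.
rewrite plane_inclE /enorm big_split_ord /= [X in _ + X]big1 ?addr0.
  by congr Num.sqrt; apply: eq_bigr => i _; rewrite row_mxEl.
by move=> i _; rewrite row_mxEr mxE expr0n.
Qed.

Definition normal_vec (j : 'I_m) : 'rV[R]_N := delta_mx ord0 (rshift n j).

Lemma enorm_normal_vec (t : R) j : enorm (t *: normal_vec j) = `|t|.
Proof.
rewrite enormZ /enorm (bigD1 (rshift n j)) //= mxE !eqxx big1 ?addr0 ?expr1n ?sqrtr1 ?mulr1 //.
by move=> i ij; rewrite mxE (negbTE ij) andbF expr0n.
Qed.

Lemma equidistant (q : 'rV[R]_N) (t : R) j : q ord0 (rshift n j) = 0 ->
  enorm (q - t *: normal_vec j) = enorm (q + t *: normal_vec j).
Proof.
move=> q0; congr Num.sqrt; apply: eq_bigr => i _; rewrite !mxE eqxx /=.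
have [->|_] := eqVneq i (rshift n j); first by rewrite q0 !mulr1 !add0r sqrrN.
by rewrite !mulr0 subr0 addr0.
Qed.

Variables (f : 'rV[R]_N -> 'rV[R]_N) (y w0 : 'rV[R]_n) (tau h : R).
Hypotheses (tau_gt0 : 0 < tau) (h_ge0 : 0 <= h) (h_le1 : h <= 1).
Hypothesis fqs : weak_qs (1 + h) (eball (plane_incl N y) tau) f.
Hypothesis w0y : enorm (w0 - y) = tau.

Variable L : R.
Hypothesis LE : enorm (f (plane_incl N w0) - f (plane_incl N y)) = L.
Hypothesis L_gt0 : 0 < L.

Local Notation c := (plane_incl N y).
Local Notation pp j := (c + tau *: normal_vec j).
Local Notation pm j := (c - tau *: normal_vec j).
Local Notation X := (eball c tau).

Local Lemma h2 : 1 + h <= 2.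
Proof. by move: h_le1; lra. Qed.

Local Lemma ch_ge0 (k : nat) : 0 <= k%:R * h.
Proof. by rewrite mulr_ge0. Qed.

Local Lemma Xc : X c. Proof. by rewrite /eball /= subrr enorm0 ltW. Qed.

Local Lemma Xincl w : enorm (w - y) <= tau -> X (plane_incl N w).
Proof. by rewrite /eball /= plane_inclB enorm_plane_incl. Qed.

Local Lemma dpp j : enorm (pp j - c) = tau.
Proof. by rewrite [c + _]addrC addrK enorm_normal_vec gtr0_norm. Qed.

Local Lemma dpm j : enorm (pm j - c) = tau.
Proof. by rewrite [X in enorm X]addrC addKr enormN enorm_normal_vec gtr0_norm. Qed.

Local Lemma Xpp j : X (pp j). Proof. by rewrite /eball /= dpp. Qed.
Local Lemma Xpm j : X (pm j). Proof. by rewrite /eball /= dpm. Qed.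
Local Lemma Xw0 : X (plane_incl N w0). Proof. by apply: Xincl; rewrite w0y. Qed.

Local Lemma inball q : X q -> enorm (f q - f c) <= 2 * L.
Proof.
move=> Xq; have : enorm (q - c) <= enorm (plane_incl N w0 - c).
  by rewrite plane_inclB enorm_plane_incl w0y.
move=> /(fqs Xq Xw0 Xc); rewrite LE => H; apply: le_trans H _.
by rewrite ler_wpM2r ?(ltW L_gt0) // h2.
Qed.

Local Lemma sphere q : X q -> enorm (q - c) = tau -> L <= 2 * enorm (f q - f c).
Proof.
move=> Xq qc; have : enorm (plane_incl N w0 - c) <= enorm (q - c).
  by rewrite plane_inclB enorm_plane_incl w0y qc.
move=> /(fqs Xw0 Xq Xc); rewrite LE => H; apply: le_trans H _.
by rewrite ler_wpM2r ?enorm_ge0 // h2.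
Qed.

Local Notation dia j := (enorm (f (pp j) - f (pm j))).

Local Lemma dia_ge j : L <= 4 * dia j.
Proof.
have : enorm (c - pm j) <= enorm (pp j - pm j).
  rewrite enorm_distC dpm.
  have -> : pp j - pm j = (2 * tau) *: normal_vec j.
    by apply/rowP => i; rewrite !mxE; ring.
  by rewrite enorm_normal_vec gtr0_norm; move: tau_gt0; lra.
move=> /(fqs Xc (Xpp j) (Xpm j)) h1.
have h2 : enorm (f c - f (pm j)) <= 2 * dia j.
  by apply: le_trans h1 _; rewrite ler_wpM2r ?enorm_ge0 // h2.
have := sphere (Xpm j) (dpm j); rewrite (enorm_distC (f (pm j))); lra.
Qed.

Local Lemma dia_gt0 j : 0 < dia j. Proof. by have := dia_ge j; move: L_gt0; lra. Qed.

Local Notation mid j := ((enorm (f (pp j)) ^+ 2 - enorm (f (pm j)) ^+ 2) / 2).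

(** A point equidistant from the two poles [pp j] and [pm j] is mapped near the
bisector of the images of the poles, with an error linear in [h]. *)
Local Lemma bisector j q : X q -> (q - c) ord0 (rshift n j) = 0 ->
  `|edot (f q) (f (pp j) - f (pm j)) / dia j - mid j / dia j| <= 96 * h * L.
Proof.
move=> Xq q0; have eq : enorm (q - pp j) = enorm (q - pm j).
  have -> : q - pp j = (q - c) - tau *: normal_vec j.
    by rewrite opprD addrA.
  have -> : q - pm j = (q - c) + tau *: normal_vec j.
    by rewrite opprB addrA addrAC.
  exact: equidistant.
have e1 : enorm (pp j - q) <= enorm (pm j - q) by rewrite ![enorm (_ - q)]enorm_distC eq.
have e2 : enorm (pm j - q) <= enorm (pp j - q) by rewrite ![enorm (_ - q)]enorm_distC eq.
have := fqs (Xpp j) (Xpm j) Xq e1; have := fqs (Xpm j) (Xpp j) Xq e2.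
set a := enorm (f (pp j) - f q); set b := enorm (f (pm j) - f q) => hb ha.
have a0 : 0 <= a by exact: enorm_ge0.
have b0 : 0 <= b by exact: enorm_ge0.
have aL : a <= 4 * L.
  apply: le_trans (enorm_distD (f c) _ _) _; rewrite (enorm_distC (f c)).
  by have := inball Xq; have := inball (Xpp j); lra.
have bL : b <= 4 * L.
  apply: le_trans (enorm_distD (f c) _ _) _; rewrite (enorm_distC (f c)).
  by have := inball Xq; have := inball (Xpm j); lra.
have key : b ^+ 2 - a ^+ 2 = 2 * (edot (f q) (f (pp j) - f (pm j)) - mid j).
  rewrite /a /b -!edotvv !(edotBl, edotBr).
  by rewrite (edotC (f (pm j)) (f q)) (edotC (f (pp j)) (f q)); field.
have bnd s t : 0 <= s -> 0 <= t -> t <= 4 * L -> s <= (1 + h) * t ->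
    s ^+ 2 - t ^+ 2 <= 48 * h * L ^+ 2.
  move=> s0 t0 tL st.
  have : s ^+ 2 <= (1 + h) ^+ 2 * t ^+ 2 by rewrite -exprMn lerXn2r ?nnegrE // mulr_ge0 //; move: h_ge0; lra.
  have : t ^+ 2 <= 16 * L ^+ 2 by have := lerXn2r 2 (t0 : t \in Num.nneg) (le_trans t0 tL : 4 * L \in Num.nneg) tL; rewrite exprMn; lra.
  have : 0 <= t ^+ 2 by rewrite sqr_ge0.
  move: h_ge0 h_le1; move: (t ^+ 2) (s ^+ 2) (L ^+ 2) => T S LL *.
  have : h * T <= h * (16 * LL) by rewrite ler_wpM2l.
  have : h ^+ 2 * T <= h * T by rewrite ler_wpM2r // expr2 ler_piMl.
  by nra.
have k1 := bnd b a b0 a0 aL hb; have k2 := bnd a b a0 b0 bL ha.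
rewrite -mulrBl normrM normfV (gtr0_norm (dia_gt0 j)) ler_pdivrMr ?dia_gt0 //.
set Z := edot _ _ - _ in key *.
have : `|Z| <= 24 * h * L ^+ 2.
  by rewrite ler_norml; apply/andP; split; lra.
move=> hZ; apply: le_trans hZ _.
have -> : 24 * h * L ^+ 2 = (24 * h * L) * L by ring.
have -> : 96 * h * L * dia j = (24 * h * L) * (4 * dia j) by ring.
by rewrite ler_wpM2l ?dia_ge // !mulr_ge0 // ltW // L_gt0.
Qed.

(** The columns of [U] are the normalized differences of the images of the two poles in
each normal direction. They are almost orthonormal, since the poles of one normal
direction are equidistant from the poles of another one. The plane is a level set
of [U], and the second clause turns a residual into a distance to that plane. *)
Lemma image_near_plane : 1536 * h * m%:R <= 1 ->
  exists (U : 'M[R]_(N, m)) (k : 'rV[R]_m),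
    (forall w, enorm (w - y) <= tau ->
       enorm (f (plane_incl N w) *m U - k) <= m%:R * (96 * h * L)) /\
    (forall t, exists v : 'rV[R]_N, v *m U = t /\ enorm v <= 2 * enorm t).
Proof.
move=> hm.
pose W : 'M[R]_(m, N) := \matrix_(j, i) ((dia j)^-1 * (f (pp j) - f (pm j)) ord0 i).
have WE q j : (q *m W^T) ord0 j = edot q (f (pp j) - f (pm j)) / dia j.
  rewrite mxE /edot mulr_suml; apply: eq_bigr => i _; rewrite !mxE; ring.
exists W^T, (\row_j (mid j / dia j)); split.
  move=> w wy; apply: enorm_le_coords => j.
  rewrite mxE WE !mxE; apply: bisector; first exact: Xincl.
  by rewrite plane_inclB plane_inclE row_mxEr mxE.
apply: (@gram_solve _ _ _ _ (768 * h)).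
- move=> i j.
  have -> : (W *m W^T) i j = edot (f (pp i) - f (pm i)) (f (pp j) - f (pm j)) / dia i / dia j.
    rewrite mxE /edot !mulr_suml; apply: eq_bigr => l _; rewrite !mxE; ring.
  have [<-|ij] := eqVneq i j.
    have d0 : dia i != 0 by rewrite lt0r_neq0 // dia_gt0.
    rewrite edotvv expr2 mulfK // divff // subrr normr0.
    exact: ch_ge0.
  rewrite subr0.
  have z1 : (pp i - c) ord0 (rshift n j) = 0.
    rewrite [c + _]addrC addrK 2!mxE eqxx eq_sym eq_rshift.
    by rewrite (negbTE ij) mulr0.
  have z2 : (pm i - c) ord0 (rshift n j) = 0.
    rewrite [pm i - c]addrC addKr 3!mxE eqxx eq_sym eq_rshift.
    by rewrite (negbTE ij) mulr0 oppr0.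
  have ha := bisector (Xpp i) z1; have hb := bisector (Xpm i) z2.
  rewrite mulrAC edotBl mulrBl; move: ha hb.
  set a := edot _ _ / dia j; set b := edot _ _ / dia j => ha hb.
  set z := mid j / dia j in ha hb.
  rewrite normrM normfV (gtr0_norm (dia_gt0 i)) ler_pdivrMr ?dia_gt0 //.
  have : `|a - b| <= 192 * h * L.
    have -> : a - b = (a - z) - (b - z) by ring.
    by apply: le_trans (ler_normB _ _) _; lra.
  move=> h3; apply: le_trans h3 _.
  have -> : 768 * h * dia i = 192 * h * (4 * dia i) by ring.
  by rewrite ler_wpM2l ?dia_ge ?ch_ge0.
- exact: ch_ge0.
- by move: hm; lra.
Qed.

End ImageNearPlane.

(** * Logarithmic integrals and dyadic sums *)

Section Integrals.
Variable R : realType.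
Local Notation mu := (@lebesgue_measure R).

(** The nonnegative integral is a supremum over simple functions below the
integrand, so its monotonicity needs no measurability. *)
Lemma ge0_integral_mono (D : set R) (f g : R -> \bar R) :
  (forall s, D s -> (0 <= f s)%E) -> (forall s, D s -> (f s <= g s)%E) ->
  (\int[mu]_(s in D) f s <= \int[mu]_(s in D) g s)%E.
Proof.
move=> f0 fg; have g0 s : D s -> (0 <= g s)%E.
  by move=> Ds; apply: le_trans (fg s Ds); exact: f0.
rewrite !ge0_integralE //; apply: ge_ereal_sup => _ [h hf <-].
apply: ereal_sup_ubound; exists h => // s; apply: le_trans (hf s) _.
by rewrite /patch; case: ifPn => // /set_mem; exact: fg.
Qed.

Definition step_fun (c : R) (A : set R) (s : R) : \bar R := (c%:E * (\1_A s)%:E)%E.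

Lemma step_ge0 c A s : 0 <= c -> (0 <= step_fun c A s)%E.
Proof. by move=> c0; rewrite /step_fun mule_ge0 // lee_fin // indicE. Qed.

Lemma step_in (c : R) (A : set R) s : A s -> step_fun c A s = c%:E.
Proof. by move=> As; rewrite /step_fun indicE mem_set // mule1. Qed.

Lemma step_out (c : R) (A : set R) s : ~ A s -> step_fun c A s = 0%E.
Proof. by move=> As; rewrite /step_fun indicE memNset // mule0. Qed.

Lemma measurable_step c (A D : set R) : measurable A ->
  measurable_fun D (step_fun c A : R -> \bar R).
Proof.
move=> mA; apply: emeasurable_funM; first exact: measurable_cst.
by apply/measurable_EFinP; exact: measurable_indic.
Qed.

Lemma integral_step c (A D : set R) : measurable A -> measurable D -> 0 <= c ->
  (\int[mu]_(s in D) step_fun c A s = c%:E * mu (A `&` D))%E.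
Proof.
move=> mA mD c0.
have m1 : measurable_fun D (fun s => (\1_A s)%:E : \bar R).
  by apply/measurable_EFinP; exact: measurable_indic.
have p1 s : D s -> (0 <= (\1_A s : R)%:E)%E by move=> _; rewrite lee_fin indicE.
by rewrite /step_fun ge0_integralZl_EFin // integral_indic.
Qed.

Lemma integral_step_le c (a b : R) (D : set R) : measurable D -> 0 <= c -> a <= b ->
  (\int[mu]_(s in D) step_fun c `[a, b]%classic s <= (c * (b - a))%:E)%E.
Proof.
move=> mD c0 ab; rewrite integral_step // EFinM; apply: lee_wpmul2l; first by rewrite lee_fin.
apply: le_trans (_ : mu `[a, b]%classic <= _)%E.
  apply: le_measure; rewrite ?inE; [exact: measurableI|exact: measurable_itv|exact: subIsetl].
rewrite lebesgue_measure_itv /= lte_fin; case: ifP => // _.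
by rewrite lee_fin subr_ge0.
Qed.

(** A covering of the half-line by intervals of bounded logarithmic length turns
the logarithmic integral of a square into a sum over the intervals. *)
Lemma log_integral_le (b : R -> \bar R) (a1 a2 d1 d2 : nat -> R) (S : R) :
  (forall s, 0 < s -> (0 <= b s)%E) ->
  (forall k, 0 < a1 k) -> (forall k, 0 < a2 k) ->
  (forall k, 0 <= d1 k) -> (forall k, 0 <= d2 k) ->
  (forall k s, a1 k <= s -> s <= 3 * a1 k -> (b s <= (d1 k)%:E)%E) ->
  (forall k s, a2 k <= s -> s <= 3 * a2 k -> (b s <= (d2 k)%:E)%E) ->
  (forall s, 0 < s -> (exists k, a1 k <= s <= 3 * a1 k) \/
                      (exists k, a2 k <= s <= 3 * a2 k)) ->
  (forall m, \sum_(k < m) (d1 k ^+ 2 + d2 k ^+ 2) <= S) ->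
  (\int[mu]_(s in `]0%R, +oo[) (b s ^+ 2 * (s^-1)%:E) <= (2 * S)%:E)%E.
Proof.
move=> b0 a10 a20 d10 d20 h1 h2 cover hS.
pose I1 k := `[a1 k, 3 * a1 k]%classic : set R.
pose I2 k := `[a2 k, 3 * a2 k]%classic : set R.
pose c1 k := d1 k ^+ 2 / a1 k; pose c2 k := d2 k ^+ 2 / a2 k.
pose g k s := (step_fun (c1 k) (I1 k) s + step_fun (c2 k) (I2 k) s)%E.
have c10 k : 0 <= c1 k by rewrite divr_ge0 ?sqr_ge0 // ltW.
have c20 k : 0 <= c2 k by rewrite divr_ge0 ?sqr_ge0 // ltW.
have g0 k s : (0 <= g k s)%E by rewrite adde_ge0 // step_ge0.
have mg k (D : set R) : measurable_fun D (g k : R -> \bar R).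
  by apply: emeasurable_funD; apply: measurable_step; exact: measurable_itv.
have mD : measurable (`]0%R, +oo[%classic : set R) by exact: measurable_itv.
have pt (s a d : R) : 0 < s -> 0 < a -> a <= s -> (0 <= b s)%E -> (b s <= d%:E)%E ->
    (b s ^+ 2 * (s^-1)%:E <= (d ^+ 2 / a)%:E)%E.
  move=> s0 a0 as_ bs0 bsd; rewrite EFinM; apply: lee_pmul.
  - by rewrite expe_ge0.
  - by rewrite lee_fin invr_ge0 ltW.
  - by move: bs0 bsd; case: (b s) => // w; rewrite !lee_fin => w0 wd; rewrite -expr2 lerXn2r ?nnegrE // (le_trans w0).
  - by rewrite lee_fin lef_pV2.
apply: (@le_trans _ _ (\int[mu]_(s in `]0%R, +oo[) \sum_(0 <= k <oo) g k s)%E).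
  apply: ge0_integral_mono => s; rewrite /= in_itv /= andbT => s0.
    apply: mule_ge0; first by apply: mule_ge0; exact: b0.
    by rewrite lee_fin invr_ge0 ltW.
  suff [k hk] : exists k, (b s ^+ 2 * (s^-1)%:E <= g k s)%E.
    apply: le_trans hk _; apply: le_trans (nneseries_lim_ge k.+1 _); last by move=> *; exact: g0.
    by rewrite big_nat_recr //= leeDr // sume_ge0.
  case: (cover s s0) => -[k /andP[k1 k2]]; exists k.
    have hp := pt s _ _ s0 (a10 k) k1 (b0 s s0) (h1 k s k1 k2).
    apply: le_trans hp _.
    have I1s : I1 k s by rewrite /I1 /= in_itv /= k1 k2.
    by rewrite /g step_in // leeDl // step_ge0.
  have hp := pt s _ _ s0 (a20 k) k1 (b0 s s0) (h2 k s k1 k2).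
  apply: le_trans hp _.
  have I2s : I2 k s by rewrite /I2 /= in_itv /= k1 k2.
  by rewrite /g [X in (_ <= X)%E]addeC step_in // leeDl // step_ge0.
rewrite integral_nneseries //; last by move=> k; exact: mg.
have gI k : (\int[mu]_(s in `]0%R, +oo[) g k s <= (2 * (d1 k ^+ 2 + d2 k ^+ 2))%:E)%E.
  rewrite ge0_integralD //; first last.
  - by apply: measurable_step; exact: measurable_itv.
  - by move=> s _; exact: step_ge0.
  - by apply: measurable_step; exact: measurable_itv.
  - by move=> s _; exact: step_ge0.
  rewrite mulrDr EFinD; apply: leeD.
    apply: le_trans (integral_step_le mD (c10 k) _) _; first by have := a10 k; lra.
    by rewrite lee_fin /c1 le_eqVlt; apply/orP; left; apply/eqP; field; rewrite lt0r_neq0.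
  apply: le_trans (integral_step_le mD (c20 k) _) _; first by have := a20 k; lra.
  by rewrite lee_fin /c2 le_eqVlt; apply/orP; left; apply/eqP; field; rewrite lt0r_neq0.
apply: lime_le; first by apply: is_cvg_nneseries => k _ _; apply: integral_ge0.
apply: nearW => m; rewrite big_mkord.
apply: (@le_trans _ _ (\sum_(k < m) (2 * (d1 k ^+ 2 + d2 k ^+ 2))%:E)%E).
  by apply: lee_sum.
by rewrite sumEFin lee_fin -mulr_sumr ler_pM2l.
Qed.

(** On the dyadic interval above [t k] the integrand dominates a constant, and these
intervals are disjoint. *)
Lemma dyadic_sum_le_log_integral (b : R -> \bar R) (t d : nat -> R) (r S : R) m :
  (forall s, 0 < s -> s < r -> (0 <= b s)%E) ->
  (forall k, 0 < t k) -> (forall k, t k = 2 * t k.+1) -> 2 * t 0 < r ->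
  (forall k, 0 <= d k) ->
  (forall k s, (k < m)%N -> t k < s -> s <= 2 * t k -> ((d k)%:E <= b s)%E) ->
  (\int[mu]_(s in `]0%R, r[) (b s ^+ 2 * (s^-1)%:E) <= S%:E)%E ->
  \sum_(k < m) d k ^+ 2 <= 2 * S.
Proof.
move=> b0 t0 tS tr d0 hb hS.
have tle j k : (j <= k)%N -> t k <= t j.
  move=> /subnK <-; elim: (k - j)%N => [|i IH]; first by rewrite add0n.
  by have := tS (i + j)%N; have := t0 (i + j).+1; rewrite addSn; lra.
have tlt j k : (j < k)%N -> 2 * t k <= t j.
  by move=> jk; rewrite (tS j) ler_pM2l // tle.
pose I k := `]t k, 2 * t k]%classic : set R.
pose g (k : nat) s := step_fun (d k ^+ 2 / (2 * t k)) (I k) s.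
have c0 k : 0 <= d k ^+ 2 / (2 * t k) by rewrite divr_ge0 ?sqr_ge0 // mulr_ge0 // ltW.
have mD : measurable (`]0%R, r[%classic : set R) by exact: measurable_itv.
have mI k : measurable (I k) by exact: measurable_itv.
have Idis j k s : I j s -> I k s -> j = k.
  rewrite /I /= !in_itv /= => /andP[j1 j2] /andP[k1 k2].
  case: (ltngtP j k) => // /tlt jk; exfalso.
    by have := lt_le_trans j1 (le_trans k2 jk); rewrite ltxx.
  by have := lt_le_trans k1 (le_trans j2 jk); rewrite ltxx.
have : (\int[mu]_(s in `]0%R, r[) (\sum_(k < m) g k s) <= S%:E)%E.
  apply: le_trans hS; apply: ge0_integral_mono => s; rewrite /= in_itv /= => /andP[s0 sr].
    by apply: sume_ge0 => k _; exact: step_ge0.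
  have [[j js]|no] := pselect (exists j : 'I_m, I j s).
    rewrite (bigD1 j) //= big1 ?adde0; last first.
      move=> k kj; apply: step_out => ks; move/eqP: kj; apply; apply: val_inj; exact: Idis ks js.
    rewrite /g step_in // EFinM; move: js; rewrite /I /= in_itv /= => /andP[j1 j2].
    apply: lee_pmul.
    - by rewrite lee_fin sqr_ge0.
    - by rewrite lee_fin invr_ge0 mulr_ge0 // ltW.
    - have := hb j s (ltn_ord j) j1 j2; case: (b s) (b0 s s0 sr) => [w||] //.
      + by rewrite !lee_fin => w0 dw; rewrite -expr2 lerXn2r ?nnegrE.
      + by move=> _ _; rewrite mulyy leey.
    - by rewrite lee_fin lef_pV2 ?posrE ?mulr_gt0.
  rewrite big1; last first.
    by move=> k _; apply: step_out => ks; apply: no; exists k.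
  apply: mule_ge0; first by apply: mule_ge0; exact: b0.
  by rewrite lee_fin invr_ge0 ltW.
rewrite ge0_integral_sum //; first last.
- by move=> k s _; exact: step_ge0.
- by move=> k; exact: measurable_step.
have -> : (\sum_(k < m) \int[mu]_(s in `]0%R, r[) g k s =
    (\sum_(k < m) d k ^+ 2 / 2)%:E)%E.
  rewrite -sumEFin; apply: eq_bigr => k _; rewrite integral_step //.
  have -> : I k `&` `]0%R, r[ = I k.
    apply/setIidPl => s; rewrite /I /= !in_itv /= => /andP[k1 k2].
    have := tle 0%N k (leq0n _); have := t0 k; move: k1 k2 tr => *.
    by apply/andP; split; lra.
  rewrite lebesgue_measure_itv /= lte_fin ifT; last by have := t0 k; lra.
  by rewrite -EFinB -EFinM; congr EFin; field; rewrite lt0r_neq0.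
by rewrite lee_fin -mulr_suml; lra.
Qed.

End Integrals.

(** * The map F *)

Section Construction.
Variables (R : realType) (n m : nat).
Local Notation N := (n + m)%N.
Variables (x : 'rV[R]_n) (r e : R) (f : 'rV[R]_N -> 'rV[R]_N) (E : set 'rV[R]_n).
Variable A : 'rV[R]_n -> R -> affine_map R n N.
Implicit Types (y z w v p : 'rV[R]_n) (s t : R) (B : affine_map R n N).
Local Notation fh := (fun z : 'rV[R]_n => f (plane_incl N z)).

(** The coarsest mesh is r / dim_scale; all the lengths below are multiples of
dim_scale times a scale. *)
Definition dim_scale : R := 64 * n%:R.

Definition smooth_const : R := 32 * dim_scale * extension_const R n.
(** The factor 20 absorbs the passage from the Taylor polynomial of the deviation to an
almost conformal affine map. *)
Definition flatness : R := 20 * smooth_const * e.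

Hypotheses (n_gt0 : (0 < n)%N) (r_gt0 : 0 < r) (E_ball : E `<=` eball x r).
Hypothesis E_closed : closed E.
Hypotheses (e_gt0 : 0 < e) (flatness_small : flatness <= 1 / 16).
Hypothesis A_approx : forall y s z, enorm (y - x) <= 9 * r -> 0 < s ->
  enorm (z - x) <= 9 * r -> enorm (z - y) <= s ->
  enorm (fh z - A y s z) <= e * op_norm (linear_part (A y s)) * s.
Hypothesis f_inj : forall z w, enorm (z - x) <= 3 * r -> enorm (w - x) <= 3 * r ->
  fh z = fh w -> z = w.
Hypothesis f_qs : weak_qs (1 + e) (eball (plane_incl N x) (3 * r)) f.

Lemma n_ge1R : 1 <= n%:R :> R. Proof. by rewrite ler1n. Qed.

Lemma extension_const_ge1 : 1 <= extension_const R n.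
Proof. by rewrite /extension_const exprn_ege1 //; have := spline_const_ge1 R n; lra. Qed.

Lemma dim_scale_ge : 64 <= dim_scale.
Proof. by rewrite /dim_scale; have := n_ge1R; lra. Qed.

Lemma smooth_const_ge : 32 * dim_scale <= smooth_const.
Proof.
by rewrite /smooth_const ler_peMr ?extension_const_ge1 //; have := dim_scale_ge; lra.
Qed.

Lemma flatness_ge (c : R) : c <= 640 * dim_scale -> c * e <= flatness.
Proof.
move=> cn; rewrite /flatness ler_wpM2r ?(ltW e_gt0) //.
by have := smooth_const_ge; lra.
Qed.

Lemma flatness_gt0 : 0 < flatness.
Proof.
by apply: lt_le_trans (flatness_ge (_ : 1 <= _)); rewrite ?mul1r //; have := dim_scale_ge; lra.
Qed.

Lemma e_small : 1000 * e <= 1.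
Proof.
have : 1000 * e <= flatness by apply: flatness_ge; have := dim_scale_ge; lra.
by move: flatness_small; lra.
Qed.

Lemma fh_qs z w y : enorm (z - x) <= 3 * r -> enorm (w - x) <= 3 * r ->
  enorm (y - x) <= 3 * r -> enorm (z - y) <= enorm (w - y) ->
  enorm (fh z - fh y) <= (1 + e) * enorm (fh w - fh y).
Proof.
move=> zx wx yx zw; apply: f_qs;
 by rewrite /eball /= plane_inclB enorm_plane_incl // plane_inclB enorm_plane_incl.
Qed.

(** Weak quasisymmetry with constant close to 1 makes the image of a sphere
nearly round, so an affine map close to it has an almost conformal linear part. *)
Lemma near_conformal y t B (k : R) : enorm (y - x) <= 2 * r -> 0 < t -> t <= r ->
  0 <= k -> k <= 4 * e ->
  (forall z, enorm (z - y) <= t -> enorm (fh z - B z) <= k * op_norm (linear_part B) * t) ->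
  0 < op_norm (linear_part B) /\
  forall v, (1 - 25 * e) * op_norm (linear_part B) * enorm v <= enorm (v *m linear_part B).
Proof.
move=> yx t0 tr k0 ke H; set b := op_norm _.
have b0 : 0 <= b by exact: op_norm_ge0.
have e0 := e_gt0; have es := e_small.
have inx w : enorm w <= 1 -> enorm (y + t *: w - y) <= t /\ enorm (y + t *: w - x) <= 3 * r.
  move=> w1; have h : enorm (y + t *: w - y) <= t.
    by rewrite [y + _]addrC addrK enormZ gtr0_norm // ler_piMr // ltW.
  by split=> //; apply: le_trans (enorm_distD y _ _) _; lra.
have yy : enorm (y - y) <= t by rewrite subrr enorm0 ltW.
have yx3 : enorm (y - x) <= 3 * r by lra.
have lin w : enorm w <= 1 ->
    enorm (fh (y + t *: w) - fh y - t *: (w *m linear_part B)) <= 2 * k * b * t.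
  move=> w1; have [h1 h2] := inx w w1.
  have -> : t *: (w *m linear_part B) = B (y + t *: w) - B y.
    by rewrite affineB [y + _]addrC addrK scalemxAl.
  have -> : fh (y + t *: w) - fh y - (B (y + t *: w) - B y) =
     (fh (y + t *: w) - B (y + t *: w)) - (fh y - B y).
    by apply/rowP => i; rewrite !mxE; ring.
  by apply: le_trans (enormB _ _) _; have := H _ h1; have := H _ yy; rewrite -/b; lra.
have key w v : enorm w <= 1 -> enorm v = 1 ->
    enorm (w *m linear_part B) <= (1 + e) * enorm (v *m linear_part B) + 6 * k * b.
  move=> w1 v1; have v1' : enorm v <= 1 by rewrite v1.
  have := lin w w1; have := lin v v1'.
  have [h1 h2] := inx w w1; have [h3 h4] := inx v v1'.
  have wv : enorm (y + t *: w - y) <= enorm (y + t *: v - y).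
    by rewrite ![y + _]addrC !addrK !enormZ v1 ler_wpM2l.
  have := fh_qs h2 h4 yx3 wv; rewrite /=.
  set P := f _ - _; set Q := f _ - _ => q1 q2 q3.
  have := enormD (P - t *: (w *m linear_part B)) (t *: (w *m linear_part B) - P + P).
  have q4 : enorm (t *: (w *m linear_part B)) <= enorm P + 2 * k * b * t.
    have := enormB P (P - t *: (w *m linear_part B)); rewrite subKr; lra.
  have q5 : enorm Q <= enorm (t *: (v *m linear_part B)) + 2 * k * b * t.
    have := enormD (Q - t *: (v *m linear_part B)) (t *: (v *m linear_part B)); rewrite subrK; lra.
  move=> _; move: q4 q5; rewrite !enormZ gtr0_norm // => q4 q5.
  set X := enorm (w *m _) in q4 *; set Y := enorm (v *m _) in q5 *.
  have kbt : 0 <= k * b * t by rewrite !mulr_ge0 // ltW.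
  have : (1 + e) * enorm Q <= (1 + e) * (t * Y + 2 * k * b * t).
    by rewrite ler_wpM2l //; lra.
  have : e * (k * b * t) <= 1 * (k * b * t) by rewrite ler_wpM2r //; lra.
  move=> q6 q7; have : t * X <= t * ((1 + e) * Y + 6 * k * b) by lra.
  by rewrite ler_pM2l.
have keyb v : enorm v = 1 -> (1 - 25 * e) * b <= enorm (v *m linear_part B).
  move=> v1; have : b <= (1 + e) * enorm (v *m linear_part B) + 6 * k * b.
    by apply: op_norm_le => w w1; exact: key.
  set Y := enorm _ => h.
  have Y0 : 0 <= Y by exact: enorm_ge0.
  have kb : k * b <= 4 * e * b by rewrite ler_wpM2r.
  have h2 : (1 - 24 * e) * b <= (1 + e) * Y by lra.
  have : (1 + e) * ((1 - 25 * e) * b) <= (1 - 24 * e) * b.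
    by rewrite mulrA ler_wpM2r //; nra.
  move=> h3; have : (1 + e) * ((1 - 25 * e) * b) <= (1 + e) * Y by exact: le_trans h2.
  by rewrite ler_pM2l //; lra.
split.
  rewrite lt0r b0 andbT; apply/negP => /eqP bz.
  have [v v1] := exists_unit R n_gt0.
  have v1' : enorm v <= 1 by rewrite v1.
  have := lin v v1'; rewrite bz mulr0 mul0r.
  have -> : v *m linear_part B = 0.
    apply: enorm_eq0; apply/eqP; rewrite eq_le enorm_ge0 andbT.
    by apply: le_trans (op_normP _ _) _; rewrite -/b bz mul0r.
  rewrite scaler0 subr0 => dim_scale; have [h1 h2] := inx v v1'.
  have : fh (y + t *: v) = fh y.
    by apply/eqP; rewrite -subr_eq0; apply/eqP/enorm_eq0/eqP; rewrite eq_le enorm_ge0 dim_scale.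
  move=> /(f_inj h2 yx3) /eqP; rewrite -subr_eq0 [y + _]addrC addrK => /eqP tv.
  by have := enormZ t v; rewrite tv enorm0 v1 mulr1 gtr0_norm //; lra.
move=> v; have [->|v0] := eqVneq v 0; first by rewrite mul0mx !enorm0 mulr0.
have vp := enorm_gt0 v0.
have := keyb ((enorm v)^-1 *: v).
rewrite -scalemxAl !enormZ gtr0_norm ?invr_gt0 // mulVf ?lt0r_neq0 // => /(_ erefl) h.
by rewrite -ler_pdivlMr // [leRHS]mulrC.
Qed.

(** The only affine map of the family that is used at large scales. *)
Definition A0 : affine_map R n N := A x (4 * r).
Local Notation a0 := (op_norm (linear_part A0)).

(** Truncating the deviation from [A0] makes it globally bounded and leaves it intact at
all the grid points near [E]. *)
Definition defect p : 'rV[R]_N := if enorm (p - x) <= 4 * r then fh p - A0 p else 0.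

Definition F z : 'rV[R]_N := A0 z + extension x r E defect z.

Lemma A0_approx z : enorm (z - x) <= 4 * r -> enorm (fh z - A0 z) <= 4 * e * a0 * r.
Proof.
move=> zx; have := @A_approx x (4 * r) z.
rewrite subrr enorm0 => H; apply: le_trans (H _ _ _ _) _; move: r_gt0; lra.
Qed.

Lemma defect_bound p : enorm (defect p) <= 4 * e * a0 * r.
Proof.
rewrite /defect; case: ifP => [|_]; first exact: A0_approx.
by rewrite enorm0 !mulr_ge0 ?op_norm_ge0 ?ltW.
Qed.

Lemma F_far z : enorm (F z - A0 z) <= 4 * e * a0 * r.
Proof.
rewrite /F [A0 z + _]addrC addrK; apply: extension_bound => //; exact: defect_bound.
Qed.

Lemma A0_conformal : 0 < a0 /\
  forall v, (1 - 25 * e) * a0 * enorm v <= enorm (v *m linear_part A0).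
Proof.
apply: (@near_conformal x r A0 (4 * e)) => //.
- by rewrite subrr enorm0 mulr_ge0 // ltW.
- by rewrite mulr_ge0 // ltW.
- by move=> z zx; apply: A0_approx; move: r_gt0 zx; lra.
Qed.

Lemma F_in z : E z -> F z = fh z.
Proof.
move=> Ez; rewrite /F extension_in // /defect ifT ?subrKC //.
by have := E_ball Ez; rewrite /eball /=; move: r_gt0; lra.
Qed.

(** An affine bound on [f] near [z] passes to [F] because the interpolants reproduce
affine maps. The matrix [U] allows bounds on some linear functionals only, which is
the form in which closeness to a plane is transferred. *)
Lemma F_convex m' (U : 'M[R]_(N, m')) B z (rho d : R) :
  0 <= rho -> close_to E z rho -> 64 * rho < r -> 0 <= d ->
  (forall p, enorm (z - p) <= 4 * rho -> enorm ((fh p - B p) *m U) <= d) ->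
  enorm ((F z - B z) *m U) <= d.
Proof.
move=> rho0 zE rr d0 H.
pose B' := AffineMap (linear_part B - linear_part A0) (translation_part B - translation_part A0).
have B'E w : B' w = B w - A0 w.
  by rewrite /affine_eval /= mulmxBr; apply/rowP => i; rewrite !mxE; ring.
have -> : F z - B z = extension x r E defect z - B' z.
  by rewrite B'E /F; apply/rowP => i; rewrite !mxE; ring.
apply: (extension_convex n_gt0 r_gt0 E_ball E_closed rho0 zE rr d0) => p zp.
rewrite /defect ifT.
  rewrite B'E; have -> : fh p - A0 p - (B p - A0 p) = fh p - B p.
    by apply/rowP => i; rewrite !mxE; ring.
  exact: H.
apply: le_trans (enorm_distD z _ _) _; have := close_to_dist E_ball zE.
by rewrite (enorm_distC p z); move: r_gt0 zp rr; lra.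
Qed.

(** From this scale on, [A0] approximates [F]; below it, every ball that is needed fits
into the domain where the hypotheses on [f] hold. *)
Definition coarse_scale : R := r / (72 * dim_scale).

Lemma coarse_scale_gt0 : 0 < coarse_scale.
Proof. by rewrite /coarse_scale; apply: divr_gt0 => //; have := dim_scale_ge; lra. Qed.

Lemma coarse_scaleE : 72 * (dim_scale * coarse_scale) = r.
Proof. by rewrite /coarse_scale; field; have := dim_scale_ge; lra. Qed.

Lemma conformal_le B (c : R) k : c <= k -> 0 <= op_norm (linear_part B) ->
  (forall v, (1 - c) * op_norm (linear_part B) * enorm v <= enorm (v *m linear_part B)) ->
  forall v, (1 - k) * op_norm (linear_part B) * enorm v <= enorm (v *m linear_part B).
Proof.
move=> ck b0 H v; apply: le_trans (H v).
by rewrite ler_wpM2r ?enorm_ge0 // ler_wpM2r //; lra.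
Qed.

Lemma F_far_cut z : enorm (F z - A0 z) <= flatness * a0 * coarse_scale.
Proof.
apply: le_trans (F_far z) _.
have -> : 4 * e * a0 * r = (288 * dim_scale) * e * (a0 * coarse_scale) by rewrite -coarse_scaleE; ring.
rewrite -[leRHS]mulrA; apply: ler_wpM2r; first by rewrite mulr_ge0 ?op_norm_ge0 // ltW // coarse_scale_gt0.
by apply: flatness_ge; have := dim_scale_ge; lra.
Qed.

Lemma far_approx y s : coarse_scale <= s -> approx flatness F y s A0.
Proof.
move=> cs; have [b0 c] := A0_conformal; split=> //.
  apply: conformal_le c; last exact: ltW.
  by apply: flatness_ge; have := dim_scale_ge; lra.
move=> z _; apply: le_trans (F_far_cut z) _.
by rewrite ler_wpM2l // mulr_ge0 ?ltW ?flatness_gt0.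
Qed.

Lemma mid_affine y s : 0 < s -> s < coarse_scale -> close_to E y (dim_scale * s) ->
  let B := A y (16 * dim_scale * s) in
  [/\ 0 < op_norm (linear_part B),
   forall v, (1 - 25 * e) * op_norm (linear_part B) * enorm v <= enorm (v *m linear_part B)
   & forall z, enorm (z - y) <= 16 * dim_scale * s ->
     enorm (fh z - B z) <= 16 * dim_scale * e * op_norm (linear_part B) * s].
Proof.
move=> s0 sc yE B; have n1 := dim_scale_ge; have r0 := r_gt0.
have ns : dim_scale * s < dim_scale * coarse_scale by rewrite ltr_pM2l //; lra.
have yx := close_to_dist E_ball yE; have cE := coarse_scaleE.
have ns0 : 0 < dim_scale * s by rewrite mulr_gt0 //; lra.
have app z : enorm (z - y) <= 16 * dim_scale * s ->
     enorm (fh z - B z) <= e * op_norm (linear_part B) * (16 * dim_scale * s).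
  move=> zy; apply: A_approx => //; [lra|lra|].
  by apply: le_trans (enorm_distD y _ _) _; lra.
have [] := @near_conformal y (16 * dim_scale * s) B e _ _ _ _ _ app; try lra.
- by move: e_gt0; lra.
- by move: e_gt0; lra.
move=> b0 c; split=> // z zy; apply: le_trans (app z zy) _.
by rewrite le_eqVlt; apply/orP; left; apply/eqP; ring.
Qed.

Lemma mid_approx y s : 0 < s -> s < coarse_scale -> close_to E y (dim_scale * s) ->
  approx flatness F y s (A y (16 * dim_scale * s)).
Proof.
move=> s0 sc yE; have [b0 c app] := mid_affine s0 sc yE.
set B := A _ _ in b0 c app *; have n1 := dim_scale_ge; have cE := coarse_scaleE.
have ns : dim_scale * s < dim_scale * coarse_scale by rewrite ltr_pM2l //; lra.
have sn : 64 * s <= dim_scale * s by rewrite ler_pM2r.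
split=> //.
  by apply: conformal_le c; [apply: flatness_ge; lra|exact: ltW].
move=> z zy; have zE : close_to E z (68 / 64 * dim_scale * s).
  by apply: close_to_shift yE _; lra.
have ke : 16 * dim_scale * e <= flatness by apply: flatness_ge; lra.
apply: le_trans (_ : 16 * dim_scale * e * op_norm (linear_part B) * s <= _); last first.
  by rewrite ler_wpM2r ?(ltW s0) // ler_wpM2r ?(ltW b0).
rewrite -[F z - B z]mulmx1; apply: F_convex zE _ _ _.
- by lra.
- by lra.
- by rewrite !mulr_ge0 ?(ltW e_gt0) ?(ltW b0) ?(ltW s0) //; lra.
move=> p zp; rewrite mulmx1; apply: app; apply: le_trans (enorm_distD z _ _) _.
by rewrite (enorm_distC p z); lra.
Qed.

Lemma dim_scale_mesh0 : dim_scale * mesh n r 0 = r.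
Proof. by rewrite /dim_scale mesh0. Qed.

Lemma mesh0_cut : mesh n r 0 = 72 * coarse_scale.
Proof.
have q0 : dim_scale != 0 by have := dim_scale_ge; lra.
by apply: (mulfI q0); rewrite dim_scale_mesh0 -[LHS]coarse_scaleE; ring.
Qed.

(** At a point off [E] the map is smooth at the scale [h] of the distance to
[E], relative to an almost conformal affine map. *)
Lemma smooth_affine y : ~ E y -> exists h B,
  [/\ 0 < h, 0 < op_norm (linear_part B),
    forall v, (1 - 25 * e) * op_norm (linear_part B) * enorm v <= enorm (v *m linear_part B)
  & taylor (fun z => F z - B z) y h (smooth_const * e * op_norm (linear_part B) * h)] /\
  (forall s, s < coarse_scale -> h < 4 * s -> close_to E y (dim_scale / 4 * h)) /\
  (forall s, s < coarse_scale -> ~ close_to E y (dim_scale * s) -> 4 * s <= h).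
Proof.
move=> nEy; have [K [KE Kmin]] := levelP n_gt0 r_gt0 E_closed nEy.
have q1 := dim_scale_ge; have h0 := mesh_gt0 n_gt0 r_gt0 K.
have r0 := r_gt0; have e0 := e_gt0; have es := e_small.
have Kx := extension_const_ge1.
exists (mesh n r K).
have sides : (forall s, s < coarse_scale -> mesh n r K < 4 * s -> close_to E y (dim_scale / 4 * mesh n r K)) /\
    (forall s, s < coarse_scale -> ~ close_to E y (dim_scale * s) -> 4 * s <= mesh n r K).
  case: K KE Kmin h0 => [|K] KE Kmin h0.
    have c0 := coarse_scale_gt0; rewrite mesh0_cut; split=> s sc; first by lra.
    by move=> _; lra.
  have := Kmin K (ltnSn K); rewrite (meshS r n_gt0 K) => nK; split=> s sc.
    by move=> _; apply: close_to_le nK; rewrite /dim_scale; lra.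
  move=> nE; rewrite leNgt; apply/negP => hs; apply: nE; apply: close_to_le nK.
  have -> : 8 * n%:R * (2 * mesh n r K.+1) = dim_scale * (mesh n r K.+1 / 4) by rewrite /dim_scale; field.
  by rewrite ler_pM2l; lra.
have [K4|K3] := leqP 4 K; last first.
  exists A0; split=> //; have [b0 c] := A0_conformal; split=> //.
  have T := extension_taylor_far x n_gt0 r_gt0 KE K3 (le_trans (enorm_ge0 _) (defect_bound 0)) defect_bound.
  apply: (@taylor_ext _ _ _ (extension x r E defect)); first exact: ltW.
    by move=> v _; rewrite /F [A0 _ + _]addrC addrK.
  apply: taylor_le T => //.
  have m3 : mesh n r 0 <= 8 * mesh n r K.
    have := mesh_le n_gt0 r_gt0 (K3 : (K <= 3)%N).
    rewrite (meshS r n_gt0 0) (meshS r n_gt0 1) (meshS r n_gt0 2); lra.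
  rewrite -[r in X in X <= _]dim_scale_mesh0 /smooth_const.
  have -> : 32 * dim_scale * extension_const R n * e * a0 * mesh n r K =
    extension_const R n * (4 * e * a0 * (dim_scale * (8 * mesh n r K))) by ring.
  rewrite ler_wpM2l //; first by lra.
  by rewrite ler_wpM2l ?mulr_ge0 ?(ltW b0) ?(ltW e0) // ler_wpM2l //; lra.
have nK : close_to E y (dim_scale / 8 * mesh n r 3).
  apply: close_to_le (Kmin K.-1 _); last by lia.
  have -> : 8 * n%:R = dim_scale / 8 by rewrite /dim_scale; field.
  by rewrite ler_wpM2l; [|lra|rewrite mesh_le //; lia].
have m3 : 8 * (dim_scale * mesh n r 3) = r.
  by rewrite -[RHS]dim_scale_mesh0 (meshS r n_gt0 0) (meshS r n_gt0 1) (meshS r n_gt0 2); ring.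
have qh : 2 * (dim_scale * mesh n r K) <= dim_scale * mesh n r 3.
  rewrite (meshS r n_gt0 3); have mK := mesh_le n_gt0 r_gt0 K4.
  by have : dim_scale * mesh n r K <= dim_scale * mesh n r 4 by [rewrite ler_wpM2l //; lra]; lra.
have yx := close_to_dist E_ball nK.
set h := mesh n r K in h0 sides qh *.
have qh0 : 0 < dim_scale * h by rewrite mulr_gt0 //; lra.
pose B := A y (dim_scale * h).
have app z : enorm (z - y) <= dim_scale * h ->
    enorm (fh z - B z) <= e * op_norm (linear_part B) * (dim_scale * h).
  move=> zy; apply: A_approx => //; [lra|].
  by apply: le_trans (enorm_distD y _ _) _; lra.
have [b0 c] : 0 < op_norm (linear_part B) /\ forall v, (1 - 25 * e) *
    op_norm (linear_part B) * enorm v <= enorm (v *m linear_part B).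
  by apply: (@near_conformal y (dim_scale * h) B e); try exact: app; lra.
exists B; split=> //; split=> //.
pose B' := AffineMap (linear_part B - linear_part A0) (translation_part B - translation_part A0).
have B'E w : B' w = B w - A0 w.
  by rewrite /affine_eval /= mulmxBr; apply/rowP => i; rewrite !mxE; ring.
have d0 : 0 <= e * op_norm (linear_part B) * (dim_scale * h).
  by apply: mulr_ge0; [apply: mulr_ge0|]; exact: ltW.
have Tn p : enorm (y - p) <= 48 * n%:R * mesh n r K ->
    enorm (defect p - B' p) <= e * op_norm (linear_part B) * (dim_scale * h).
  have -> : 48 * n%:R = dim_scale * (48 / 64) by rewrite /dim_scale; field.
  rewrite -/h enorm_distC => py; rewrite /defect ifT.
    rewrite B'E; have -> : fh p - A0 p - (B p - A0 p) = fh p - B p.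
      by apply/rowP => i; rewrite !mxE; ring.
    by apply: app; lra.
  by apply: le_trans (enorm_distD y _ _) _; lra.
have T := extension_taylor_near n_gt0 r_gt0 E_ball KE K4 Kmin d0 Tn.
apply: (@taylor_ext _ _ _ (fun z => extension x r E defect z - B' z)); first exact: ltW.
  by move=> v _; rewrite B'E /F; apply/rowP => i; rewrite !mxE; ring.
apply: taylor_le T => //; rewrite -/h.
have -> : smooth_const * e * op_norm (linear_part B) * h =
   32 * (extension_const R n * (e * op_norm (linear_part B) * (dim_scale * h))) by rewrite /smooth_const; ring.
have : 0 <= extension_const R n * (e * op_norm (linear_part B) * (dim_scale * h)).
  by apply: mulr_ge0 => //; lra.
by lra.
Qed.

Lemma smooth_approx y : ~ E y -> exists h B,
  [/\ 0 < h, forall s, 0 < s -> 4 * s <= h -> approx flatness F y s B,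
    forall z, enorm (z - y) <= h -> enorm (F z - B z) <=
      flatness * op_norm (linear_part B) * h * (enorm (z - y) / h) ^+ 2,
    forall s, s < coarse_scale -> h < 4 * s -> close_to E y (dim_scale / 4 * h)
  & forall s, s < coarse_scale -> ~ close_to E y (dim_scale * s) -> 4 * s <= h].
Proof.
move=> /smooth_affine[h [B1 [[h0 b0 c T] [s1 s2]]]].
exists h; case: T => _ [L [L1 L2]].
have e0 := e_gt0; have es := e_small; have kap0 := flatness_gt0; have ks := flatness_small.
pose d := smooth_const * e; have kd : flatness = 20 * d by rewrite /flatness /d; ring.
have d25 : 25 * e <= d by rewrite /d ler_wpM2r ?(ltW e0) //; have := smooth_const_ge; have := dim_scale_ge; lra.
rewrite -/d in L1 L2; set b1 := op_norm (linear_part B1) in b0 c L1 L2.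
pose B := AffineMap (linear_part B1 + L) (translation_part B1 + (F y - B1 y) - y *m L).
have BE z : F z - B z = (F z - B1 z) - (F y - B1 y) - (z - y) *m L.
  by rewrite /affine_eval /= mulmxDr mulmxBl; apply/rowP => i; rewrite !mxE; ring.
have Lv v : enorm (v *m L) <= d * b1 * enorm v.
  apply: le_trans (L1 v) _; rewrite le_eqVlt; apply/orP; left; apply/eqP.
  by field; exact: lt0r_neq0.
have Ln : op_norm L <= d * b1.
  by apply: op_norm_le => v v1; apply: le_trans (Lv v) _; rewrite ler_piMr // mulr_ge0 // ?(ltW b0) //; lra.
set b := op_norm (linear_part B).
have bb1 : b <= b1 + d * b1.
  by apply: le_trans (op_normD _ _) _; rewrite lerD2l.
have b1b : b1 <= b + d * b1.
  have e1 : op_norm (linear_part B1 - linear_part B) = op_norm L.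
    by rewrite op_norm_distC [X in op_norm X]addrC /= addKr.
  have := op_norm_lipschitz (linear_part B1) (linear_part B).
  by rewrite e1 -/b1 -/b; lra.
have db : d * b1 <= 1 / 320 * b1 by rewrite ler_wpM2r ?(ltW b0) //; lra.
have b12 : b1 <= 2 * b by lra.
have rem z : enorm (z - y) <= h -> enorm (F z - B z) <= 2 * d * b * h * (enorm (z - y) / h) ^+ 2.
  move=> zy; have := L2 (z - y) zy; rewrite subrKC -BE => h1.
  apply: le_trans h1 _; rewrite ler_wpM2r ?sqr_ge0 // ler_wpM2r ?(ltW h0) //.
  have : d * b1 <= d * (2 * b) by rewrite ler_wpM2l //; lra.
  by lra.
exists B; split=> //.
  move=> s s0 sh; split; first by rewrite -/b; lra.
    move=> v; rewrite -/b.
    have : enorm (v *m linear_part B1) <= enorm (v *m linear_part B) + enorm (v *m L).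
      have -> : v *m linear_part B1 = v *m linear_part B - v *m L.
        by rewrite /= mulmxDr addrK.
      exact: enormB.
    have := c v; have := Lv v; have v0 := enorm_ge0 v => h1 h2 h3.
    have : (1 - flatness) * b <= (1 - 25 * e - d) * b1.
      have : (1 - flatness) * b <= (1 - flatness) * (b1 + d * b1) by rewrite ler_wpM2l //; lra.
      have : (1 - flatness) * (d * b1) <= 1 * (d * b1).
        by rewrite ler_wpM2r ?mulr_ge0 ?(ltW b0) //; lra.
      have : 25 * e * b1 <= d * b1 by rewrite ler_wpM2r ?(ltW b0).
      have : 0 <= d * b1 by rewrite mulr_ge0 ?(ltW b0) //; lra.
      by rewrite kd; lra.
    by move=> /(ler_wpM2r v0); lra.
  move=> z zy; rewrite -/b; have zh : enorm (z - y) <= h by lra.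
  apply: le_trans (rem z zh) _.
  have t1 : enorm (z - y) / h <= 1 by rewrite ler_pdivrMr // mul1r.
  have t0 : 0 <= enorm (z - y) / h by rewrite divr_ge0 ?enorm_ge0 ?ltW.
  have hb : 0 <= b by exact: op_norm_ge0.
  apply: le_trans (_ : 2 * d * b * h * (enorm (z - y) / h) <= _).
    rewrite ler_wpM2l ?expr2 ?ler_piMl // !mulr_ge0 ?(ltW h0) //; lra.
  have -> : 2 * d * b * h * (enorm (z - y) / h) = 2 * d * b * enorm (z - y).
    by field; exact: lt0r_neq0.
  apply: le_trans (_ : 2 * d * b * (4 * s) <= _).
    by rewrite ler_wpM2l // !mulr_ge0 //; lra.
  have : 0 <= d * b * s by rewrite !mulr_ge0 ?(ltW s0) //; lra.
  by rewrite kd; lra.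
move=> z zy; apply: le_trans (rem z zy) _; rewrite -/b.
rewrite ler_wpM2r ?sqr_ge0 // ler_wpM2r ?(ltW h0) // ler_wpM2r ?op_norm_ge0 //.
by rewrite kd; lra.
Qed.

Lemma F_flat : flat flatness F.
Proof.
move=> y s s0; have [cs|sc] := leP coarse_scale s; first by exists A0; exact: far_approx.
have [yE|nyE] := pselect (close_to E y (dim_scale * s)).
  by exists (A y (16 * dim_scale * s)); exact: mid_approx.
have nEy : ~ E y.
  move=> Ey; apply: nyE; exists y => //; rewrite subrr enorm0.
  by apply: mulr_ge0; [have := dim_scale_ge; lra|exact: ltW].
by have [h [B [_ a _ _ H]]] := smooth_approx nEy; exists B; apply: a => //; exact: H.
Qed.

End Construction.

(** * Beta numbers of flat maps *)

Section Cover.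
Variable R : realType.

Lemma linear_archimedean (a s : R) : 0 < s -> exists k : nat, a < s * (1 + k%:R / 3).
Proof.
move=> s0; exists (3 * (Num.truncn (a / s)).+1)%N.
have := truncnS_gt (a / s); set j := (Num.truncn _).+1; rewrite ltr_pdivrMr // => h.
rewrite natrM; have -> : 1 + 3 * j%:R / 3 = 1 + j%:R :> R by field.
by lra.
Qed.

(** The intervals [a k, 3 * a k] overlap and shrink geometrically. *)
Lemma cover_down (a : nat -> R) s : (forall k, 0 < a k) -> (forall k, a k <= 3 * a k.+1) ->
  (forall k, a k.+1 <= 3 / 4 * a k) -> 0 < s -> s <= 3 * a 0 ->
  exists k, a k <= s <= 3 * a k.
Proof.
move=> a0 a3 a4 s0 sa.
have dec k : a k * (1 + k%:R / 3) <= a 0.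
  elim: k => [|k IH]; first by rewrite mul0r addr0 mulr1.
  apply: le_trans IH; rewrite -natr1.
  have := a4 k; have := a0 k; have := a0 k.+1; have : 0 <= k%:R :> R by [].
  by move: (k%:R) (a k) (a k.+1) => j u v; nra.
have ex : exists k, a k <= s.
  have [k ks] := linear_archimedean (a 0) s0; exists k; rewrite leNgt; apply/negP => sk.
  have : s * (1 + k%:R / 3) <= a k * (1 + k%:R / 3).
    by rewrite ler_wpM2r ?(ltW sk) // addr_ge0 // divr_ge0.
  by have := dec k; lra.
exists (ex_minn ex); case: ex_minnP => -[|k] ks kmin; rewrite ks //=.
have : s < a k by rewrite ltNge; apply/negP => /kmin; rewrite ltnn.
by have := a3 k; lra.
Qed.

Lemma cover_up (a : nat -> R) s : (forall k, 0 < a k) -> (forall k, a k.+1 <= 3 * a k) ->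
  (forall k, a k <= 3 / 4 * a k.+1) -> a 0 <= s ->
  exists k, a k <= s <= 3 * a k.
Proof.
move=> a0 a3 a4 sa.
have inc k : a 0 * (1 + k%:R / 3) <= a k.
  elim: k => [|k IH]; first by rewrite mul0r addr0 mulr1.
  rewrite -natr1; have := a4 k; have := a0 0; have : 0 <= k%:R :> R by [].
  by move: (k%:R) (a k) (a k.+1) (a 0) IH => j u v w; nra.
have ex : exists k, s <= 3 * a k.
  have [k ks] := linear_archimedean s (a0 0); exists k.
  by have := inc k; have := a0 k; lra.
exists (ex_minn ex); case: ex_minnP => -[|k] ks kmin; rewrite ks andbT //.
have : 3 * a k < s by rewrite ltNge; apply/negP => /kmin; rewrite ltnn.
by have := a3 k; lra.
Qed.

(** The induction carries the potential [g], the square of t k / h capped at 1/16, which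
drops by three quarters of each summand. *)
Lemma halving_square_sum (t : nat -> R) (h : R) M : 0 < h -> (forall k, 0 < t k) ->
  (forall k, t k = 2 * t k.+1) ->
  \sum_(k < M) (if 4 * t k <= h then t k / h else 0) ^+ 2 <= 1 / 12.
Proof.
move=> h0 t0 tS; pose g k := if 4 * t k <= h then (t k / h) ^+ 2 else 1 / 16.
suff H : \sum_(k < M) (if 4 * t k <= h then t k / h else 0) ^+ 2 + 4 / 3 * g M <= 1 / 12.
  apply: le_trans H; rewrite lerDl mulr_ge0 // /g.
  by case: ifP => _; [exact: sqr_ge0|rewrite divr_ge0].
have small k : 4 * t k <= h -> (t k / h) ^+ 2 <= 1 / 16.
  move=> th; have q1 : t k / h <= 1 / 4 by rewrite ler_pdivrMr //; lra.
  have q0 : 0 <= t k / h by rewrite divr_ge0 // ltW.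
  by nra.
elim: M => [|M IH].
  rewrite big_ord0 add0r /g; case: ifP => [/small|_]; lra.
rewrite big_ord_recr /=; apply: le_trans IH; rewrite -addrA lerD2l /g.
have tM : t M / h = 2 * (t M.+1 / h) by rewrite (tS M) mulrA.
have tm := tS M; have tp := t0 M.+1.
case: (leP (4 * t M) h) => c1; last first.
  by rewrite expr0n /= add0r; case: ifP => [/small|_]; lra.
rewrite ifT; last by lra.
by rewrite tM; move: (t M.+1 / h) => w; nra.
Qed.

End Cover.

Section FlatBeta.
Variables (R : realType) (n N : nat).
Implicit Types (y z : 'rV[R]_n) (B : affine_map R n N).

(** A point of the image at distance at most a quarter of the image scale comes from the
ball of radius [t], by [flat_far]; it remains to compare the scales. *)
Lemma flat_beta_scale (kappa : R) (F : 'rV[R]_n -> 'rV[R]_N) y t B V (d s : R) :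
  (0 < n)%N -> 0 <= kappa -> kappa <= 1 / 16 -> flat kappa F ->
  0 < t -> approx kappa F y t B -> affine_plane n V -> 0 <= d ->
  (forall z, enorm (z - y) <= t ->
     (edist_to (F z) V <= (d * (op_norm (linear_part B) * t))%:E)%E) ->
  op_norm (linear_part B) * t / 12 <= s -> s <= 3 * (op_norm (linear_part B) * t / 12) ->
  (beta_number n (range F) (F y) s <= (12 * d)%:E)%E.
Proof.
move=> n0 k0 k1 Ffl t0 a HV d0 H s1 s2.
have b0 : 0 < op_norm (linear_part B) * t by case: a => b0 _ _; rewrite mulr_gt0.
set bt := op_norm _ * t in H s1 s2 b0.
have s0 : 0 < s by lra.
apply: (@le_trans _ _ (d * bt / s)%:E).
  apply: (beta_le s0 HV) => _ [z _ <-] zs; apply: H; rewrite leNgt; apply/negP => tz.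
  by have := flat_far n0 k0 k1 Ffl t0 a (ltW tz); rewrite -/bt; lra.
rewrite lee_fin ler_pdivrMr //.
have : d * bt <= d * (12 * s) by rewrite ler_wpM2l //; lra.
by lra.
Qed.

Lemma approx_injective kappa (F : 'rV[R]_n -> 'rV[R]_N) y s B : kappa < 1 ->
  approx kappa F y s B -> forall v : 'rV[R]_n, v *m linear_part B = 0 -> v = 0.
Proof.
move=> k1 [b0 c _] v vB; have := c v; rewrite vB enorm0 => h.
apply: enorm_eq0; apply/eqP; rewrite eq_le enorm_ge0 andbT.
by rewrite -(pmulr_rle0 _ (_ : 0 < (1 - kappa) * op_norm (linear_part B))) // mulr_gt0 //; lra.
Qed.

Variables (F : 'rV[R]_n -> 'rV[R]_N) (kappa cut : R) (y : 'rV[R]_n).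
Hypotheses (n_gt0 : (0 < n)%N) (k0 : 0 <= kappa) (k1 : kappa <= 1 / 16).
Hypotheses (Fflat : flat kappa F) (cut_gt0 : 0 < cut).
Variable A0 : affine_map R n N.
Hypothesis A0_far : forall z,
  enorm (F z - A0 z) <= kappa * op_norm (linear_part A0) * cut.
Hypothesis A0_approx : forall s, cut <= s -> approx kappa F y s A0.
Variable h : R.
Hypothesis h_smooth : 0 < h -> exists B,
  (forall s, 0 < s -> 4 * s <= h -> approx kappa F y s B) /\
  (forall z, enorm (z - y) <= h ->
     enorm (F z - B z) <= kappa * op_norm (linear_part B) * h * (enorm (z - y) / h) ^+ 2).
Variables (eta : nat -> R) (D S : R).
Hypotheses (eta_ge0 : forall k, 0 <= eta k) (D_ge0 : 0 <= D).
Local Notation t k := (cut / 2 ^+ k).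
Hypothesis h_mid : forall k, h < 4 * t k.+1 -> exists V, affine_plane n V /\
  forall B, approx kappa F y (t k.+1) B -> forall z, enorm (z - y) <= t k.+1 ->
    (edist_to (F z) V <= (D * eta k * (op_norm (linear_part B) * t k.+1))%:E)%E.
Hypothesis eta_sum : forall M, \sum_(k < M) eta k ^+ 2 <= S.

Local Lemma t_gt0 k : 0 < t k. Proof. by rewrite divr_gt0 // exprn_gt0. Qed.

Local Lemma t_half k : t k = 2 * t k.+1.
Proof. by rewrite exprS; field; rewrite expf_neq0. Qed.

Local Lemma range_dist B z (d : R) : enorm (F z - B z) <= d ->
  (edist_to (F z) (range B) <= d%:E)%E.
Proof. by apply: edist_to_le; exists z. Qed.

(** The square of the beta number is summed over dyadic scales: below the scale
[h] it decays by smoothness, above [cut] it decays because the map is a bounded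
perturbation of an affine one, and in between it is controlled by [eta]. *)
Lemma flat_beta_integral :
  (\int[lebesgue_measure]_(s in `]0%R, +oo[)
     (beta_number n (range F) (F y) s ^+ 2 * (s^-1)%:E)
   <= (2 * (1440 * kappa ^+ 2 + 144 * D ^+ 2 * S))%:E)%E.
Proof.
have [Bf HB] := flat_family Fflat.
have k1' : kappa < 1 by move: k1; lra.
pose T k := cut * 2 ^+ k.
have T0 k : 0 < T k by rewrite mulr_gt0 // exprn_gt0.
have TS k : T k.+1 = 2 * T k by rewrite /T exprS; ring.
have Tge k : cut <= T k by rewrite /T ler_peMr ?(ltW cut_gt0) // exprn_ege1 // ler1n.
have t0 := t_gt0.
pose b1 k := op_norm (linear_part (Bf y (t k))) * t k / 12.
pose b2 k := op_norm (linear_part (Bf y (T k))) * T k / 12.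
have Bpos s : 0 < s -> 0 < op_norm (linear_part (Bf y s)) by move=> s0; case: (HB y s s0).
have b10 k : 0 < b1 k by rewrite /b1 divr_gt0 // mulr_gt0 // Bpos.
have b20 k : 0 < b2 k by rewrite /b2 divr_gt0 // mulr_gt0 // Bpos.
have ratio s : 0 < s ->
   op_norm (linear_part (Bf y s)) <= 3 / 2 * op_norm (linear_part (Bf y (2 * s))) /\
   op_norm (linear_part (Bf y (2 * s))) <= 3 / 2 * op_norm (linear_part (Bf y s)).
  move=> s0; have s20 : 0 < 2 * s by lra.
  have yy a b : 0 < a -> enorm (y - y) <= Num.max a b.
    by move=> p; rewrite subrr enorm0 le_max ltW.
  have q1 := approx_ratio s0 s20 k0 k1 (HB y s s0) (HB y _ s20) (yy _ _ s0) ltac:(lra) ltac:(lra).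
  have q2 := approx_ratio s20 s0 k0 k1 (HB y _ s20) (HB y s s0) (yy _ _ s20) ltac:(lra) ltac:(lra).
  have p1 := Bpos _ s0; have p2 := Bpos _ s20; move: q1 q2 p1 p2 k1.
  by move: (op_norm _) (op_norm _) => u v; split; nra.
have same s B : 0 < s -> approx kappa F y s B ->
    op_norm (linear_part B) <= 2 * op_norm (linear_part (Bf y s)).
  move=> s0 a; have := approx_ratio s0 s0 k0 k1 a (HB y s s0).
  rewrite subrr enorm0 maxxx => q1.
  have {}q1 := q1 (ltW s0) ltac:(lra) ltac:(lra).
  by have := Bpos s s0; move: q1 k1; move: (op_norm _) (op_norm _) => u v; nra.
pose eta' k := if k is k'.+1 then eta k' else 0.
pose sm k : R := if (0 < h) && (4 * t k <= h) then t k / h else 0.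
pose d1 k : R := if k is k'.+1 then
   12 * (if h < 4 * t k then D * eta k' else 2 * kappa * sm k) else 12 * (2 * kappa).
pose d2 (k : nat) : R := 12 * (2 * kappa / 2 ^+ k).
have sm0 k : 0 <= sm k.
  by rewrite /sm; case: ifP => // /andP[h0 _]; rewrite divr_ge0 ?ltW.
have d10 k : 0 <= d1 k.
  rewrite /d1; case: k => [|k]; first by rewrite !mulr_ge0.
  by case: ifP => _; rewrite !mulr_ge0.
have d20 k : 0 <= d2 k by rewrite /d2 mulr_ge0 // divr_ge0 ?mulr_ge0 // exprn_ge0.
have planeA0 : affine_plane n (range A0).
  by apply: affine_range_plane; exact: approx_injective k1' (A0_approx (lexx _)).
have beta2 k s : b2 k <= s -> s <= 3 * b2 k ->
    (beta_number n (range F) (F y) s <= (d2 k)%:E)%E.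
  apply: (flat_beta_scale n_gt0 k0 k1 Fflat (T0 k) (HB y _ (T0 k)) planeA0).
    by rewrite divr_ge0 ?mulr_ge0 // exprn_ge0.
  move=> z _; apply: range_dist; apply: le_trans (A0_far z) _.
  have -> : 2 * kappa / 2 ^+ k * (op_norm (linear_part (Bf y (T k))) * T k) =
     kappa * (2 * op_norm (linear_part (Bf y (T k)))) * cut.
    by rewrite /T; field; rewrite expf_neq0.
  rewrite ler_wpM2r ?(ltW cut_gt0) // ler_wpM2l //.
  by apply: same => //; exact: A0_approx.
have beta1 k s : b1 k <= s -> s <= 3 * b1 k ->
    (beta_number n (range F) (F y) s <= (d1 k)%:E)%E.
  case: k => [|k] /=.
    apply: (flat_beta_scale n_gt0 k0 k1 Fflat (t0 0) (HB y _ (t0 0)) planeA0).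
      by rewrite mulr_ge0.
    move=> z _; apply: range_dist; apply: le_trans (A0_far z) _.
    rewrite expr0 divr1; have sA := same _ _ cut_gt0 (A0_approx (lexx _)).
    have : kappa * op_norm (linear_part A0) * cut <=
        kappa * (2 * op_norm (linear_part (Bf y cut))) * cut.
      by rewrite ler_wpM2r ?(ltW cut_gt0) // ler_wpM2l.
    by lra.
  have [hk|hk] := ltP h (4 * t k.+1).
    have [V [HV HVd]] := h_mid hk.
    apply: (flat_beta_scale n_gt0 k0 k1 Fflat (t0 k.+1) (HB y _ (t0 k.+1)) HV).
      by rewrite mulr_ge0.
    by move=> z zt; apply: HVd => //; exact: HB.
  have h0 : 0 < h by have := t0 k.+1; lra.
  have [B [Ba Brem]] := h_smooth h0.
  have a := Ba _ (t0 k.+1) hk.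
  have HV : affine_plane n (range B) by apply: affine_range_plane; exact: approx_injective k1' a.
  rewrite /sm h0 hk /=.
  apply: (flat_beta_scale n_gt0 k0 k1 Fflat (t0 k.+1) (HB y _ (t0 k.+1)) HV).
    by apply: mulr_ge0; [rewrite mulr_ge0|exact: divr_ge0 (ltW (t0 _)) (ltW h0)].
  move=> z zt; apply: range_dist; have tp := t0 k.+1; have hn := lt0r_neq0 h0.
  apply: le_trans (Brem z _) _; first by lra.
  have sB := same _ _ tp a.
  move: sB zt tp; set b := op_norm _; set b' := op_norm _; set tt := t k.+1.
  move=> sB zt tp; set w := enorm _ in zt *; have w0 : 0 <= w by exact: enorm_ge0.
  have -> : 2 * kappa * (tt / h) * (b' * tt) = kappa * (2 * b') * h * (tt / h) ^+ 2 by field.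
  apply: ler_pM; rewrite ?sqr_ge0 //.
  - by rewrite !mulr_ge0 ?op_norm_ge0 // ltW.
  - by rewrite ler_wpM2r ?(ltW h0) // ler_wpM2l.
  - have wh : w / h <= tt / h by rewrite ler_wpM2r ?invr_ge0 ?(ltW h0).
    have w0h : 0 <= w / h by rewrite divr_ge0 // ltW.
    by rewrite lerXn2r ?nnegrE // (le_trans w0h).
apply: (log_integral_le _ b10 b20 d10 d20 beta1 beta2).
- by move=> s s0; apply: beta_ge0; [exists y|exact: ltW].
- move=> s s0; have [sb|sb] := leP s (b1 0).
    left; apply: cover_down => //; last by have := b10 0; lra.
      move=> k; have [r1 r2] := ratio _ (t0 k.+1); rewrite -t_half in r1 r2.
      rewrite /b1; have tp := t0 k.+1; rewrite {2}t_half.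
      by move: r2 tp; move: (op_norm _) (op_norm _) => u v; nra.
    move=> k; have [r1 r2] := ratio _ (t0 k.+1); rewrite -t_half in r1 r2.
    rewrite /b1; have tp := t0 k.+1; rewrite [X in _ <= _ * (_ * X / _)]t_half.
    by move: r1 tp; move: (op_norm _) (op_norm _) => u v; nra.
  right; apply: cover_up => //.
  + move=> k; have [r1 r2] := ratio _ (T0 k); rewrite -TS in r1 r2.
    rewrite /b2; have tp := T0 k; rewrite [X in _ * X / _ <= _]TS.
    by move: r2 tp; move: (op_norm _) (op_norm _) => u v; nra.
  + move=> k; have [r1 r2] := ratio _ (T0 k); rewrite -TS in r1 r2.
    rewrite /b2; have tp := T0 k; rewrite [X in _ <= _ * (_ * X / _)]TS.
    by move: r1 tp; move: (op_norm _) (op_norm _) => u v; nra.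
  + by move: sb; rewrite /b1 /b2 /T expr0 divr1 mulr1 => /ltW.
move=> M; rewrite big_split /=.
have kk : 0 <= kappa ^+ 2 by rewrite sqr_ge0.
have DS : 0 <= D ^+ 2 * S.
  by apply: mulr_ge0; [exact: sqr_ge0|have := eta_sum 0; rewrite big_ord0].
have S2 : \sum_(k < M) d2 k ^+ 2 <= 768 * kappa ^+ 2.
  have H : \sum_(k < M) d2 k ^+ 2 + 768 * kappa ^+ 2 / 4 ^+ M <= 768 * kappa ^+ 2.
    elim: M => [|M IH]; first by rewrite big_ord0 add0r expr0 divr1.
    rewrite big_ord_recr /=; apply: le_trans IH; rewrite -addrA lerD2l.
    have e4 : 4 ^+ M = (2 ^+ M) ^+ 2 :> R.
      by rewrite -exprM mulnC exprM; congr (_ ^+ M); ring.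
    have P0 : 2 ^+ M != 0 :> R by rewrite expf_neq0.
    rewrite [4 ^+ M.+1]exprS e4 /d2 le_eqVlt; apply/orP; left; apply/eqP.
    by move: (2 ^+ M) P0 => P P0; field.
  apply: le_trans H; rewrite lerDl; apply: divr_ge0; last exact: exprn_ge0.
  by lra.
suff S1 : \sum_(k < M) d1 k ^+ 2 <= 624 * kappa ^+ 2 + 144 * D ^+ 2 * S by lra.
case: M {S2} => [|M]; first by rewrite big_ord0; lra.
rewrite big_ord_recl /=.
have sq k : d1 k.+1 ^+ 2 <= 144 * D ^+ 2 * eta k ^+ 2 + 576 * kappa ^+ 2 * sm k.+1 ^+ 2.
  have p1 : 0 <= D ^+ 2 * eta k ^+ 2 by rewrite mulr_ge0 ?sqr_ge0.
  have p2 : 0 <= kappa ^+ 2 * sm k.+1 ^+ 2 by rewrite mulr_ge0 ?sqr_ge0.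
  rewrite /d1; case: ifP => _.
    have -> : (12 * (D * eta k)) ^+ 2 = 144 * D ^+ 2 * eta k ^+ 2 by ring.
    by lra.
  have -> : (12 * (2 * kappa * sm k.+1)) ^+ 2 = 576 * kappa ^+ 2 * sm k.+1 ^+ 2 by ring.
  by lra.
have sms : \sum_(k < M) sm k.+1 ^+ 2 <= 1 / 12.
  rewrite /sm; have [h0|h0] := ltP 0 h; last first.
    by rewrite big1 // => i _; rewrite /= expr0n.
  exact: (halving_square_sum M h0 (fun k => t_gt0 k.+1) (fun k => t_half k.+1)).
have : \sum_(k < M) d1 k.+1 ^+ 2 <= 144 * D ^+ 2 * S + 576 * kappa ^+ 2 * (1 / 12).
  apply: le_trans (ler_sum _ (fun (k : 'I_M) _ => sq k)) _.
  rewrite big_split /= -!mulr_sumr.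
  have : D ^+ 2 * \sum_(k < M) eta k ^+ 2 <= D ^+ 2 * S by rewrite ler_wpM2l ?sqr_ge0.
  have : kappa ^+ 2 * \sum_(k < M) sm k.+1 ^+ 2 <= kappa ^+ 2 * (1 / 12) by rewrite ler_wpM2l.
  by lra.
rewrite /bump /=; lra.
Qed.

End FlatBeta.

(** * The beta numbers of F and the theorem *)

Section BetaIntegral.
Variables (R : realType) (n m : nat).
Local Notation N := (n + m)%N.
Variables (x : 'rV[R]_n) (r e : R) (f : 'rV[R]_N -> 'rV[R]_N) (E : set 'rV[R]_n).
Variable A : 'rV[R]_n -> R -> affine_map R n N.
Implicit Types (y z w v p : 'rV[R]_n) (s t : R) (B : affine_map R n N).
Local Notation fh := (fun z : 'rV[R]_n => f (plane_incl N z)).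
Local Notation dim_scale := (dim_scale R n).
Local Notation flatness := (flatness n e).
Local Notation coarse_scale := (coarse_scale n r).

Hypotheses (n_gt0 : (0 < n)%N) (r_gt0 : 0 < r) (E_ball : E `<=` eball x r).
Hypothesis E_closed : closed E.
Hypotheses (e_gt0 : 0 < e) (flatness_small : flatness <= 1 / 16).
Hypothesis A_approx : forall y s z, enorm (y - x) <= 9 * r -> 0 < s ->
  enorm (z - x) <= 9 * r -> enorm (z - y) <= s ->
  enorm (fh z - A y s z) <= e * op_norm (linear_part (A y s)) * s.
Hypothesis f_inj : forall z w, enorm (z - x) <= 3 * r -> enorm (w - x) <= 3 * r ->
  fh z = fh w -> z = w.
Hypothesis f_qs : weak_qs (1 + e) (eball (plane_incl N x) (3 * r)) f.

Local Notation F := (F x r f E A).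
Local Notation A0 := (A0 x r A).
Local Notation a0 := (op_norm (linear_part A0)).

Let Fflat : flat flatness F :=
  F_flat n_gt0 r_gt0 E_ball E_closed e_gt0 flatness_small A_approx f_inj f_qs.
Let conf0 := A0_conformal n_gt0 r_gt0 e_gt0 flatness_small A_approx f_inj f_qs.

Definition mid_const : R := 60 * (64 * dim_scale * m%:R).

(** At scales where the points of the ball are close to [E], the image lies near
the plane cut out by the bisectors; convexity carries this from [f] to [F]. *)
Lemma mid_beta y y' s (eta : R) : E y' -> 0 < s -> s < coarse_scale -> enorm (y - y') <= dim_scale * s ->
  0 <= eta -> eta <= e -> weak_qs (1 + eta) (eball (plane_incl N y') (8 * dim_scale * s)) f ->
  exists V, affine_plane n V /\
  forall B, approx flatness F y s B -> forall z, enorm (z - y) <= s ->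
    (edist_to (F z) V <= (mid_const * eta * (op_norm (linear_part B) * s))%:E)%E.
Proof.
move=> Ey' s0 sc yy' eta0 etae qs.
have es : 1000 * e <= 1 by exact: e_small n_gt0 e_gt0 flatness_small.
have e0 := e_gt0; have r0 := r_gt0; have ks := flatness_small.
have q1 : 64 <= dim_scale by exact: dim_scale_ge n_gt0.
have kp : 0 < flatness by exact: flatness_gt0 n_gt0 e_gt0.
have yE : close_to E y (dim_scale * s) by exists y'.
have [b0 c app] := mid_affine n_gt0 r_gt0 E_ball e_gt0 flatness_small A_approx f_inj f_qs s0 sc yE.
have ma := mid_approx n_gt0 r_gt0 E_ball E_closed e_gt0 flatness_small A_approx f_inj f_qs s0 sc yE.
have cE := coarse_scaleE r n_gt0.
have qs0 : 0 < dim_scale * s by apply: mulr_gt0 => //; lra.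
have qsc : dim_scale * s < dim_scale * coarse_scale by rewrite ltr_pM2l //; lra.
have sq : 64 * s <= dim_scale * s by rewrite ler_pM2r.
set G := A y _ in b0 c app ma.
have GB B : approx flatness F y s B -> op_norm (linear_part G) <= 2 * op_norm (linear_part B).
  move=> a; have := approx_ratio s0 s0 (ltW kp) ks ma a.
  rewrite subrr enorm0 maxxx => H; have {}H := H (ltW s0) ltac:(lra) ltac:(lra).
  have bB : 0 < op_norm (linear_part B) by case: a.
  have : flatness * op_norm (linear_part B) <= 1 / 16 * op_norm (linear_part B).
    by rewrite ler_wpM2r // ltW.
  by lra.
have eq0 : 0 <= dim_scale * m%:R by rewrite mulr_ge0 //; lra.
(* For a large excess the trivial bound on the beta number is good enough. *)
have [etam|etam] := leP (1536 * eta * m%:R) 1; last first.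
  pose V0 := AffineMap (linear_part A0) (F y - y *m linear_part A0).
  exists (range V0); split.
    apply: affine_range_plane => v vA; have [a00 c0] := conf0.
    have := c0 v; rewrite vA enorm0 => h.
    apply: enorm_eq0; apply/eqP; rewrite eq_le enorm_ge0 andbT.
    by rewrite -(pmulr_rle0 _ (_ : 0 < (1 - 25 * e) * a0)) // mulr_gt0 //; lra.
  move=> B a z zy; apply: (@edist_to_le _ _ _ (V0 y)); first by exists y.
  have -> : V0 y = F y by rewrite /affine_eval /= subrKC.
  have h1 : enorm (z - y) <= 4 * s by lra.
  have h2 : enorm (y - y) <= 4 * s by rewrite subrr enorm0; lra.
  have := approx_upper a h1 h2.
  have bB : 0 < op_norm (linear_part B) by case: a.
  have bs : 0 < op_norm (linear_part B) * s by rewrite mulr_gt0.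
  have : op_norm (linear_part B) * enorm (z - y) <= op_norm (linear_part B) * s.
    by rewrite ler_pM2l.
  have : flatness * (op_norm (linear_part B) * s) <= 1 / 16 * (op_norm (linear_part B) * s).
    by rewrite ler_pM2r.
  move=> h3 h4 h5; apply: (@le_trans _ _ (2 * (op_norm (linear_part B) * s))); first by lra.
  apply: ler_wpM2r; first exact: ltW.
  have em : 0 <= eta * m%:R by rewrite mulr_ge0.
  have : 64 * (eta * m%:R) <= dim_scale * (eta * m%:R) by rewrite ler_wpM2r.
  by rewrite /mid_const; lra.
have [v0 v01] := exists_unit R n_gt0.
pose tau := 8 * dim_scale * s; pose w0 := y' + tau *: v0.
have tau0 : 0 < tau by rewrite /tau; lra.
have w0y : enorm (w0 - y') = tau.
  by rewrite /w0 [y' + _]addrC addrK enormZ v01 mulr1 gtr0_norm.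
have y'x := E_ball Ey'; rewrite /eball /= in y'x.
have w0x : enorm (w0 - x) <= 3 * r.
  by apply: le_trans (enorm_distD y' _ _) _; rewrite w0y /tau; lra.
have L0 : 0 < enorm (fh w0 - fh y').
  apply: enorm_gt0; rewrite subr_eq0; apply/eqP => /f_inj H.
  have w0y' : w0 = y' by apply: H => //; lra.
  by move: w0y; rewrite w0y' subrr enorm0 => tz; rewrite -tz ltxx in tau0.
have eta1 : eta <= 1 by lra.
have [U [k [Uk Us]]] := image_near_plane tau0 eta0 eta1 qs w0y erefl L0 etam.
set L := enorm _ in L0 Uk.
exists [set p | p *m U = k]; split.
  by apply: level_set_plane => t; have [v [vt _]] := Us t; exists v.
move=> B a z zy.
have LB : L <= 18 * dim_scale * (op_norm (linear_part B) * s).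
  have GBs : op_norm (linear_part G) * s <= 2 * op_norm (linear_part B) * s.
    by rewrite ler_pM2r // GB.
  have h1 : enorm (w0 - y) <= 16 * dim_scale * s.
    by apply: le_trans (enorm_distD y' _ _) _; rewrite w0y (enorm_distC y') /tau; lra.
  have h2 : enorm (y' - y) <= 16 * dim_scale * s by rewrite enorm_distC; lra.
  have := app _ h1; have := app _ h2.
  have := op_normP (linear_part G) (w0 - y'); rewrite w0y -affineB => g1 g2 g3.
  have : L <= op_norm (linear_part G) * tau + 32 * dim_scale * e * op_norm (linear_part G) * s.
    have -> : L = enorm ((G w0 - G y') + ((fh w0 - G w0) - (fh y' - G y'))).
      by congr enorm; apply/rowP => i; rewrite !mxE; ring.
    have := enormD (G w0 - G y') ((fh w0 - G w0) - (fh y' - G y')).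
    have := enormB (fh w0 - G w0) (fh y' - G y').
    by rewrite /=; lra.
  have gs : 0 <= dim_scale * (op_norm (linear_part G) * s).
    by rewrite mulr_ge0 ?mulr_ge0 ?(ltW b0) ?(ltW s0) //; lra.
  have : 1000 * e * (dim_scale * (op_norm (linear_part G) * s)) <= 1 * (dim_scale * (op_norm (linear_part G) * s)).
    by rewrite ler_wpM2r.
  have : dim_scale * (op_norm (linear_part G) * s) <= dim_scale * (2 * op_norm (linear_part B) * s).
    by rewrite ler_wpM2l //; lra.
  by rewrite /tau; lra.
have [p0 [p0k _]] := Us k.
pose P0 := AffineMap (0 : 'M[R]_(n, N)) p0.
have P0E v : P0 v = p0 by rewrite /affine_eval /= mulmx0 add0r.
have d0 : 0 <= m%:R * (96 * eta * L) by rewrite !mulr_ge0 // ltW.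
have zE : close_to E z (65 / 64 * dim_scale * s).
  by exists y' => //; apply: le_trans (enorm_distD y _ _) _; lra.
have Fz : enorm ((F z - p0) *m U) <= m%:R * (96 * eta * L).
  rewrite -(P0E z); apply: (F_convex A n_gt0 r_gt0 E_ball E_closed _ zE) => //.
  - by lra.
  - by lra.
  move=> p zp; rewrite P0E mulmxBl p0k; apply: Uk.
  apply: le_trans (enorm_distD z _ _) _; rewrite (enorm_distC p).
  by have := enorm_distD y z y'; rewrite -/tau /tau; lra.
have [v [vU vn]] := Us ((F z - p0) *m U).
apply: (@edist_to_le _ _ _ (F z - v)).
  by rewrite /= mulmxBl vU mulmxBl opprB addrC subrK p0k.
rewrite subKr; apply: le_trans vn _.
have em : 0 <= m%:R * eta by rewrite mulr_ge0.
have : m%:R * eta * L <= m%:R * eta * (18 * dim_scale * (op_norm (linear_part B) * s)).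
  by rewrite ler_wpM2l.
have bB : 0 < op_norm (linear_part B) by case: a.
have : 0 <= dim_scale * m%:R * eta * (op_norm (linear_part B) * s).
  by rewrite mulr_ge0 ?mulr_ge0 ?(ltW bB) ?(ltW s0).
by rewrite /mid_const; lra.
Qed.

(** For y off [E], a single point [y'] of [E] serves all middle scales: its
distance to y is comparable to the smallest of these scales. *)
Lemma beta_integral (CE : R) y y0 : E y0 ->
  (forall z, E z -> (\int[lebesgue_measure]_(s in `]0%R, r[)
     (weak_qs_excess f (eball (plane_incl N z) s) ^+ 2 * (s^-1)%:E) <= CE%:E)%E) ->
  (\int[lebesgue_measure]_(s in `]0%R, +oo[)
     (beta_number n (range F) (F y) s ^+ 2 * (s^-1)%:E)
   <= (2 * (1440 * flatness ^+ 2 + 144 * mid_const ^+ 2 * (2 * CE)))%:E)%E.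
Proof.
move=> Ey0 intE.
have kp : 0 < flatness by exact: flatness_gt0 n_gt0 e_gt0.
have q1 : 64 <= dim_scale by exact: dim_scale_ge n_gt0.
have cut0 : 0 < coarse_scale by exact: coarse_scale_gt0 n_gt0 r_gt0.
have cE := coarse_scaleE r n_gt0; have r0 := r_gt0; have e0 := e_gt0.
pose t k := coarse_scale / 2 ^+ k.
have t0 k : 0 < t k by rewrite divr_gt0 // exprn_gt0.
have tS k : t k = 2 * t k.+1 by rewrite /t exprS; field; rewrite expf_neq0.
have tc k : 2 * t k.+1 <= coarse_scale.
  elim: k => [|k IH]; first by rewrite -tS /t expr0 divr1.
  by have := tS k.+1; have := t0 k.+2; lra.
have [h [hs hm]] : exists h, (0 < h -> exists B,
    (forall s, 0 < s -> 4 * s <= h -> approx flatness F y s B) /\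
    (forall z, enorm (z - y) <= h ->
       enorm (F z - B z) <= flatness * op_norm (linear_part B) * h * (enorm (z - y) / h) ^+ 2)) /\
    exists2 y', E y' & forall s, 0 < s -> s < coarse_scale -> h < 4 * s -> enorm (y - y') <= dim_scale * s.
  have [Ey|nEy] := pselect (E y).
    exists 0; split; first by rewrite ltxx.
    by exists y => // s s0 _ _; rewrite subrr enorm0 mulr_ge0 // ?(ltW s0) //; lra.
  have [h [B [h0 a rem h1 _]]] :=
    smooth_approx n_gt0 r_gt0 E_ball E_closed e_gt0 flatness_small A_approx f_inj f_qs nEy.
  exists h; split; first by move=> _; exists B.
  have [[s [sc hs]]|no] := pselect (exists s, s < coarse_scale /\ h < 4 * s).
    have [y' Ey' yy'] := h1 s sc hs; exists y' => // s' s0' sc' hs'.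
    apply: le_trans yy' _; rewrite -mulrA ler_wpM2l //; first by lra.
    by lra.
  by exists y0 => // s s0 sc hs; exfalso; apply: no; exists s.
have [y' Ey' yy'] := hm.
have y'x := E_ball Ey'; rewrite /eball /= in y'x.
have sub (k : nat) : eball (plane_incl N y') (8 * dim_scale * t k.+1) `<=`
    eball (plane_incl N x) (3 * r).
  move=> p; rewrite /eball /= => py'; apply: le_trans (enorm_distD (plane_incl N y') _ _) _.
  rewrite plane_inclB enorm_plane_incl.
  have : dim_scale * (2 * t k.+1) <= dim_scale * coarse_scale by rewrite ler_wpM2l //; lra.
  by lra.
have ex k : exists eta, [/\ 0 <= eta, eta <= e,
    weak_qs_excess f (eball (plane_incl N y') (8 * dim_scale * t k.+1)) = eta%:E
  & weak_qs (1 + eta) (eball (plane_incl N y') (8 * dim_scale * t k.+1)) f].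
  apply: weak_qs_excessP; apply: le_trans (weak_qs_excess_sub _ (sub k)) _.
  rewrite /weak_qs_excess leeBlDr //; apply: ereal_inf_lbound; exists (1 + e).
    by split; [lra|exact: f_qs].
  by rewrite addrC EFinD.
have [eta Heta] := choice ex.
have ks := flatness_small.
apply: (@flat_beta_integral R n N F flatness coarse_scale y n_gt0 (ltW kp) ks Fflat cut0 A0 _ _ h _ eta).
- by move=> z; exact: F_far_cut.
- by move=> s cs; exact: far_approx.
- exact: hs.
- by move=> k; case: (Heta k).
- by rewrite /mid_const !mulr_ge0 //; lra.
- move=> k hk; have tp := t0 k.+1; have sc : t k.+1 < coarse_scale by have := tc k; lra.
  case: (Heta k) => h0 h1 _ h2.
  exact: mid_beta Ey' tp sc (yy' _ tp sc hk) h0 h1 h2.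
- move=> M; apply: (@dyadic_sum_le_log_integral _
    (fun s => weak_qs_excess f (eball (plane_incl N y') s)) (fun k => 8 * dim_scale * t k.+1) eta r).
  + by move=> s _ _; exact: weak_qs_excess_ge0.
  + by move=> k; rewrite mulr_gt0 //; lra.
  + by move=> k; rewrite (tS k.+1); ring.
  + have : dim_scale * (2 * t 1) <= dim_scale * coarse_scale by rewrite ler_wpM2l ?tc //; lra.
    by lra.
  + by move=> k; case: (Heta k).
  + move=> k s _ ks1 ks2; case: (Heta k) => _ _ <- _; apply: weak_qs_excess_sub => p.
    by rewrite /eball /= => h1; apply: le_trans h1 _; exact: ltW.
  + exact: intE.
Qed.

(** A map that is uniformly close to [A0] on the ball has an image whose diameter
is comparable to that of the image under [A0]. *)
Lemma near_A0_diam (g : 'rV[R]_n -> 'rV[R]_N) :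
  (forall z, enorm (z - x) <= r -> enorm (g z - A0 z) <= 4 * e * a0 * r) ->
  ((a0 * r)%:E <= ediam (g @` eball x r))%E /\
  (ediam (g @` eball x r) <= (3 * (a0 * r))%:E)%E.
Proof.
move=> H; have [a00 c0] := conf0; have r0 := r_gt0; have e0 := e_gt0.
have es : 1000 * e <= 1 by exact: e_small n_gt0 e_gt0 flatness_small.
have ar0 : 0 < a0 * r by rewrite mulr_gt0.
have ear : 1000 * e * (a0 * r) <= 1 * (a0 * r) by rewrite ler_pM2r.
have lin z w : enorm (z - x) <= r -> enorm (w - x) <= r ->
    enorm (g z - g w - (z - w) *m linear_part A0) <= 8 * e * a0 * r.
  move=> zx wx; rewrite -affineB.
  have -> : g z - g w - (A0 z - A0 w) = (g z - A0 z) - (g w - A0 w).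
    by apply/rowP => i; rewrite !mxE; ring.
  by apply: le_trans (enormB _ _) _; have := H z zx; have := H w wx; lra.
split.
  have [v v1] := exists_unit R n_gt0.
  have h1 : enorm (x + r *: v - x) <= r.
    by rewrite [x + _]addrC addrK enormZ v1 mulr1 gtr0_norm.
  have h2 : enorm (x - r *: v - x) <= r.
    by rewrite [X in enorm X]addrC addKr enormN enormZ v1 mulr1 gtr0_norm.
  apply: (@ediam_ge _ _ _ (g (x + r *: v)) (g (x - r *: v))).
  - by exists (x + r *: v).
  - by exists (x - r *: v).
  have := lin _ _ h1 h2; have := c0 (x + r *: v - (x - r *: v)).
  have -> : x + r *: v - (x - r *: v) = (2 * r) *: v by apply/rowP => i; rewrite !mxE; ring.
  rewrite enormZ v1 mulr1 gtr0_norm; last by lra.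
  have := enormB (g (x + r *: v) - g (x - r *: v)) (g (x + r *: v) - g (x - r *: v) -
     ((2 * r) *: v *m linear_part A0)).
  rewrite subKr; set X := enorm _; set Y := enorm _; set Z := enorm _.
  by lra.
apply: ediam_le; first by lra.
move=> _ _ [z zx <-] [w wx <-]; rewrite /eball /= in zx wx.
have := lin z w zx wx; have := op_normP (linear_part A0) (z - w).
have := enormD (g z - g w - (z - w) *m linear_part A0) ((z - w) *m linear_part A0).
rewrite subrK; have zw : enorm (z - w) <= 2 * r.
  by apply: le_trans (enorm_distD x _ _) _; rewrite (enorm_distC x); lra.
have : a0 * enorm (z - w) <= a0 * (2 * r) by rewrite ler_pM2l.
by lra.
Qed.

End BetaIntegral.

Theorem theorem4p9 (R : realType) (n : nat) (hn : (1 <= n)%N) :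
  exists (C : nat -> R -> R) (C' : nat -> R),
    (forall N gammaE, 0 < C N gammaE) /\ (forall N, 0 < C' N) /\
  forall eps : R, 0 < eps ->
  exists eps_star : R, 0 < eps_star /\
  forall (N : nat), (n <= N - 1)%N ->
  forall (x : 'rV[R]_n) (r : R) (f : 'rV[R]_N -> 'rV[R]_N),
    0 < r ->
    almost_affine eps_star (eball x (9 * r)) (fun z => f (plane_incl N z)) ->
    topological_embedding (eball (plane_incl N x) (3 * r)) f ->
    (weak_qs_excess f (eball (plane_incl N x) (3 * r)) <= eps_star%:E)%E ->
  forall (E : set 'rV[R]_n) (gammaE CE : R),
    closed E -> E `<=` eball x r -> 0 < gammaE -> 0 < CE ->
    (gammaE%:E * ediam (eball x r) <= ediam E)%E ->
    (forall y, E y ->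
      (\int[lebesgue_measure]_(s in `]0%R, r[)
         (weak_qs_excess f (eball (plane_incl N y) s) ^+ 2 * (s^-1)%:E) <= CE%:E)%E) ->
  exists F : 'rV[R]_n -> 'rV[R]_N,
    quasisymmetric setT F /\
    (forall y, E y -> F y = f (plane_incl N y)) /\
    almost_affine eps setT F /\
    (weak_qs_excess F setT <= eps%:E)%E /\
    (((C N gammaE)^-1)%:E * ediam (f @` (plane_incl N @` eball x r))
       <= ediam (F @` eball x r))%E /\
    (ediam (F @` eball x r)
       <= (C N gammaE)%:E * ediam (f @` (plane_incl N @` eball x r)))%E /\
    (forall y : 'rV[R]_n,
      (\int[lebesgue_measure]_(s in `]0%R, +oo[)
         (beta_number n (F @` setT) (F y) s ^+ 2 * (s^-1)%:E)
       <= (C' N * (CE + eps ^+ 2))%:E)%E).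
Proof.
have Ce : 32 * dim_scale R n <= smooth_const R n by exact: smooth_const_ge.
have q1 : 64 <= dim_scale R n by exact: dim_scale_ge.
pose C' N : R := 2 * (1440 + 288 * mid_const R n (N - n) ^+ 2).
have C'0 N : 0 < C' N by have := sqr_ge0 (mid_const R n (N - n)); rewrite /C'; lra.
exists (fun _ _ => 3), C'; split=> [_ _|]; first by lra.
split=> // eps eps0.
pose d := Num.min eps 1; have d0 : 0 < d by rewrite lt_min eps0 ltr01.
have [deps d1] : d <= eps /\ d <= 1 by split; rewrite /d ge_min lexx ?orbT.
(* With this choice [flatness] is d / 50, small enough for all the conclusions. *)
pose e := d / (1000 * smooth_const R n).
have Ce0 : 0 < smooth_const R n by lra.
have e0 : 0 < e by apply: (divr_gt0 d0); lra.
have kd : flatness n e = d / 50 by rewrite /flatness /e; field; exact: lt0r_neq0.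
have kp : 0 <= flatness n e by rewrite kd; lra.
have ks : flatness n e <= 1 / 16 by rewrite kd; lra.
exists e; split=> // N nN; have [m Nm] : exists m, N = (n + m)%N by exists (N - n)%N; lia.
subst N => x r f r0 [A [_ Aap]] emb qs E g CE Ecl Eb g0 CE0 Ediam Eint.
have A_approx y s z : enorm (y - x) <= 9 * r -> 0 < s -> enorm (z - x) <= 9 * r ->
    enorm (z - y) <= s ->
    enorm (f (plane_incl (n + m) z) - A y s z) <= e * op_norm (linear_part (A y s)) * s.
  move=> yx s0 zx zy; rewrite -lee_fin; apply: le_trans (Aap y s yx s0).
  by apply: ereal_sup_ubound; exists z.
have f_inj z w : enorm (z - x) <= 3 * r -> enorm (w - x) <= 3 * r ->
    f (plane_incl (n + m) z) = f (plane_incl (n + m) w) -> z = w.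
  move=> zx wx fzw; case: emb => _ [h [hK _]].
  have inb v : enorm (v - x) <= 3 * r ->
      plane_incl (n + m) v \in eball (plane_incl (n + m) x) (3 * r).
    by move=> vx; rewrite inE /eball /= plane_inclB enorm_plane_incl.
  have : plane_incl (n + m) z = plane_incl (n + m) w.
    by rewrite -(hK _ (inb z zx)) -(hK _ (inb w wx)) fzw.
  move/eqP; rewrite -subr_eq0 plane_inclB => /eqP zw; apply/eqP; rewrite -subr_eq0.
  by apply/eqP/enorm_eq0; rewrite -(enorm_plane_incl m) zw enorm0.
have f_qs : weak_qs (1 + e) (eball (plane_incl (n + m) x) (3 * r)) f.
  have [h [h0 he _ hqs]] := weak_qs_excessP qs.
  move=> p p' a Xp Xp' Xa pp'; apply: le_trans (hqs p p' a Xp Xp' Xa pp') _.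
  by rewrite ler_wpM2r ?enorm_ge0 // lerD2l.
have [y0 Ey0] : exists y, E y.
  apply: contrapT => noE; have [v v1] := exists_unit R hn.
  have : (ediam E <= 0%:E)%E by apply: ediam_le => // p p' Ep; exfalso; apply: noE; exists p.
  have dB : (r%:E <= ediam (eball x r))%E.
    apply: (@ediam_ge _ _ _ (x + r *: v) x).
    - by rewrite /eball /= [x + _]addrC addrK enormZ v1 mulr1 gtr0_norm.
    - by rewrite /eball /= subrr enorm0 ltW.
    - by rewrite [x + _]addrC addrK enormZ v1 mulr1 gtr0_norm.
  move=> /(le_trans Ediam); apply/negP; rewrite -ltNge.
  apply: lt_le_trans (lee_wpmul2l _ dB); last by rewrite lee_fin ltW.
  by rewrite -EFinM lte_fin mulr_gt0.
have Fl := F_flat hn r0 Eb Ecl e0 ks A_approx f_inj f_qs.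
set G := F x r f E A in Fl.
exists G; split; first exact: flat_quasisymmetric Fl.
split; first by move=> y Ey; exact: F_in.
split; first by apply: (flat_almost_affine kp ks _ Fl); rewrite kd; lra.
split; first by apply: (flat_weak_qs_excess kp ks _ Fl); rewrite kd; lra.
have [G1 G2] : ((op_norm (linear_part (A0 x r A)) * r)%:E <= ediam (G @` eball x r))%E /\
    (ediam (G @` eball x r) <= (3 * (op_norm (linear_part (A0 x r A)) * r))%:E)%E.
  apply: (near_A0_diam hn r0 e0 ks A_approx f_inj f_qs) => z _.
  exact: (F_far E hn r0 e0 A_approx).
have [f1 f2] : ((op_norm (linear_part (A0 x r A)) * r)%:E <=
      ediam ((fun z => f (plane_incl (n + m) z)) @` eball x r))%E /\
    (ediam ((fun z => f (plane_incl (n + m) z)) @` eball x r) <=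
      (3 * (op_norm (linear_part (A0 x r A)) * r))%:E)%E.
  apply: (near_A0_diam hn r0 e0 ks A_approx f_inj f_qs) => z zx.
  by apply: (A0_approx r0 A_approx); lra.
have fim : f @` (plane_incl (n + m) @` eball x r) =
    (fun z => f (plane_incl (n + m) z)) @` eball x r.
  by rewrite image_comp.
rewrite fim; split.
  apply: le_trans G1; apply: (@le_trans _ _ ((3^-1)%:E *
     (3 * (op_norm (linear_part (A0 x r A)) * r))%:E)%E).
    by apply: lee_wpmul2l => //; rewrite lee_fin invr_ge0.
  by rewrite -EFinM lee_fin mulKf.
split.
  by apply: le_trans G2 _; rewrite EFinM; apply: lee_wpmul2l => //; rewrite lee_fin.
move=> y.
have := beta_integral hn r0 Eb Ecl e0 ks A_approx f_inj f_qs y Ey0 Eint.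
move=> H; apply: le_trans H _; rewrite lee_fin /C' addKn.
have M0 := sqr_ge0 (mid_const R n m).
have ke : flatness n e <= eps by rewrite kd; lra.
have k2 : flatness n e ^+ 2 <= eps ^+ 2 by rewrite lerXn2r ?nnegrE // ltW.
have : 0 <= mid_const R n m ^+ 2 * eps ^+ 2 by rewrite mulr_ge0 ?sqr_ge0.
have : 0 <= mid_const R n m ^+ 2 * CE by rewrite mulr_ge0 // ltW.
by lra.
Qed.
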